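(* Let $I=[0,\infty[$, $\varepsilon\in C^2(I,I)$, $C\in C^1(I,\mathbb{R}^+)$ with $\overline{C}:=\inf_{t>0}C(t)>0$, $F\in C^1(\mathbb{R})$, $a'\in\mathbb{R}$, and let $a=a(x,t,u,u_x,u_t,u_{xx})$ be a given function. Write $\overline{\varepsilon}=\inf_{t>0}\varepsilon(t)$, $\overline{\ddot\varepsilon}=\inf_{t>0}\ddot\varepsilon(t)$. Consider, for $t_0\ge 0$, the problem $$-\varepsilon(t)u_{xxt}+u_{tt}-C(t)u_{xx}+(a'+a)u_t=F(u),\quad x\in\,]0,\pi[,\ t>t_0,\qquad u(0,t)=u(\pi,t)=0,$$ $$u(x,t_0)=u_0(x),\quad u_t(x,t_0)=u_1(x),\qquad u_0(0)=u_1(0)=u_0(\pi)=u_1(\pi)=0,$$ and its null solution $u^0\equiv 0$. Assume that there exist constants $k\ge0$, $h\ge0$, $A\ge0$, $\omega>0$, $\rho>0$, $\mu>0$, $\tau>0$ such that: 1. $F(0)=0$, and $F_z(z)\le k+h|z|^\omega$ whenever $|z|<\rho$; 2. $\overline{C}>k$; $\ C(t)-\dot\varepsilon(t)\ge\mu(1+\varepsilon(t))$ for all $t\in I$; $\ \mu+\overline{C}/2-2k>0$; $\ \overline{\ddot\varepsilon}>-\infty$; 3. $0\le a\le A\,d^\tau(u,u_t,t)$, and $a'+\overline{\varepsilon}/2>0$. Assume moreover that either $\dot C(t)\le0$ for all $t\in I$, or $\dot C(t)\to0$ as $t\to\infty$. Let $d$, $g$, $G$, $\sigma'_M$ be as defined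 in the context. Then: (i) if $\sigma'_M>0$, then $u^0$ is stable; (ii) if $\sigma'_M>0$ and moreover $\int_0^\infty\frac{dt}{g(t)}=\infty$, then $u^0$ is asymptotically stable; (iii) if $\sup_{t>0}g(t)<\infty$, then $u^0$ is uniformly stable and uniformly exponential-asymptotically stable.
   Context: Solutions $u$ are understood as sufficiently regular (classical) solutions on $[0,\pi]\times[t_0,\infty[$, i.e. with all derivatives appearing in the equation continuous. The bound $0\le a\le A\,d^\tau(u,u_t,t)$ means that $a$, evaluated at $(x,t,u,u_x,u_t,u_{xx})$, satisfies it for all $x,t$. A dot denotes $d/dt$. **Distance.** For functions $\varphi,\psi$ on $[0,\pi]$ vanishing at $0$ and $\pi$, $$d^2(\varphi,\psi,t):=\int_0^\pi[\varepsilon^2(t)\varphi_{xx}^2+\varphi_x^2+\varphi^2+\psi^2]\,dx .$$ For a solution $u$ put $d(t):=d(u(\cdot,t),u_t(\cdot,t),t)$. **Stability notions.** In these, $\kappa\in\mathbb{R}$ and $\xi>0$ are suitable constants (the assertions are that such constants exist), $I_\kappa:=[\kappa,\infty[$, and the initial time satisfies $t_0\in I_\kappa$, $t_0\ge 0$. - $u^0$ is *stable* if for every $\sigma\in\,]0,\xi]$ and every $t_0\in I_\kappa$ there is $\delta(\sigma,t_0)>0$ such that for every solution, $d(t_0)<\delta(\sigma,t_0)$ implies $d(t)<\sigma$ for all $t\ge t_0$. It is *uniformly stable* if $\delta$ can be chosen independent of $t_0$. - $u^0$ is *asymptotically stable* if it is stable and for every $t_0\in I_\kappa$ there is $\delta(t_0)>0$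 such that for every $\nu>0$ and every solution with $d(t_0)<\delta(t_0)$ there is $T=T(\nu,t_0,u_0,u_1)>0$ with $d(t)<\nu$ for all $t\ge t_0+T$. - $u^0$ is *uniformly exponential-asymptotically stable* if there are constants $\delta,D,E>0$ such that for all $t_0\in I_\kappa$ and every solution, $d(t_0)<\delta$ implies $d(t)\le D\exp[-E(t-t_0)]\,d(t_0)$ for all $t\ge t_0$. **Auxiliary quantities.** Define $$g(t):=C(t)-\tfrac{\dot\varepsilon(t)}{2}+1,\qquad \eta:=\min\{1,\tfrac34\mu\},\qquad m(r):=\max\{|F_\zeta(\zeta)|:\ |\zeta|\le r\}.$$ (By hypothesis 2, $g>1$.) Fix any constant $\theta>\theta_2$, where $$\theta_1:=\max\Big\{2a',\ \tfrac{2k}{\mu}-a',\ \tfrac{5-\overline{\ddot\varepsilon}-a'(\mu-\overline{C})}{\mu+\overline{C}/2-2k}\Big\},\qquad \theta_2:=\max\Big\{\theta_1,\ \tfrac{\overline{C}+5/4}{a'+\overline{\varepsilon}/2}\Big\}.$$ For $\sigma>0$ put $$\gamma_3(\sigma):=\frac{1+\theta+\overline{\varepsilon}/2}{a'+\overline{\varepsilon}}+\theta^2+2+\frac{a'+\theta}{\mu}+(a'+1)\theta+\frac{A^2}{a'+\overline{\varepsilon}}\Big(\frac1\mu+\frac{\theta}{\overline{C}}\Big)\sigma^{2\tau},$$ $$\lambda(\sigma):=\frac{\eta}{[1+m(\sigma)][1+\gamma_3(\sigma)]},\qquad G(\sigma):=h\int_0^\infty \exp\Big(-\frac{\omega\lambda(\sigma)}{2}\int_0^{s}\frac{ds'}{g(s')}\Big)\,g(s)\,ds,$$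 with $G\equiv0$ if $h=0$, and $$\sigma'_M:=\sup\{\sigma\in\mathbb{R}^+:\ G(\sigma)<\infty\}\in[0,\infty]$$ (with $\sup\emptyset=0$). *)

(* Defs.v *)
(* Classical real analysis: Stdlib reals with Coquelicot. *)
From Stdlib Require Export Reals.
From Coquelicot Require Export Coquelicot.
Open Scope R_scope.

(* Derivatives are taken within the domain of the function, hence one-sided at
   the end points of an interval: values off the domain never matter. For
   [D := fun _ => True] this amounts to [is_derive]. *)
Definition is_derive_in (D : R -> Prop) (f : R -> R) (x l : R) : Prop :=
  filterdiff f (within D (locally x)) (fun y => scal y l).

Definition ex_derive_in (D : R -> Prop) (f : R -> R) (x : R) : Prop :=
  exists l, is_derive_in D f x l.

Definition derive_in (D : R -> Prop) (f : R -> R) (x : R) : R :=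
  iota (is_derive_in D f x).

Definition C1_on (D : R -> Prop) (f : R -> R) : Prop :=
  (forall x, D x -> ex_derive_in D f x) /\ continuous_on D (derive_in D f).

Definition C2_on (D : R -> Prop) (f : R -> R) : Prop :=
  C1_on D f /\ C1_on D (derive_in D f).

Definition from (t0 : R) : R -> Prop := fun t => t0 <= t.
Definition I0pi : R -> Prop := fun x => 0 <= x <= PI.
Definition strip (t0 : R) : R * R -> Prop := fun p => I0pi (fst p) /\ from t0 (snd p).

(* The derivative of a function on [0, oo[. *)
Definition dot (f : R -> R) : R -> R := derive_in (from 0) f.

Definition inf_pos (f : R -> R) : Rbar := Glb_Rbar (fun y => exists t, 0 < t /\ y = f t).
Definition sup_pos (f : R -> R) : Rbar := Lub_Rbar (fun y => exists t, 0 < t /\ y = f t).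

(* The power x ^ y for x >= 0 and y > 0. [Rpower] cannot be used at x = 0,
   where it returns 1. *)
Definition rpow (x y : R) : R := if Rlt_dec 0 x then Rpower x y else 0.

(* Integral over [0, oo[ of a nonnegative function, as an extended real. *)
Definition integral_0_infty (f : R -> R) : Rbar := Lim (fun T => RInt f 0 T) p_infty.

(* Partial derivatives on the strip [0, pi] x [t0, oo[; those in [x] do not
   depend on [t0]. *)
Definition d_x (u : R -> R -> R) : R -> R -> R :=
  fun x t => derive_in I0pi (fun y => u y t) x.
Definition d_t (t0 : R) (u : R -> R -> R) : R -> R -> R :=
  fun x t => derive_in (from t0) (fun s => u x s) t.

Definition has_cont_d_x (t0 : R) (u : R -> R -> R) : Prop :=
  (forall x t, I0pi x -> from t0 t -> ex_derive_in I0pi (fun y => u y t) x) /\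
  continuous_on (strip t0) (fun p => d_x u (fst p) (snd p)).
Definition has_cont_d_t (t0 : R) (u : R -> R -> R) : Prop :=
  (forall x t, I0pi x -> from t0 t -> ex_derive_in (from t0) (fun s => u x s) t) /\
  continuous_on (strip t0) (fun p => d_t t0 u (fst p) (snd p)).

(* u, u_x, u_xx, u_xxt, u_t and u_tt exist and are continuous on the strip. *)
Definition classical (t0 : R) (u : R -> R -> R) : Prop :=
  continuous_on (strip t0) (fun p => u (fst p) (snd p)) /\
  has_cont_d_x t0 u /\
  has_cont_d_x t0 (d_x u) /\
  has_cont_d_t t0 (d_x (d_x u)) /\
  has_cont_d_t t0 u /\
  has_cont_d_t t0 (d_t t0 u).

(* The coefficient [a], as a function of (x, t, u, u_x, u_t, u_xx), along u. *)
Definition along (a : R -> R -> R -> R -> R -> R -> R) (t0 : R) (u : R -> R -> R)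
    (x t : R) : R :=
  a x t (u x t) (d_x u x t) (d_t t0 u x t) (d_x (d_x u) x t).

Definition is_solution (eps C F : R -> R) (a' : R) (a : R -> R -> R -> R -> R -> R -> R)
    (t0 : R) (u0 u1 : R -> R) (u : R -> R -> R) : Prop :=
  classical t0 u /\
  (forall x t, 0 < x < PI -> t0 < t ->
     - eps t * d_t t0 (d_x (d_x u)) x t + d_t t0 (d_t t0 u) x t
       - C t * d_x (d_x u) x t + (a' + along a t0 u x t) * d_t t0 u x t
     = F (u x t)) /\
  (forall t, t0 <= t -> u 0 t = 0 /\ u PI t = 0) /\
  (forall x, I0pi x -> u x t0 = u0 x /\ d_t t0 u x t0 = u1 x) /\
  (u0 0 = 0 /\ u1 0 = 0 /\ u0 PI = 0 /\ u1 PI = 0).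

Definition dist2 (eps : R -> R) (phi psi : R -> R) (t : R) : R :=
  RInt (fun x => (eps t)^2 * (derive_in I0pi (derive_in I0pi phi) x)^2
                 + (derive_in I0pi phi x)^2 + (phi x)^2 + (psi x)^2) 0 PI.

Definition dist (eps : R -> R) (phi psi : R -> R) (t : R) : R :=
  sqrt (dist2 eps phi psi t).

Definition dsol (eps : R -> R) (t0 : R) (u : R -> R -> R) (t : R) : R :=
  dist eps (fun x => u x t) (fun x => d_t t0 u x t) t.

(* In the stability notions [sol t0 u0 u1 u] says that u is a solution on
   [t0, oo[ with initial data (u0, u1). *)
Definition stable_with (kappa xi : R) (eps : R -> R)
    (sol : R -> (R -> R) -> (R -> R) -> (R -> R -> R) -> Prop) : Prop :=
  forall sigma t0, 0 < sigma <= xi -> kappa <= t0 -> 0 <= t0 ->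
  exists delta, 0 < delta /\
    forall u0 u1 u, sol t0 u0 u1 u -> dsol eps t0 u t0 < delta ->
    forall t, t0 <= t -> dsol eps t0 u t < sigma.

Definition stable (eps : R -> R)
    (sol : R -> (R -> R) -> (R -> R) -> (R -> R -> R) -> Prop) : Prop :=
  exists kappa xi, 0 < xi /\ stable_with kappa xi eps sol.

Definition uniformly_stable (eps : R -> R)
    (sol : R -> (R -> R) -> (R -> R) -> (R -> R -> R) -> Prop) : Prop :=
  exists kappa xi, 0 < xi /\
  forall sigma, 0 < sigma <= xi ->
  exists delta, 0 < delta /\
    forall t0, kappa <= t0 -> 0 <= t0 ->
    forall u0 u1 u, sol t0 u0 u1 u -> dsol eps t0 u t0 < delta ->
    forall t, t0 <= t -> dsol eps t0 u t < sigma.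

(* T depends on nu, t0 and the initial data only. *)
Definition asymptotically_stable (eps : R -> R)
    (sol : R -> (R -> R) -> (R -> R) -> (R -> R -> R) -> Prop) : Prop :=
  exists kappa xi, 0 < xi /\ stable_with kappa xi eps sol /\
  forall t0, kappa <= t0 -> 0 <= t0 ->
  exists delta, 0 < delta /\
    forall nu u0 u1, 0 < nu ->
    exists T, 0 < T /\
      forall u, sol t0 u0 u1 u -> dsol eps t0 u t0 < delta ->
      forall t, t0 + T <= t -> dsol eps t0 u t < nu.

Definition uniformly_exp_asymptotically_stable (eps : R -> R)
    (sol : R -> (R -> R) -> (R -> R) -> (R -> R -> R) -> Prop) : Prop :=
  exists kappa delta D E, 0 < delta /\ 0 < D /\ 0 < E /\
  forall t0, kappa <= t0 -> 0 <= t0 ->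
  forall u0 u1 u, sol t0 u0 u1 u -> dsol eps t0 u t0 < delta ->
  forall t, t0 <= t -> dsol eps t0 u t <= D * exp (- E * (t - t0)) * dsol eps t0 u t0.

Definition g (eps C : R -> R) (t : R) : R := C t - dot eps t / 2 + 1.

Definition eta (mu : R) : R := Rmin 1 (3 / 4 * mu).

Definition m (F : R -> R) (r : R) : R :=
  real (Lub_Rbar (fun y => exists z, Rabs z <= r /\ y = Rabs (Derive F z))).

(* Below [ebar], [eddbar] and [Cbar] stand for the infima of eps, of its second
   derivative and of C. *)
Definition theta1 (a' k mu eddbar Cbar : R) : R :=
  Rmax (2 * a')
    (Rmax (2 * k / mu - a')
          ((5 - eddbar - a' * (mu - Cbar)) / (mu + Cbar / 2 - 2 * k))).

Definition theta2 (a' k mu ebar eddbar Cbar : R) : R :=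
  Rmax (theta1 a' k mu eddbar Cbar) ((Cbar + 5 / 4) / (a' + ebar / 2)).

Definition gamma3 (a' A mu tau theta ebar Cbar sigma : R) : R :=
  (1 + theta + ebar / 2) / (a' + ebar) + theta^2 + 2 + (a' + theta) / mu
  + (a' + 1) * theta
  + A^2 / (a' + ebar) * (1 / mu + theta / Cbar) * rpow sigma (2 * tau).

Definition lambda (F : R -> R) (a' A mu tau theta ebar Cbar sigma : R) : R :=
  eta mu / ((1 + m F sigma) * (1 + gamma3 a' A mu tau theta ebar Cbar sigma)).

Definition G (eps C F : R -> R) (a' h A omega mu tau theta sigma : R) : Rbar :=
  if Req_EM_T h 0 then Finite 0
  else
    Rbar_mult h
      (integral_0_infty (fun s =>
         exp (- (omega * lambda F a' A mu tau theta (real (inf_pos eps))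
                    (real (inf_pos C)) sigma / 2)
              * RInt (fun s' => / g eps C s') 0 s)
         * g eps C s)).

(* Adding 0 to the set gives the convention that the supremum of the empty set
   is 0 and changes nothing otherwise. *)
Definition sigma'_M (eps C F : R -> R) (a' h A omega mu tau theta : R) : Rbar :=
  Lub_Rbar (fun sigma => sigma = 0 \/
    (0 < sigma /\ Rbar_lt (G eps C F a' h A omega mu tau theta sigma) p_infty)).

(* Main.v *)
(* The Liapunov functional is, with [v = u_t] and [Phi] the primitive of [F],
     2 V = (1 + gamma) |v|^2 + |eps u_xx|^2 - 2 <eps u_xx, v>
           + (C (1 + gamma) - eps' + eps (a' + theta)) |u_x|^2
           + a' theta |u|^2 + 2 theta <u, v> - 2 (1 + gamma) int Phi(u),
   with [gamma = gamma3 sigma]. As long as [d] is small, [c0 d^2 <= V <= Lam g d^2] and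
   [V' <= - eta d^2 + n h g d^omega d^2], where [Lam = (1 + m) (1 + gamma)] is such that
   [lambda = eta / Lam]. With [p' = lambda / g], a barrier argument on [d^2 exp p] turns
   [G sigma < oo] into smallness of the integral of the superlinear term and yields
   [d^2 <= K exp (- (p - p t0)) d^2(t0)], with uniform constants when [g] is bounded. *)
Require Import Defs.
From Stdlib Require Import Lra Psatz Classical.

(** * Calculus on [0, PI] *)

(** The damping [(a' + a) u_t] cannot carry the decay alone: [a'] may be negative, and it does not
    act on [u]. The strong damping contributes [- gamma eps |v_x|^2], which by Poincare turns [a']
    into [a' + ebar]; the cross terms [<eps u_xx, v>] and [<u, v>] produce the dissipation of [u_xx]
    and [u_x]. The coefficients of [|u_x|^2] and [|u|^2] in [V] are those for which [<u_xx, v>] and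
    [<u, v>] drop out of [V']. Then [theta] is taken large enough for [|u_x|^2] to get a negative
    coefficient, and [gamma] for [|v|^2] to absorb the terms in [a u_t]. The derivative of [C]
    enters through [dot C (1 + gamma) |u_x|^2 / 2]; if [dot C] merely tends to 0, this is controlled
    only from some time [kappa] on. The upper bound of [V] carries the factor [g], possibly
    unbounded, so the linear rate is [lambda / g] and may tend to 0: smallness of [d] alone then
    does not make the superlinear term negligible, and [G] is needed. *)

Definition continuous2 (f : R -> R -> R) : Prop := forall x t, continuity_2d_pt f x t.

Lemma continuous2_slice f t : continuous2 f -> forall x, continuous (fun y => f y t) x.
Proof.
intros Hf x P [e He].
destruct (Hf x t e) as [d Hd].
exists d; intros y Hy; apply He.
apply Hd; [exact Hy|].
rewrite Rminus_eq_0, Rabs_R0; apply cond_pos.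
Qed.

Lemma continuous2_swap f : continuous2 f -> continuous2 (fun t x => f x t).
Proof.
intros Hf t x e; destruct (Hf x t e) as [d Hd].
exists d; intros u v Hu Hv; now apply Hd.
Qed.

Lemma continuous2_plus f g :
  continuous2 f -> continuous2 g -> continuous2 (fun x t => f x t + g x t).
Proof. intros Hf Hg x t; now apply continuity_2d_pt_plus. Qed.

Lemma continuous2_mult f g :
  continuous2 f -> continuous2 g -> continuous2 (fun x t => f x t * g x t).
Proof. intros Hf Hg x t; now apply continuity_2d_pt_mult. Qed.

Lemma continuous2_fst f : (forall x, continuous f x) -> continuous2 (fun x _ => f x).
Proof.
intros Hf x t; apply (continuity_1d_2d_pt_comp f (fun x _ => x)).
- apply continuity_pt_filterlim, Hf.
- apply continuity_2d_pt_id1.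
Qed.

Lemma continuous2_comp F f :
  (forall z, continuous F z) -> continuous2 f -> continuous2 (fun x t => F (f x t)).
Proof.
intros HF Hf x t; apply continuity_1d_2d_pt_comp; [|apply Hf].
apply continuity_pt_filterlim, HF.
Qed.

Lemma ex_RInt_continuous_all (f : R -> R) a b :
  (forall x, continuous f x) -> ex_RInt f a b.
Proof. intros Hf; apply (ex_RInt_continuous f); auto. Qed.

Lemma RInt_Rplus (f g : R -> R) a b :
  (forall x, continuous f x) -> (forall x, continuous g x) ->
  RInt (fun x => f x + g x) a b = RInt f a b + RInt g a b.
Proof. intros Hf Hg; apply (RInt_plus f g); now apply ex_RInt_continuous_all. Qed.

Lemma RInt_Rscal (f : R -> R) c a b :
  (forall x, continuous f x) -> RInt (fun x => c * f x) a b = c * RInt f a b.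
Proof. intros Hf; apply (RInt_scal f); now apply ex_RInt_continuous_all. Qed.

Lemma RInt_Ropp (f : R -> R) a b :
  (forall x, continuous f x) -> RInt (fun x => - f x) a b = - RInt f a b.
Proof. intros Hf; apply (RInt_opp f); now apply ex_RInt_continuous_all. Qed.

Lemma RInt_slice_continuous f b :
  continuous2 f -> 0 <= b -> forall t, continuous (fun s => RInt (fun x => f x s) 0 b) t.
Proof.
intros Hf Hb t.
apply continuity_pt_filterlim.
intros e He.
(* Dividing by [b + 1] instead of [b] covers [b = 0]. *)
assert (He' : 0 < e / (b + 1)) by (apply Rdiv_lt_0_compat; lra).
destruct (uniform_continuity_2d_1d f 0 b t (fun x _ => Hf x t) (mkposreal _ He'))
  as [d Hd].
exists d; split; [apply cond_pos|].
intros s [_ Hs].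
change (Rabs (minus (RInt (fun x => f x s) 0 b) (RInt (fun x => f x t) 0 b)) < e).
change (Rabs (s - t) < d) in Hs.
assert (Hds := cond_pos d).
apply Rabs_def2 in Hs.
assert (E1 : ex_RInt (fun x => f x s) 0 b)
  by (apply ex_RInt_continuous_all; now apply continuous2_slice).
assert (E2 : ex_RInt (fun x => f x t) 0 b)
  by (apply ex_RInt_continuous_all; now apply continuous2_slice).
rewrite <- (RInt_minus _ _ _ _ E1 E2).
apply Rle_lt_trans with ((b - 0) * (e / (b + 1))).
- apply (abs_RInt_le_const (fun x => minus (f x s) (f x t))); [lra| |].
  + now apply (ex_RInt_minus (fun x => f x s) (fun x => f x t)).
  + intros x Hx; apply Rlt_le.
    apply (Hd x t x s); try lra.
    rewrite Rminus_eq_0, Rabs_R0; apply cond_pos.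
- apply Rmult_lt_reg_r with (b + 1); [lra|].
  field_simplify; nra.
Qed.

Lemma is_derive_RInt_slice f ft t0 b :
  continuous2 f -> continuous2 ft -> 0 <= b ->
  (forall x s, t0 < s -> is_derive (fun r => f x r) s (ft x s)) ->
  forall t, t0 < t ->
  is_derive (fun s => RInt (fun x => f x s) 0 b) t (RInt (fun x => ft x t) 0 b).
Proof.
intros Cf Cft Hb Df t Ht.
rewrite (RInt_ext (fun x => ft x t) (fun x => Derive (fun s => f x s) t)).
2:{ intros x _; symmetry; now apply is_derive_unique, Df. }
assert (Ht' : 0 < t - t0) by lra.
apply (is_derive_RInt_param (fun s x => f x s)).
- exists (mkposreal _ Ht'); intros s Hs x _.
  change (Rabs (s - t) < t - t0) in Hs; apply Rabs_def2 in Hs.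
  exists (ft x s); apply Df; lra.
- intros x _.
  apply (continuity_2d_pt_ext_loc (fun s y => ft y s)).
  + exists (mkposreal _ Ht'); simpl; intros s y Hs _; apply Rabs_def2 in Hs.
    symmetry; apply is_derive_unique, Df; lra.
  + apply (continuous2_swap ft Cft).
- apply filter_forall; intros s.
  apply ex_RInt_continuous_all; now apply continuous2_slice.
Qed.

Lemma is_derive_RInt_upper (f : R -> R) a :
  (forall x, continuous f x) -> forall x, is_derive (fun y => RInt f a y) x (f x).
Proof.
intros Hf x; apply (is_derive_RInt f (fun y => RInt f a y) a); [|apply Hf].
apply filter_forall; intros y; apply (RInt_correct f).
now apply ex_RInt_continuous_all.
Qed.

Lemma is_derive_continuous (f : R -> R) x l : is_derive f x l -> continuous f x.
Proof. intros H; apply (ex_derive_continuous f); now exists l. Qed.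

(** Nothing is asked of the derivative at the end points, where the extended solutions need not have
    one: [f] minus a primitive of [df] is continuous with zero derivative inside, hence constant. *)
Lemma FTC_interior (f df : R -> R) a b :
  a <= b -> (forall x, a <= x <= b -> continuous f x) -> (forall x, continuous df x) ->
  (forall x, a < x < b -> is_derive f x (df x)) ->
  RInt df a b = f b - f a.
Proof.
intros Hab Cf Cdf Df.
assert (HD : forall y, is_derive (fun y => RInt df a y) y (df y))
  by (apply is_derive_RInt_upper, Cdf).
destruct (MVT_gen (fun x => minus (f x) (RInt df a x)) a b (fun _ => 0))
  as [c [_ Hc]].
- rewrite Rmin_left, Rmax_right by lra; intros x Hx.
  replace 0 with (minus (df x) (df x)) by (apply (minus_eq_zero (df x))).
  apply (is_derive_minus f (fun x => RInt df a x)); auto.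
- rewrite Rmin_left, Rmax_right by lra; intros x Hx.
  apply continuity_pt_filterlim.
  apply (continuous_minus f (fun x => RInt df a x)); [now apply Cf|].
  eapply is_derive_continuous, HD.
- rewrite (RInt_point a df) in Hc.
  unfold minus, plus, opp, zero in Hc; simpl in Hc; lra.
Qed.

Lemma RInt_by_parts (f df g dg : R -> R) b :
  0 <= b ->
  (forall x, continuous f x) -> (forall x, continuous df x) ->
  (forall x, continuous g x) -> (forall x, continuous dg x) ->
  (forall x, 0 < x < b -> is_derive f x (df x)) ->
  (forall x, 0 < x < b -> is_derive g x (dg x)) ->
  f 0 = 0 -> f b = 0 ->
  RInt (fun x => f x * dg x) 0 b = - RInt (fun x => df x * g x) 0 b.
Proof.
intros Hb Cf Cdf Cg Cdg Df Dg F0 Fb.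
assert (C1 : forall x, continuous (fun x => df x * g x) x)
  by (intros x; now apply (continuous_mult df g)).
assert (C2 : forall x, continuous (fun x => f x * dg x) x)
  by (intros x; now apply (continuous_mult f dg)).
assert (H : RInt (fun x => df x * g x + f x * dg x) 0 b = f b * g b - f 0 * g 0).
{ apply (FTC_interior (fun x => f x * g x)); auto.
  - intros x _; now apply (continuous_mult f g).
  - intros x; now apply (continuous_plus (fun x => df x * g x) (fun x => f x * dg x)).
  - intros x Hx; apply (is_derive_mult f g); auto; intros; apply Rmult_comm. }
rewrite F0, Fb in H.
rewrite RInt_Rplus in H by assumption; lra.
Qed.

Lemma RInt_ge_0_continuous (f : R -> R) a b :
  a <= b -> (forall x, continuous f x) -> (forall x, a < x < b -> 0 <= f x) ->
  0 <= RInt f a b.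
Proof. intros; apply RInt_ge_0; auto; now apply ex_RInt_continuous_all. Qed.

Lemma is_derive_tan_affine l x :
  0 < l < 1 -> 0 <= x <= PI ->
  is_derive (fun y => tan (l * (y - PI / 2))) x
    (l * (1 + tan (l * (x - PI / 2)) ^ 2)).
Proof.
intros Hl Hx.
assert (HP := PI_RGT_0).
assert (Hc : 0 < cos (l * (x - PI / 2))) by (apply cos_gt_0; nra).
unfold tan; auto_derive; [unfold minus; apply Rgt_not_eq, Hc|].
change (x + - (PI / 2)) with (x - PI / 2); field; lra.
Qed.

(* With [r = tan (l (x - PI/2))], which is smooth on [0, PI] for [l < 1],
   [f'^2 - l^2 f^2 = (f' + l r f)^2 - (l r f^2)'] ; then let [l] tend to [1]. *)
Lemma Poincare (f df : R -> R) :
  (forall x, continuous f x) -> (forall x, continuous df x) ->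
  (forall x, 0 < x < PI -> is_derive f x (df x)) ->
  f 0 = 0 -> f PI = 0 ->
  RInt (fun x => f x * f x) 0 PI <= RInt (fun x => df x * df x) 0 PI.
Proof.
intros Cf Cdf Df F0 FP.
assert (HP := PI_RGT_0).
set (I1 := RInt (fun x => f x * f x) 0 PI).
set (I2 := RInt (fun x => df x * df x) 0 PI).
assert (Cff : forall x, continuous (fun x => f x * f x) x)
  by (intros x; now apply (continuous_mult f f)).
assert (Cdd : forall x, continuous (fun x => df x * df x) x)
  by (intros x; now apply (continuous_mult df df)).
assert (I1_ge : 0 <= I1) by (apply RInt_ge_0_continuous; auto; intros; [lra|nra]).
assert (Hl : forall l, 0 < l < 1 -> l ^ 2 * I1 <= I2).
{ intros l Hl.
  set (r := fun x => tan (l * (x - PI / 2))).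
  set (J := fun x => RInt (fun x => df x * df x) 0 x - l ^ 2 * RInt (fun x => f x * f x) 0 x
                     + l * (r x * (f x * f x))).
  assert (Cr : forall x, 0 <= x <= PI -> continuous r x)
    by (intros x Hx; eapply is_derive_continuous; now apply is_derive_tan_affine).
  destruct (MVT_gen J 0 PI (fun x => (df x + l * r x * f x) ^ 2)) as [c [_ Hc]].
  - rewrite Rmin_left, Rmax_right by lra; intros x Hx.
    assert (D1 := is_derive_RInt_upper _ 0 Cdd x).
    assert (D2 := is_derive_RInt_upper _ 0 Cff x).
    assert (D3 := Df x Hx).
    assert (D4 : is_derive r x (l * (1 + r x ^ 2)))
      by (apply is_derive_tan_affine; lra).
    unfold J; auto_derive.
    + repeat split; try (now exists (df x)); try (now eexists; apply D4);
        apply ex_RInt_continuous_all || idtac; auto;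
        try (apply filter_forall; intros; now apply continuity_pt_filterlim, Cdd);
        try (apply filter_forall; intros; now apply continuity_pt_filterlim, Cff).
    + replace (Derive (fun x0 : R => f x0) x) with (df x) by (symmetry; now apply is_derive_unique).
      replace (Derive (fun x0 : R => r x0) x) with (l * (1 + r x ^ 2))
        by (symmetry; now apply is_derive_unique).
      ring.
  - rewrite Rmin_left, Rmax_right by lra; intros x Hx.
    apply continuity_pt_filterlim.
    apply (continuous_plus (fun x => RInt (fun x => df x * df x) 0 x - l ^ 2 * RInt (fun x => f x * f x) 0 x)
             (fun x => l * (r x * (f x * f x)))).
    + apply (continuous_minus (fun x => RInt (fun x => df x * df x) 0 x)
               (fun x => l ^ 2 * RInt (fun x => f x * f x) 0 x)).
      * eapply is_derive_continuous, (is_derive_RInt_upper _ 0 Cdd).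
      * apply (continuous_mult (fun _ => l ^ 2)); [apply continuous_const|].
        eapply is_derive_continuous, (is_derive_RInt_upper _ 0 Cff).
    + apply (continuous_mult (fun _ => l)); [apply continuous_const|].
      apply (continuous_mult r); auto.
  - unfold J in Hc; rewrite !RInt_point, F0, FP in Hc.
    unfold zero in Hc; simpl in Hc; fold I1 I2 in Hc.
    assert (0 <= (df c + l * r c * f c) ^ 2) by apply pow2_ge_0.
    simpl in *; nra. }
destruct (Rle_lt_dec I1 I2) as [|Hlt]; [assumption|exfalso].
assert (I2_ge : 0 <= I2) by (apply RInt_ge_0_continuous; auto; intros; [lra|nra]).
(* For [l = 1 - e] with this [e], [l^2 I1 >= (1 - 2 e) I1 = (I1 + I2) / 2 > I2]. *)
assert (Hx : 0 < (I1 - I2) / (4 * I1) < 1).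
{ split; [apply Rdiv_lt_0_compat; lra|].
  apply Rmult_lt_reg_r with (4 * I1); [lra|]; field_simplify; lra. }
assert (He : (I1 - I2) / (4 * I1) * I1 = (I1 - I2) / 4) by (field; lra).
set (e := (I1 - I2) / (4 * I1)) in *.
assert (Hm := Hl (1 - e) ltac:(lra)).
nra.
Qed.

(** Integrate [(f^2)' = 2 f f' <= f'^2 + f^2] from 0. With constant 1, [d] itself bounds [|u|], so a
    small [d] keeps [u] in the range where the bound on [F'] holds. *)
Lemma sup_bound (f df : R -> R) :
  (forall x, continuous f x) -> (forall x, continuous df x) ->
  (forall x, 0 < x < PI -> is_derive f x (df x)) ->
  f 0 = 0 ->
  forall x, 0 <= x <= PI ->
  f x ^ 2 <= RInt (fun x => df x * df x) 0 PI + RInt (fun x => f x * f x) 0 PI.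
Proof.
intros Cf Cdf Df F0 x Hx.
assert (Cff : forall x, continuous (fun x => f x * f x) x)
  by (intros y; now apply (continuous_mult f f)).
assert (Cdd : forall x, continuous (fun x => df x * df x) x)
  by (intros y; now apply (continuous_mult df df)).
assert (Cdf' : forall x, continuous (fun x => df x * f x + f x * df x) x).
{ intros y; apply (continuous_plus (fun x => df x * f x) (fun x => f x * df x));
  [now apply (continuous_mult df f)|now apply (continuous_mult f df)]. }
assert (Cs : forall x, continuous (fun x => df x * df x + f x * f x) x)
  by (intros y; now apply (continuous_plus (fun x => df x * df x) (fun x => f x * f x))).
assert (H : RInt (fun x => df x * f x + f x * df x) 0 x = f x * f x - f 0 * f 0).
{ apply (FTC_interior (fun x => f x * f x)); auto; [lra|].
  intros y Hy; apply (is_derive_mult f f); try (apply Df; lra); intros; apply Rmult_comm. }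
rewrite <- RInt_Rplus by assumption.
rewrite <- (RInt_Chasles _ 0 x PI) by now apply ex_RInt_continuous_all.
assert (H1 : RInt (fun x => df x * f x + f x * df x) 0 x
             <= RInt (fun x => df x * df x + f x * f x) 0 x).
{ apply RInt_le; [lra|now apply ex_RInt_continuous_all|now apply ex_RInt_continuous_all|].
  intros y _; unfold plus; simpl.
  assert (0 <= (df y - f y) ^ 2) by apply pow2_ge_0; nra. }
assert (H2 : 0 <= RInt (fun x => df x * df x + f x * f x) x PI).
{ apply RInt_ge_0_continuous; auto; [lra|].
  intros y _;  nra. }
unfold plus at 1; simpl.
rewrite F0 in H; lra.
Qed.

(** * Barriers for differential inequalities *)

(** A continuation argument: at the supremum of the times up to which [f] stays positive, the last
    hypothesis gives positivity and continuity carries it further. *)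
Lemma first_exit (f : R -> R) t0 :
  (forall t, t0 <= t -> continuous f t) -> 0 < f t0 ->
  (forall t1, t0 < t1 -> (forall s, t0 <= s < t1 -> 0 < f s) -> 0 < f t1) ->
  forall t, t0 <= t -> 0 < f t.
Proof.
intros Cf H0 Hstep t Ht.
destruct (Rlt_le_dec 0 (f t)) as [|Hn]; [assumption|exfalso].
set (E := fun s => t0 <= s <= t /\ forall r, t0 <= r <= s -> 0 < f r).
destruct (completeness E) as [m [Hub Hlub]].
- exists t; intros s [Hs _]; lra.
- exists t0; split; [lra|]; intros r Hr; now replace r with t0 by lra.
- assert (Hm0 : t0 <= m).
  { apply Hub; split; [lra|]; intros r Hr; now replace r with t0 by lra. }
  assert (Hmt : m <= t) by (apply Hlub; intros s [Hs _]; lra).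
  assert (Hbelow : forall s, t0 <= s < m -> 0 < f s).
  { intros s Hs; destruct (Rlt_le_dec 0 (f s)) as [|Hs']; [assumption|exfalso].
    assert (m <= s); [|lra].
    apply Hlub; intros r [Hr Hr'].
    destruct (Rle_lt_dec r s); [assumption|].
    assert (0 < f s) by (apply Hr'; lra); lra. }
  assert (Hfm : 0 < f m).
  { destruct (Rle_lt_or_eq_dec _ _ Hm0) as [Hlt|<-]; [|assumption].
    now apply Hstep. }
  destruct (Cf m Hm0 (fun y => 0 < y)) as [d Hd].
  { exists (mkposreal _ Hfm); intros y Hy.
    change (Rabs (y - f m) < f m) in Hy; apply Rabs_def2 in Hy; lra. }
  assert (Hlt : m < t) 
    by (destruct (Rle_lt_or_eq_dec _ _ Hmt) as [?|Heq]; [assumption|rewrite Heq in Hfm; lra]).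
  assert (Hdp := cond_pos d).
  set (s := Rmin t (m + d / 2)).
  assert (Hs : m < s <= m + d / 2 /\ s <= t).
  { unfold s; split; [split|]; [apply Rmin_glb_lt; lra|apply Rmin_r|apply Rmin_l]. }
  assert (s <= m); [|lra].
  apply Hub; split; [lra|].
  intros r Hr; destruct (Rlt_le_dec r m); [apply Hbelow; lra|].
  apply Hd; change (Rabs (r - m) < d); apply Rabs_def1; lra.
Qed.

(** [V exp (- Q)] has nonpositive derivative on the interval; at [t0] continuity suffices. *)
Lemma Gronwall (V V' Q r : R -> R) t0 t1 :
  t0 <= t1 ->
  (forall t, t0 <= t -> continuous V t) -> (forall t, t0 <= t -> continuous Q t) ->
  (forall t, t0 < t -> is_derive V t (V' t)) ->
  (forall t, t0 < t -> is_derive Q t (r t)) ->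
  (forall t, t0 < t <= t1 -> V' t <= r t * V t) ->
  V t1 <= V t0 * exp (Q t1 - Q t0).
Proof.
intros H01 CV CQ DV DQ Hle.
set (phi := fun t => V t * exp (- Q t)).
(* The intermediate point may be [t0], where no derivative is known; the value 0 chosen there still
   yields [phi t1 <= phi t0]. *)
destruct (MVT_gen phi t0 t1
  (fun t => if Rlt_dec t0 t then (V' t - r t * V t) * exp (- Q t) else 0))
  as [c [Hc Heq]].
- rewrite Rmin_left, Rmax_right by lra; intros t Ht.
  destruct (Rlt_dec t0 t) as [_|]; [|lra].
  assert (D1 := DV t (proj1 Ht)); assert (D2 := DQ t (proj1 Ht)).
  unfold phi; auto_derive.
  + repeat split; eexists; [apply D1|apply D2].
  + replace (Derive (fun x : R => V x) t) with (V' t)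
      by (symmetry; now apply is_derive_unique).
    replace (Derive (fun x : R => Q x) t) with (r t)
      by (symmetry; now apply is_derive_unique).
    ring.
- rewrite Rmin_left, Rmax_right by lra; intros t Ht.
  apply continuity_pt_filterlim.
  apply (continuous_mult V (fun t => exp (- Q t))); [apply CV; lra|].
  apply (continuous_comp (fun t => - Q t) exp).
  + apply (continuous_opp Q), CQ; lra.
  + apply (ex_derive_continuous exp), ex_derive_Reals_1, derivable_pt_exp.
- rewrite Rmin_left, Rmax_right in Hc by lra.
  assert (Hphi : phi t1 <= phi t0).
  { destruct (Rlt_dec t0 c) as [Hlt|_]; [|lra].
    assert (Hv := Hle c ltac:(lra)).
    assert (0 < exp (- Q c)) by apply exp_pos.
    assert (0 <= (r c * V c - V' c) * exp (- Q c) * (t1 - t0)).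
    { repeat apply Rmult_le_pos; lra. }
    lra. }
  unfold phi in Hphi.
  unfold Rminus; rewrite Rplus_comm, exp_plus, <- Rmult_assoc.
  apply Rmult_le_reg_r with (exp (- Q t1)); [apply exp_pos|].
  rewrite (Rmult_assoc _ (exp (Q t1))), <- exp_plus, Rplus_opp_r, exp_0; lra.
Qed.

(* [B] is a barrier for [D2]: the differential inequality is only available below it. *)
Lemma barrier (D2 V V' Q r B : R -> R) c t0 :
  0 < c ->
  (forall t, t0 <= t -> continuous D2 t) -> (forall t, t0 <= t -> continuous V t) ->
  (forall t, t0 <= t -> continuous Q t) -> (forall t, t0 <= t -> continuous B t) ->
  (forall t, t0 < t -> is_derive V t (V' t)) ->
  (forall t, t0 < t -> is_derive Q t (r t)) ->
  (forall t, t0 <= t -> D2 t <= B t -> c * D2 t <= V t) ->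
  (forall t, t0 < t -> D2 t <= B t -> V' t <= r t * V t) ->
  D2 t0 < B t0 ->
  (forall t, t0 <= t -> V t0 * exp (Q t - Q t0) < c * B t) ->
  forall t, t0 <= t -> c * D2 t <= V t0 * exp (Q t - Q t0).
Proof.
intros Hc CD CV CQ CB DV DQ Hlow Hdec Hinit Hsmall.
assert (Hpos : forall t, t0 <= t -> 0 < B t - D2 t).
{ apply first_exit; [|lra|].
  - intros t Ht; apply (continuous_minus B D2); auto.
  - intros t1 Ht1 Hbelow.
    (* By continuity from the left, [D2] cannot already exceed [B] at [t1]. *)
    assert (H1 : D2 t1 <= B t1).
    { destruct (Rle_lt_dec (D2 t1) (B t1)) as [|Hlt]; [assumption|exfalso].
      assert (Hp : 0 < D2 t1 - B t1) by lra.
      destruct (continuous_minus B D2 t1 (CB t1 ltac:(lra)) (CD t1 ltac:(lra)) (fun y => y < 0))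
        as [d Hd].
      { exists (mkposreal _ Hp); intros y Hy.
        change (Rabs (y - (B t1 - D2 t1)) < D2 t1 - B t1) in Hy.
        apply Rabs_def2 in Hy; lra. }
      assert (Hdp := cond_pos d).
      set (s := Rmax t0 (t1 - d / 2)).
      assert (Hs : t0 <= s < t1 /\ t1 - d / 2 <= s).
      { unfold s; split; [split|]; [apply Rmax_l|apply Rmax_lub_lt; lra|apply Rmax_r]. }
      assert (Hneg := Hd s); change (Rabs (s - t1) < d -> B s - D2 s < 0) in Hneg.
      assert (Hs' := Hbelow s (proj1 Hs)).
      assert (B s - D2 s < 0) by (apply Hneg, Rabs_def1; lra); lra. }
    (* By [H1] the differential inequality holds up to and including [t1]; the strict inequality in
       [Hsmall] then keeps [D2] strictly below [B] there. *)
    assert (HG : V t1 <= V t0 * exp (Q t1 - Q t0)).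
    { apply (Gronwall V V' Q r); auto; [lra|].
      intros t Ht; apply Hdec; [lra|].
      destruct (Req_dec t t1) as [->|]; [assumption|].
      assert (0 < B t - D2 t) by (apply Hbelow; lra); lra. }
    assert (Hl := Hlow t1 ltac:(lra) H1).
    assert (Hs := Hsmall t1 ltac:(lra)).
    assert (c * D2 t1 < c * B t1) by lra.
    assert (D2 t1 < B t1) by (apply Rmult_lt_reg_l with c; lra); lra. }
intros t Ht.
apply Rle_trans with (V t).
- apply Hlow; auto; specialize (Hpos t Ht); lra.
- apply (Gronwall V V' Q r); auto.
  intros s Hs; apply Hdec; [lra|].
  assert (0 < B s - D2 s) by (apply Hpos; lra); lra.
Qed.

(** * Regularity of classical solutions *)

Lemma is_derive_in_interior (D : R -> Prop) (f : R -> R) x l :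
  locally x D -> (is_derive_in D f x l <-> is_derive f x l).
Proof.
intros HD.
assert (Hle : forall P : R -> Prop, within D (locally x) P <-> locally x P).
{ intros P; split; intros H.
  - apply (filter_imp (fun y => D y /\ (D y -> P y))); [tauto|].
    now apply filter_and.
  - unfold within; revert H; apply filter_imp; auto. }
split; intros [Hl Hd]; split; auto; intros y Hy e.
- apply Hle, Hd; intros P HP; apply Hle, Hy, HP.
- apply Hle, Hd; intros P HP; apply Hle, Hy, HP.
Qed.

(** [iota] needs uniqueness of the derivative, which is inherited from [is_derive] because the two
    filters agree at interior points. *)
Lemma derive_in_interior (D : R -> Prop) (f : R -> R) x :
  locally x D -> ex_derive_in D f x -> is_derive f x (derive_in D f x).
Proof.
intros HD [l Hl].
apply (is_derive_in_interior D f x _ HD).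
apply (iota_correct (V := R_CompleteNormedModule) (is_derive_in D f x)).
exists l; split; [exact Hl|].
intros l' Hl'.
apply (is_derive_in_interior D f x _ HD) in Hl, Hl'.
now rewrite <- (is_derive_unique _ _ _ Hl), <- (is_derive_unique _ _ _ Hl').
Qed.

Lemma locally_from t0 t : t0 < t -> locally t (from t0).
Proof.
intros Ht; assert (Hp : 0 < t - t0) by lra.
exists (mkposreal _ Hp); intros y Hy.
change (Rabs (y - t) < t - t0) in Hy; apply Rabs_def2 in Hy; unfold from; lra.
Qed.

Lemma locally_I0pi x : 0 < x < PI -> locally x I0pi.
Proof.
intros Hx; assert (Hp : 0 < Rmin x (PI - x)) by (apply Rmin_glb_lt; lra).
exists (mkposreal _ Hp); intros y Hy.
change (Rabs (y - x) < Rmin x (PI - x)) in Hy; apply Rabs_def2 in Hy.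
assert (H1 := Rmin_l x (PI - x)); assert (H2 := Rmin_r x (PI - x)).
unfold I0pi; lra.
Qed.

Lemma continuous_on_comp {T U W : UniformSpace} (D : U -> Prop) (f : U -> W) (c : T -> U) p :
  continuous_on D f -> (forall q, D (c q)) -> continuous c p ->
  continuous (fun q => f (c q)) p.
Proof.
intros Hf HD Hc.
apply (filterlim_comp _ _ _ c f _ (within D (locally (c p))) _); [|now apply Hf].
intros P HP; change (locally p (fun q => P (c q))).
  apply (filter_imp (fun q => D (c q) -> P (c q))); [auto|exact (Hc _ HP)].
Qed.

Lemma continuous_Rmax_l a t : continuous (fun s => Rmax a s) t.
Proof.
apply continuity_pt_filterlim; intros e He; exists e; split; [lra|].
intros s [_ Hs]; change (Rabs (Rmax a s - Rmax a t) < e); change (Rabs (s - t) < e) in Hs.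
apply Rabs_def2 in Hs; unfold Rmax; destruct (Rle_dec a s), (Rle_dec a t); apply Rabs_def1; lra.
Qed.

Lemma continuous_Rmin_l a t : continuous (fun s => Rmin a s) t.
Proof.
apply continuity_pt_filterlim; intros e He; exists e; split; [lra|].
intros s [_ Hs]; change (Rabs (Rmin a s - Rmin a t) < e); change (Rabs (s - t) < e) in Hs.
apply Rabs_def2 in Hs; unfold Rmin; destruct (Rle_dec a s), (Rle_dec a t); apply Rabs_def1; lra.
Qed.

Definition clamp (x : R) : R := Rmax 0 (Rmin PI x).

Lemma clamp_range x : 0 <= clamp x <= PI.
Proof.
unfold clamp; assert (H := PI_RGT_0); split; [apply Rmax_l|].
apply Rmax_lub; [lra|apply Rmin_l].
Qed.

Lemma clamp_id x : 0 <= x <= PI -> clamp x = x.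
Proof. intros Hx; unfold clamp; rewrite Rmin_right, Rmax_right; lra. Qed.

Definition extend (t0 : R) (f : R -> R -> R) (x t : R) : R := f (clamp x) (Rmax t0 t).

Lemma extend_id t0 f x t : 0 <= x <= PI -> t0 <= t -> extend t0 f x t = f x t.
Proof. intros Hx Ht; unfold extend; rewrite clamp_id, Rmax_right; auto. Qed.

Lemma extend_continuous2 t0 f :
  continuous_on (strip t0) (fun p => f (fst p) (snd p)) -> continuous2 (extend t0 f).
Proof.
intros Hf x t; apply continuity_2d_pt_filterlim; unfold extend.
apply (continuous_on_comp (T := prod_UniformSpace R_UniformSpace R_UniformSpace)
        (strip t0) (fun p => f (fst p) (snd p))
        (fun q => (clamp (fst q), Rmax t0 (snd q))) (x, t) Hf).
- intros q; split; simpl; [apply clamp_range|apply Rmax_l].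
- apply (continuous_comp_2 (fun q : R * R => clamp (fst q)) (fun q => Rmax t0 (snd q))
           (fun a b => (a, b)) (x, t)).
  + apply (continuous_comp fst clamp); [apply continuous_fst|].
    apply (continuous_comp (Rmin PI) (Rmax 0)); [apply continuous_Rmin_l|apply continuous_Rmax_l].
  + apply (continuous_comp snd (Rmax t0)); [apply continuous_snd|apply continuous_Rmax_l].
  + apply continuous_ext with (fun q : R * R => q); [now intros []|apply continuous_id].
Qed.

Lemma extend_is_derive_t t0 f df :
  (forall x t, 0 <= x <= PI -> t0 < t -> is_derive (fun s => f x s) t (df x t)) ->
  forall x t, t0 < t -> is_derive (fun s => extend t0 f x s) t (extend t0 df x t).
Proof.
intros Hd x t Ht; unfold extend.
rewrite (Rmax_right t0 t) by lra.
apply (is_derive_ext_loc (fun s => f (clamp x) s)).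
- generalize (locally_from t0 t Ht); apply filter_imp; intros s Hs.
  now rewrite Rmax_right.
- apply Hd; [apply clamp_range|assumption].
Qed.

Lemma extend_is_derive_x t0 f df :
  (forall x t, 0 < x < PI -> t0 <= t -> is_derive (fun y => f y t) x (df x t)) ->
  forall x t, 0 < x < PI -> is_derive (fun y => extend t0 f y t) x (extend t0 df x t).
Proof.
intros Hd x t Hx; unfold extend.
rewrite (clamp_id x) by lra.
apply (is_derive_ext_loc (fun y => f y (Rmax t0 t))).
- generalize (locally_I0pi x Hx); apply filter_imp; intros y Hy.
  now rewrite clamp_id.
- apply Hd; [assumption|apply Rmax_l].
Qed.

(* [extend] makes a classical solution continuous on the whole plane: time derivatives are
   then available for all [x], space derivatives in the interior. *)
Record regular (t0 : R) (u ux uxx uxxt v vt : R -> R -> R) : Prop := {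
  reg_u : continuous2 u;
  reg_ux : continuous2 ux;
  reg_uxx : continuous2 uxx;
  reg_uxxt : continuous2 uxxt;
  reg_v : continuous2 v;
  reg_vt : continuous2 vt;
  reg_d_u : forall x t, t0 < t -> is_derive (fun s => u x s) t (v x t);
  reg_d_v : forall x t, t0 < t -> is_derive (fun s => v x s) t (vt x t);
  reg_d_uxx : forall x t, t0 < t -> is_derive (fun s => uxx x s) t (uxxt x t);
  reg_dx_u : forall x t, 0 < x < PI -> is_derive (fun y => u y t) x (ux x t);
  reg_dx_ux : forall x t, 0 < x < PI -> is_derive (fun y => ux y t) x (uxx x t);
  reg_0 : forall t, u 0 t = 0;
  reg_PI : forall t, u PI t = 0
}.

Arguments reg_u {t0 u ux uxx uxxt v vt} _.
Arguments reg_ux {t0 u ux uxx uxxt v vt} _.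
Arguments reg_uxx {t0 u ux uxx uxxt v vt} _.
Arguments reg_uxxt {t0 u ux uxx uxxt v vt} _.
Arguments reg_v {t0 u ux uxx uxxt v vt} _.
Arguments reg_vt {t0 u ux uxx uxxt v vt} _.
Arguments reg_d_u {t0 u ux uxx uxxt v vt} _.
Arguments reg_d_v {t0 u ux uxx uxxt v vt} _.
Arguments reg_d_uxx {t0 u ux uxx uxxt v vt} _.
Arguments reg_dx_u {t0 u ux uxx uxxt v vt} _.
Arguments reg_dx_ux {t0 u ux uxx uxxt v vt} _.
Arguments reg_0 {t0 u ux uxx uxxt v vt} _.
Arguments reg_PI {t0 u ux uxx uxxt v vt} _.

Lemma classical_regular t0 u :
  classical t0 u -> (forall t, t0 <= t -> u 0 t = 0 /\ u PI t = 0) ->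
  regular t0 (extend t0 u) (extend t0 (d_x u)) (extend t0 (d_x (d_x u)))
    (extend t0 (d_t t0 (d_x (d_x u)))) (extend t0 (d_t t0 u))
    (extend t0 (d_t t0 (d_t t0 u))).
Proof.
intros (Cu & [Eux Cux] & [Euxx Cuxx] & [Euxxt Cuxxt] & [Ev Cv] & [Evt Cvt]) Hb.
assert (HP := PI_RGT_0).
assert (Dt : forall f, has_cont_d_t t0 f -> forall x t, 0 <= x <= PI -> t0 < t ->
  is_derive (fun s => f x s) t (d_t t0 f x t)).
{ intros f [Ef _] x t Hx Ht; apply derive_in_interior; [now apply locally_from|].
  apply Ef; [exact Hx|unfold from; lra]. }
assert (Dx : forall f, has_cont_d_x t0 f -> forall x t, 0 < x < PI -> t0 <= t ->
  is_derive (fun y => f y t) x (d_x f x t)).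
{ intros f [Ef _] x t Hx Ht; apply derive_in_interior; [now apply locally_I0pi|].
  apply Ef; [unfold I0pi; lra|exact Ht]. }
split; try (now apply extend_continuous2);
  try (apply extend_is_derive_t, Dt; now split);
  try (apply extend_is_derive_x, Dx; now split).
- intros t; unfold extend; rewrite clamp_id by lra; apply Hb, Rmax_l.
- intros t; unfold extend; rewrite clamp_id by lra; apply Hb, Rmax_l.
Qed.

(** Taylor's formula at 0 with integral remainder, from [((x - y) f')' = (x - y) f'' - f']. *)
Lemma double_primitive (f df ddf : R -> R) :
  (forall x, continuous f x) -> (forall x, continuous df x) -> (forall x, continuous ddf x) ->
  (forall x, 0 < x < PI -> is_derive f x (df x)) ->
  (forall x, 0 < x < PI -> is_derive df x (ddf x)) ->
  f 0 = 0 ->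
  forall x, 0 <= x <= PI -> f x = df 0 * x + RInt (fun y => (x - y) * ddf y) 0 x.
Proof.
intros Cf Cdf Cddf Df Ddf F0 x Hx.
assert (H1 : RInt df 0 x = f x - f 0) by (apply FTC_interior; auto; [lra|intros; apply Df; lra]).
assert (Cxy : forall y, continuous (fun y => x - y) y).
{ intros y; apply (continuous_minus (fun _ => x) (fun y => y)); [apply continuous_const|apply continuous_id]. }
assert (H2 : RInt (fun y => (x - y) * ddf y + - df y) 0 x = (x - x) * df x - (x - 0) * df 0).
{ apply (FTC_interior (fun y => (x - y) * df y)); [lra| | |].
  - intros y _; now apply (continuous_mult (fun y => x - y) df).
  - intros y; apply (continuous_plus (fun y => (x - y) * ddf y) (fun y => - df y)).
    + now apply (continuous_mult (fun y => x - y) ddf).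
    + now apply (continuous_opp df).
  - intros y Hy; assert (D := Ddf y ltac:(lra)).
    auto_derive; [now exists (ddf y)|].
    replace (Derive (fun x0 : R => df x0) y) with (ddf y)
      by (symmetry; now apply is_derive_unique).
    ring. }
rewrite RInt_Rplus, RInt_Ropp in H2; auto.
- lra.
- intros y; now apply (continuous_mult (fun y => x - y) ddf).
- intros y; now apply (continuous_opp df).
Qed.

(* Differentiating in time the formula that recovers [u] from [u_xx] and the boundary
   values gives the regularity in [x] of [u_t], which is not part of [classical]. *)
Lemma regular_vx t0 u ux uxx uxxt v vt :
  regular t0 u ux uxx uxxt v vt -> forall t, t0 < t ->
  exists vx : R -> R,
    (forall x, continuous vx x) /\
    (forall x, 0 < x < PI -> is_derive (fun y => v y t) x (vx x)) /\
    (forall x, 0 < x < PI -> is_derive vx x (uxxt x t)) /\ v 0 t = 0 /\ v PI t = 0.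
Proof.
intros Hreg t Ht; assert (HP := PI_RGT_0).
set (R0 := fun x s => RInt (fun y => (x - y) * uxx y s) 0 x).
set (R1 := fun x => RInt (fun y => (x - y) * uxxt y t) 0 x).
assert (Cxy : forall x, continuous2 (fun y _ => x - y)).
{ intros x; apply (continuous2_fst (fun y => x - y)); intros y.
  apply (continuous_minus (fun _ => x) (fun y => y)); [apply continuous_const|apply continuous_id]. }
assert (DR : forall x, 0 <= x -> is_derive (fun s => R0 x s) t (R1 x)).
{ intros x Hx.
  apply (is_derive_RInt_slice (fun y s => (x - y) * uxx y s) (fun y s => (x - y) * uxxt y s) t0);
    auto; try (apply continuous2_mult; auto; apply Hreg).
  intros y s Hs; apply (is_derive_scal (fun s => uxx y s)); now apply Hreg. }
(* The slope [ux 0 s] is eliminated by the boundary condition at [PI]; what remains are integrals of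
   [uxx], which can be differentiated in time. *)
assert (Hu : forall x s, 0 <= x <= PI -> u x s = R0 x s - x / PI * R0 PI s).
{ intros x s Hx.
  assert (H := double_primitive (fun y => u y s) (fun y => ux y s) (fun y => uxx y s)
    (continuous2_slice u s (reg_u Hreg))
    (continuous2_slice ux s (reg_ux Hreg))
    (continuous2_slice uxx s (reg_uxx Hreg))
    (fun y => reg_dx_u Hreg y s)
    (fun y => reg_dx_ux Hreg y s) (reg_0 Hreg s)).
  assert (H1 := H x Hx); assert (H2 := H PI ltac:(lra)); simpl in H1, H2.
  rewrite (reg_PI Hreg) in H2.
  fold (R0 x s) in H1; fold (R0 PI s) in H2.
  rewrite H1; replace (R0 PI s) with (- (ux 0 s * PI)) by lra; field; lra. }
assert (Hv : forall x, 0 <= x <= PI -> v x t = R1 x - x / PI * R1 PI).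
{ intros x Hx.
  rewrite <- (is_derive_unique _ _ _ (reg_d_u Hreg x t Ht)).
  apply is_derive_unique.
  apply (is_derive_ext (fun s => R0 x s - x / PI * R0 PI s)); [intros s; symmetry; now apply Hu|].
  assert (D1 := DR x ltac:(lra)); assert (D2 := DR PI ltac:(lra)).
  apply (is_derive_minus (fun s => R0 x s) (fun s => x / PI * R0 PI s)); auto.
  now apply (is_derive_scal (fun s => R0 PI s)). }
set (w := fun y => uxxt y t).
assert (Cw : forall y, continuous w y) by (apply continuous2_slice, Hreg).
assert (Cyw : forall y, continuous (fun y => y * w y) y)
  by (intros y; apply (continuous_mult (fun y => y) w); auto; apply continuous_id).
(* The factor [x] is pulled out so that the integrands no longer depend on [x] and the fundamental
   theorem applies. *)
assert (HR1 : forall x, R1 x = x * RInt w 0 x - RInt (fun y => y * w y) 0 x).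
{ intros x; unfold R1, Rminus; rewrite <- RInt_Rscal, <- RInt_Ropp, <- RInt_Rplus; auto.
  - apply RInt_ext; intros y _; unfold w; simpl; ring.
  - intros y; apply (continuous_mult (fun _ => x) w); auto; apply continuous_const.
  - intros y; now apply (continuous_opp (fun y => y * w y)). }
assert (Dw : forall y, is_derive (fun y => RInt w 0 y) y (w y)) by now apply is_derive_RInt_upper.
assert (Dyw : forall y, is_derive (fun x => RInt (fun y => y * w y) 0 x) y (y * w y))
  by now apply (is_derive_RInt_upper (fun y => y * w y)).
exists (fun x => RInt w 0 x - R1 PI / PI).
assert (Dvx : forall x, is_derive (fun x => RInt w 0 x - R1 PI / PI) x (w x)).
{ intros x; replace (w x) with (w x - 0) by ring.
  apply (is_derive_minus (fun x => RInt w 0 x) (fun _ => R1 PI / PI)); auto; apply (is_derive_const (R1 PI / PI)). }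
split; [|split; [|split; [|split]]].
- intros x; eapply is_derive_continuous, Dvx.
- intros x Hx.
  apply (is_derive_ext_loc (fun x => x * RInt w 0 x - RInt (fun y => y * w y) 0 x - x / PI * R1 PI)).
  + generalize (locally_I0pi x Hx); apply filter_imp; intros y Hy.
    rewrite <- HR1; symmetry; now apply Hv.
  + set (g1 := fun x => RInt w 0 x) in *; set (g2 := fun x => RInt (fun y => y * w y) 0 x) in *.
    change (is_derive (fun x => x * g1 x - g2 x - x / PI * R1 PI) x (g1 x - R1 PI / PI)).
    assert (D1 := Dw x); assert (D2 := Dyw x).
    auto_derive; [repeat split; eexists; [apply D1|apply D2]|].
    replace (Derive (fun x0 : R => g1 x0) x) with (w x)
      by (symmetry; now apply is_derive_unique).
    replace (Derive (fun x0 : R => g2 x0) x) with (x * w x)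
      by (symmetry; now apply is_derive_unique).
    field; lra.
- intros x _; apply Dvx.
- rewrite Hv by lra; unfold R1 at 1; rewrite RInt_point; unfold zero; simpl; field; lra.
- rewrite Hv by lra; field; lra.
Qed.

(** * Inner products on [0, PI] and Green identities *)

Definition ip (f g : R -> R) : R := RInt (fun x => f x * g x) 0 PI.

Lemma ip_sym f g : ip f g = ip g f.
Proof. apply RInt_ext; intros x _; apply Rmult_comm. Qed.

Lemma continuous_Rmult (f g : R -> R) x :
  continuous f x -> continuous g x -> continuous (fun x => f x * g x) x.
Proof. apply (continuous_mult f g). Qed.

Lemma continuous_Rplus (f g : R -> R) x :
  continuous f x -> continuous g x -> continuous (fun x => f x + g x) x.
Proof. apply (continuous_plus f g). Qed.

Lemma continuous_Rscal (f : R -> R) c x :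
  continuous f x -> continuous (fun x => c * f x) x.
Proof. intros; apply continuous_Rmult; auto; apply continuous_const. Qed.

Lemma ip_plus f g h :
  (forall x, continuous f x) -> (forall x, continuous g x) -> (forall x, continuous h x) ->
  ip f (fun x => g x + h x) = ip f g + ip f h.
Proof.
intros Cf Cg Ch; unfold ip.
rewrite <- RInt_Rplus by (intros; now apply continuous_Rmult).
apply RInt_ext; intros; simpl; ring.
Qed.

Lemma ip_scal f g c :
  (forall x, continuous f x) -> (forall x, continuous g x) ->
  ip f (fun x => c * g x) = c * ip f g.
Proof.
intros Cf Cg; unfold ip.
rewrite <- RInt_Rscal by (intros; now apply continuous_Rmult).
apply RInt_ext; intros; simpl; ring.
Qed.

Lemma ip_ge_0 f : (forall x, continuous f x) -> 0 <= ip f f.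
Proof.
intros Cf; apply RInt_ge_0_continuous.
- apply Rlt_le, PI_RGT_0.
- intros; now apply continuous_Rmult.
- intros; apply Rle_0_sqr.
Qed.

(** The right-hand side is the squared norm of [x f1 + y f2 + z f3]. Choices of [x], [y], [z] give
    the Cauchy-Schwarz and Young inequalities for these inner products. *)
Lemma ip_gram f1 f2 f3 x y z :
  (forall x, continuous f1 x) -> (forall x, continuous f2 x) -> (forall x, continuous f3 x) ->
  0 <= x ^ 2 * ip f1 f1 + y ^ 2 * ip f2 f2 + z ^ 2 * ip f3 f3
       + 2 * x * y * ip f1 f2 + 2 * x * z * ip f1 f3 + 2 * y * z * ip f2 f3.
Proof.
intros C1 C2 C3.
set (f := fun s => x * f1 s + (y * f2 s + z * f3 s)).
assert (Cl : forall g c, (forall s, continuous g s) -> forall s, continuous (fun s => c * g s) s)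
  by (intros; now apply continuous_Rscal).
assert (C23 : forall s, continuous (fun s => y * f2 s + z * f3 s) s)
  by (intros; apply continuous_Rplus; auto).
assert (Cf : forall s, continuous f s) by (intros; apply continuous_Rplus; auto).
assert (Hexp : forall g, (forall s, continuous g s) ->
  ip g f = x * ip g f1 + (y * ip g f2 + z * ip g f3)).
{ intros g Cg; unfold f.
  rewrite (ip_plus g (fun s => x * f1 s)), ip_plus, !ip_scal; auto. }
assert (H := ip_ge_0 f Cf).
rewrite (Hexp f Cf), (ip_sym f f1), (ip_sym f f2), (ip_sym f f3), !Hexp in H by assumption.
rewrite (ip_sym f2 f1), (ip_sym f3 f1), (ip_sym f3 f2) in H.
lra.
Qed.

Lemma is_derive_ip t0 f ft g gt :
  continuous2 f -> continuous2 ft -> continuous2 g -> continuous2 gt ->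
  (forall x s, t0 < s -> is_derive (fun r => f x r) s (ft x s)) ->
  (forall x s, t0 < s -> is_derive (fun r => g x r) s (gt x s)) ->
  forall t, t0 < t ->
  is_derive (fun s => ip (fun x => f x s) (fun x => g x s)) t
    (ip (fun x => ft x t) (fun x => g x t) + ip (fun x => f x t) (fun x => gt x t)).
Proof.
intros Cf Cft Cg Cgt Df Dg t Ht; unfold ip.
rewrite <- RInt_Rplus.
- apply (is_derive_RInt_slice (fun x s => f x s * g x s)
           (fun x s => ft x s * g x s + f x s * gt x s) t0); auto.
  + now apply continuous2_mult.
  + apply (continuous2_plus (fun x s => ft x s * g x s) (fun x s => f x s * gt x s));
      now apply continuous2_mult.
  + apply Rlt_le, PI_RGT_0.
  + intros x s Hs; apply (is_derive_mult (fun r => f x r) (fun r => g x r)); auto.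
    intros; apply Rmult_comm.
- intros x; apply continuous_Rmult; now apply (continuous2_slice _ t).
- intros x; apply continuous_Rmult; now apply (continuous2_slice _ t).
Qed.

Lemma ip_slice_continuous f g :
  continuous2 f -> continuous2 g ->
  forall t, continuous (fun s => ip (fun x => f x s) (fun x => g x s)) t.
Proof.
intros Cf Cg; apply (RInt_slice_continuous (fun x s => f x s * g x s)).
- now apply continuous2_mult.
- apply Rlt_le, PI_RGT_0.
Qed.

Lemma ip_by_parts f df g dg :
  (forall x, continuous f x) -> (forall x, continuous df x) ->
  (forall x, continuous g x) -> (forall x, continuous dg x) ->
  (forall x, 0 < x < PI -> is_derive f x (df x)) ->
  (forall x, 0 < x < PI -> is_derive g x (dg x)) ->
  f 0 = 0 -> f PI = 0 -> ip f dg = - ip df g.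
Proof. intros; apply RInt_by_parts; auto; apply Rlt_le, PI_RGT_0. Qed.

Lemma regular_ip_ux t0 u ux uxx uxxt v vt :
  regular t0 u ux uxx uxxt v vt -> forall t,
  ip (fun x => ux x t) (fun x => ux x t) = - ip (fun x => u x t) (fun x => uxx x t).
Proof.
intros Hreg t.
rewrite (ip_by_parts (fun x : R => u x t) (fun x : R => ux x t) (fun x : R => ux x t) (fun x : R => uxx x t)).
- ring.
- apply continuous2_slice, Hreg.
- apply continuous2_slice, Hreg.
- apply continuous2_slice, Hreg.
- apply continuous2_slice, Hreg.
- intros; now apply (reg_dx_u Hreg).
- intros; now apply (reg_dx_ux Hreg).
- apply Hreg.
- apply Hreg.
Qed.

(** Integration by parts through [v_x], which [regular_vx] provides. The inequality is Poincare for
    [v]; it turns the strong damping into a damping of [v] itself. *)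
Lemma regular_green t0 u ux uxx uxxt v vt :
  regular t0 u ux uxx uxxt v vt -> forall t, t0 < t ->
  ip (fun x => u x t) (fun x => uxxt x t) = ip (fun x => uxx x t) (fun x => v x t) /\
  ip (fun x => v x t) (fun x => uxxt x t) <= - ip (fun x => v x t) (fun x => v x t).
Proof.
intros Hreg t Ht.
destruct (regular_vx _ _ _ _ _ _ _ Hreg t Ht) as (vx & Cvx & Dv & Dvx & V0 & VP).
assert (Cu := continuous2_slice u t (reg_u Hreg)).
assert (Cux := continuous2_slice ux t (reg_ux Hreg)).
assert (Cuxx := continuous2_slice uxx t (reg_uxx Hreg)).
assert (Cuxxt := continuous2_slice uxxt t (reg_uxxt Hreg)).
assert (Cv := continuous2_slice v t (reg_v Hreg)).
split.
- rewrite (ip_by_parts (fun x : R => u x t) (fun x : R => ux x t) vx (fun x : R => uxxt x t)); auto;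
    try (intros; now apply Hreg).
  rewrite (ip_sym (fun x => uxx x t)).
  rewrite (ip_by_parts (fun x : R => v x t) vx (fun x : R => ux x t) (fun x : R => uxx x t)); auto;
    try (intros; now apply Hreg).
  now rewrite ip_sym.
- rewrite (ip_by_parts (fun x : R => v x t) vx vx (fun x : R => uxxt x t)); auto.
  apply Ropp_le_contravar; now apply Poincare.
Qed.

(** [u_xt] is not among the derivatives in [regular], so [|u_x|^2] is differentiated in the form
    [- <u, u_xx>]. *)
Lemma is_derive_ip_ux t0 u ux uxx uxxt v vt :
  regular t0 u ux uxx uxxt v vt -> forall t, t0 < t ->
  is_derive (fun s => ip (fun x => ux x s) (fun x => ux x s)) t
    (- 2 * ip (fun x => uxx x t) (fun x => v x t)).
Proof.
intros Hreg t Ht.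
apply (is_derive_ext (fun s => - ip (fun x => u x s) (fun x => uxx x s))).
- intros s; symmetry; now apply (regular_ip_ux t0 u ux uxx uxxt v vt).
- replace (- 2 * ip (fun x => uxx x t) (fun x => v x t)) with
    (- (ip (fun x => v x t) (fun x => uxx x t) + ip (fun x => u x t) (fun x => uxxt x t))).
  + apply (is_derive_opp (fun s => ip (fun x => u x s) (fun x => uxx x s))).
    apply (is_derive_ip t0 u v uxx uxxt); apply Hreg || assumption.
  + rewrite (proj1 (regular_green _ _ _ _ _ _ _ Hreg t Ht)), (ip_sym (fun x => v x t)); ring.
Qed.

(** * Algebra of the Liapunov functional *)

(** Scalar form of the bound on [V']: [a], [b], [c], [e] stand for [|v|^2], [|u_xx|^2], [|u_x|^2],
    [|u|^2]; [r] for [<v, u_xxt>]; [s1], [s2], [s3] for the products of [v], [u_xx], [u] with the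
    nonlinear damping term; [f1], [f2] for those of [u_xx], [u] with [F(u)]; [H] for [h d^omega];
    [SS] for the squared bound on the damping coefficient. A quarter of [mu eps^2 b] is spent on
    [s2], whence the [3/4] in [eta]. *)
Lemma dissipation_bound (eps deps ddeps Ct dC C0 ebar eddbar k H a' mu theta gamma SS : R)
    (a b c e r s1 s2 s3 f1 f2 : R) :
  0 <= ebar <= eps -> 0 < C0 <= Ct -> 0 < mu -> 0 <= k -> 0 <= H ->
  mu * (1 + eps) <= Ct - deps -> eddbar <= ddeps -> dC * (1 + gamma) <= 1 ->
  0 <= gamma -> 0 < theta -> 2 * a' <= theta -> 2 * k <= mu * (theta + a') ->
  0 <= theta - a' -> 5 - eddbar - a' * (mu - C0) <= theta * (mu + C0 / 2 - 2 * k) ->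
  1 <= gamma * (a' + ebar) + a' - theta - SS * (/ mu + theta / C0) ->
  0 <= SS -> 0 <= a -> 0 <= b -> 0 <= e <= c ->
  r <= - a -> 0 <= s1 ->
  eps * s2 <= mu / 4 * eps ^ 2 * b + SS / mu * a ->
  - s3 <= C0 / 4 * e + SS / C0 * a ->
  - f1 <= (k + H) * c -> f2 <= (k + H) * e ->
  gamma * eps * r - (gamma * a' + a' - theta) * a - (1 + gamma) * s1
    - eps * (Ct - deps) * b + eps * s2 - eps * f1
    + (dC * (1 + gamma) - ddeps + deps * (a' + theta)) / 2 * c - theta * Ct * c
    - theta * s3 + theta * f2
  <= - (3 / 4 * mu * eps ^ 2 * b + 2 * c + a) + H * (eps + theta) * c.
Proof.
intros He HC Hmu Hk HH HQ Hdd HdC Hg Ht Ht1 Ht2 Htp Ht3 Hdis HSS Ha Hb Hec Hr Hs1 Hs2 Hs3 Hf1 Hf2.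
assert (h1 : gamma * eps * r <= - (gamma * ebar * a)).
{ assert (0 <= gamma * eps * (- a - r)) by (apply Rmult_le_pos; [apply Rmult_le_pos|]; lra).
  assert (0 <= gamma * (eps - ebar) * a) by (apply Rmult_le_pos; [apply Rmult_le_pos|]; lra).
  lra. }
assert (h2 : 0 <= (1 + gamma) * s1) by (apply Rmult_le_pos; lra).
assert (h3 : mu * eps ^ 2 * b <= eps * (Ct - deps) * b).
{ apply Rmult_le_compat_r; [assumption|].
  assert (0 <= eps * (Ct - deps - mu * (1 + eps))) by (apply Rmult_le_pos; lra).
  assert (0 <= mu * eps) by (apply Rmult_le_pos; lra). lra. }
assert (h5 : - (eps * f1) <= eps * ((k + H) * c)).
{ assert (0 <= eps * ((k + H) * c + f1)) by (apply Rmult_le_pos; lra). lra. }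
assert (h6 : - (theta * s3) <= theta * (C0 / 4 * c + SS / C0 * a)).
{ assert (0 <= theta * (C0 / 4 * e + SS / C0 * a + s3)) by (apply Rmult_le_pos; lra).
  assert (0 <= theta * C0 * (c - e))
    by (apply Rmult_le_pos; [apply Rmult_le_pos|]; lra).
  lra. }
assert (h7 : theta * f2 <= theta * ((k + H) * c)).
{ assert (0 <= theta * ((k + H) * e - f2)) by (apply Rmult_le_pos; lra).
  assert (0 <= theta * ((k + H) * (c - e)))
    by (apply Rmult_le_pos; [|apply Rmult_le_pos]; lra).
  lra. }
assert (Hat : 0 <= theta + a').
{ apply Rmult_le_reg_l with mu; lra. }
(* Bounding [deps] by [Ct - mu (1 + eps)], then [Ct] from below by [C0], leaves half of [1 - eddbar
   - a' (mu - C0) - theta (mu + C0 / 2 - 2 k)]; the constant 5 in [theta1] makes this at most -2. *)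
assert (h8 : (dC * (1 + gamma) - ddeps + deps * (a' + theta)) / 2 - theta * Ct
             + (eps + theta) * k + theta * C0 / 4 <= - 2).
{ assert (0 <= (Ct - deps - mu * (1 + eps)) * (theta + a')) by (apply Rmult_le_pos; lra).
  assert (0 <= (Ct - C0) * (theta - a')) by (apply Rmult_le_pos; lra).
  assert (0 <= eps * (mu * (theta + a') - 2 * k)) by (apply Rmult_le_pos; lra).
  lra. }
apply (Rmult_le_compat_r c) in h8; [|lra].
apply (Rmult_le_compat_r a) in Hdis; [|lra].
unfold Rdiv in *; nra.
Qed.

(** Here [p], [q], [W] stand for [<u_xx, v>], [<u, v>] and the integral of the primitive of [F]
    along [u]; [a], [b], [c], [e] are as in [dissipation_bound]. The factor [g] comes from the
    coefficient of [|u_x|^2]. *)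
Lemma lyapunov_upper (eps deps Ct a' mu theta gamma mF : R) (a b c e p q W : R) :
  0 <= eps -> 0 < Ct -> 0 < mu -> 0 <= mF -> mu * (1 + eps) <= Ct - deps ->
  2 <= gamma -> 0 <= a' + theta -> 1 + (a' + theta) / mu <= gamma ->
  0 <= a -> 0 <= b -> 0 <= c -> 0 <= e -> 0 <= eps ^ 2 * b + a + 2 * eps * p ->
  a' * theta * e + 2 * theta * q <= gamma * (a + e) -> - W <= mF / 2 * e ->
  ((gamma + 1) * a + eps ^ 2 * b - 2 * eps * p
     + (Ct * (1 + gamma) - deps + eps * (a' + theta)) * c
     + a' * theta * e + 2 * theta * q) / 2 - (1 + gamma) * W
  <= (1 + mF) * (1 + gamma) * (Ct - deps / 2 + 1) * (eps ^ 2 * b + c + e + a).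
Proof.
intros He HC Hmu Hm HQ Hg Hat Hgk Ha Hb Hc Hee Hp Hq HW.
assert (Hepsb : 0 <= eps ^ 2 * b) by (apply Rmult_le_pos; [apply pow2_ge_0|lra]).
set (g := Ct - deps / 2 + 1).
assert (Hmue : 0 <= mu * eps) by (apply Rmult_le_pos; lra).
assert (Hg1 : 1 <= g) by (unfold g; lra).
(* Since [mu eps <= Ct - deps], [eps (a' + theta) <= (Ct - deps) (gamma - 1)]; the sum is then at
   most [gamma (2 Ct - deps)]. This is the purpose of [(a' + theta) / mu] in [gamma3]. *)
assert (HK : Ct * (1 + gamma) - deps + eps * (a' + theta) <= 2 * gamma * g).
{ assert (He' : eps * (a' + theta) <= (Ct - deps) * ((a' + theta) / mu)).
  { replace (eps * (a' + theta)) with (mu * eps * ((a' + theta) / mu)) by (field; lra).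
    apply Rmult_le_compat_r; [|lra].
    apply Rdiv_le_0_compat; lra. }
  assert (0 <= (Ct - deps) * (gamma - (1 + (a' + theta) / mu))) by (apply Rmult_le_pos; lra).
  unfold g; lra. }
set (X := (1 + mF) * (1 + gamma) * g).
assert (HX1 : (1 + mF) * (1 + gamma) <= X).
{ unfold X; assert (0 <= (1 + mF) * (1 + gamma) * (g - 1))
    by (repeat apply Rmult_le_pos; lra). lra. }
assert (HX2 : 1 + gamma <= (1 + mF) * (1 + gamma)) by nra.
assert (HX3 : gamma * g <= X).
{ unfold X; assert (0 <= g * (mF * (1 + gamma) + 1)).
  { apply Rmult_le_pos; [lra|]; assert (0 <= mF * (1 + gamma)) by (apply Rmult_le_pos; lra); lra. }
  lra. }
assert (B1 : 0 <= (X - (1 + gamma)) * a) by (apply Rmult_le_pos; lra).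
assert (B2 : 0 <= (X - 1) * (eps ^ 2 * b)) by (apply Rmult_le_pos; lra).
assert (B3 : (Ct * (1 + gamma) - deps + eps * (a' + theta)) * c <= 2 * X * c)
  by (apply Rmult_le_compat_r; lra).
assert (B4 : 0 <= (X - (1 + mF) * (1 + gamma)) * e) by (apply Rmult_le_pos; lra).
assert (B5 : - ((1 + gamma) * W) <= (1 + gamma) * (mF / 2 * e)).
{ assert (0 <= (1 + gamma) * (mF / 2 * e + W)) by (apply Rmult_le_pos; lra). lra. }
assert (0 <= mF * (1 + gamma) * e) by (repeat apply Rmult_le_pos; lra).
assert (0 <= gamma * e) by (apply Rmult_le_pos; lra).
change ((1 + mF) * (1 + gamma) * (Ct - deps / 2 + 1)) with X.
lra.
Qed.

(* Writing [A u = - eps u_xx + a' u] and [Th = theta - a'], twice the quadratic part is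
   [gamma |v|^2 + |A u + v|^2 + (gamma C + C - eps') |u_x|^2 + Th (<A u, u> + 2 <u, v>)],
   and [A >= a' + ebar] makes it positive as soon as [gamma (a' + ebar) > Th]. *)
Lemma lyapunov_lower (ebar C0 k a' mu theta gamma : R) :
  0 < a' + ebar -> 0 <= ebar -> 0 < C0 -> 0 < mu -> 0 <= theta - a' -> 0 < gamma ->
  theta - a' + 1 <= gamma * (a' + ebar) -> 0 < gamma * C0 + mu - (1 + gamma) * k ->
  exists c0, 0 < c0 /\
  forall eps deps Ct H a b c e p q W : R,
  ebar <= eps -> C0 <= Ct -> mu * (1 + eps) <= Ct - deps -> 0 <= k + H ->
  (1 + gamma) * H <= (gamma * C0 + mu - (1 + gamma) * k) / 2 ->
  0 <= a -> 0 <= b -> 0 <= e <= c ->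
  (forall x y z, 0 <= x ^ 2 * b + y ^ 2 * e + z ^ 2 * a
                 - 2 * x * y * c + 2 * x * z * p + 2 * y * z * q) ->
  W <= (k + H) / 2 * e ->
  c0 * (eps ^ 2 * b + c + e + a) <=
  ((gamma + 1) * a + eps ^ 2 * b - 2 * eps * p
     + (Ct * (1 + gamma) - deps + eps * (a' + theta)) * c
     + a' * theta * e + 2 * theta * q) / 2 - (1 + gamma) * W.
Proof.
intros Hae Heb HC0 Hmu HTh Hg Hdis Hkap.
set (Th := theta - a') in *.
set (kap := gamma * C0 + mu - (1 + gamma) * k) in *.
(* A part of [gamma] for which [g1 (a' + ebar) >= Th + 1/2] still holds; the rest,
   [del = gamma - g1], is kept to control [|v|^2]. *)
set (g1 := gamma * (Th + / 2) / (Th + 1)).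
assert (Hg1 : 0 < g1) by (apply Rdiv_lt_0_compat; nra).
set (nu := g1 / ((2 * Th + 1) * (1 + g1))).
assert (Hden : 0 < (2 * Th + 1) * (1 + g1)) by (apply Rmult_lt_0_compat; lra).
assert (Hnu : 0 < nu) by (now apply Rdiv_lt_0_compat).
assert (Hkap' : 0 < kap / (4 * (a' ^ 2 + 1))).
{ apply Rdiv_lt_0_compat; [assumption|]; assert (0 <= a' ^ 2) by apply pow2_ge_0; lra. }
(* With [nu'], the loss [a'^2 e] in [N >= eps^2 b / 2 - a'^2 e] costs at most a quarter of [kap],
   the surplus available for [|u_x|^2]. *)
set (nu' := Rmin nu (kap / (4 * (a' ^ 2 + 1)))).
assert (Hnu' : 0 < nu') by (now apply Rmin_glb_lt).
assert (Hnu1 : nu' <= nu) by apply Rmin_l.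
assert (Hnu2 : nu' * a' ^ 2 <= kap / 4).
{ assert (H2 : nu' <= kap / (4 * (a' ^ 2 + 1))) by apply Rmin_r.
  assert (Ha2 : 0 <= a' ^ 2) by apply pow2_ge_0.
  apply (Rmult_le_compat_r (a' ^ 2 + 1)) in H2; [|lra].
  replace (kap / (4 * (a' ^ 2 + 1)) * (a' ^ 2 + 1)) with (kap / 4) in H2 by (field; lra).
  lra. }
set (del := gamma / (2 * (Th + 1))).
assert (Hdel : 0 < del) by (apply Rdiv_lt_0_compat; lra).
assert (Hg1del : g1 = gamma - del) by (unfold g1, del; field; lra).
set (c0 := Rmin (del / 2) (Rmin (nu' / 4) (kap / 16))).
assert (Hc0 : 0 < c0) by (repeat apply Rmin_glb_lt; lra).
assert (Hc1 : c0 <= del / 2) by apply Rmin_l.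
assert (Hc2 : c0 <= nu' / 4) by (eapply Rle_trans; [apply Rmin_r|apply Rmin_l]).
assert (Hc3 : c0 <= kap / 16) by (eapply Rle_trans; [apply Rmin_r|apply Rmin_r]).
exists c0; split; [assumption|].
intros eps deps Ct H a b c e p q W He HC HQ HkH HH Ha Hb Hec Hgram HW.
(* A lower bound of the operator [A], by Poincare in the form [e <= c]; below, [N] is [|A u|^2] and
   [P] is [<A u, u>]. *)
set (al := eps + a').
set (N := eps ^ 2 * b + 2 * eps * a' * c + a' ^ 2 * e).
set (P := eps * c + a' * e).
assert (HPe : al * e <= P).
{ unfold al, P; assert (0 <= eps * (c - e)) by (apply Rmult_le_pos; lra); lra. }
assert (HNP : al * P <= N).
{ assert (H1 := Hgram (- eps) (a' - al) 0).
  assert (0 <= al * (P - al * e)) by (apply Rmult_le_pos; unfold al in *; lra).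
  unfold N, P, al in *; nra. }
assert (HN0 : 0 <= N) by (assert (H1 := Hgram (- eps) a' 0); unfold N; lra).
assert (HP0 : 0 <= P).
{ eapply Rle_trans; [|exact HPe]; apply Rmult_le_pos; unfold al; lra. }
assert (Hg1al : Th + / 2 <= g1 * al).
{ unfold g1; apply Rmult_le_reg_r with (Th + 1); [lra|].
  replace (gamma * (Th + / 2) / (Th + 1) * al * (Th + 1))
    with (gamma * al * (Th + / 2)) by (field; lra).
  rewrite (Rmult_comm (Th + / 2)); apply Rmult_le_compat_r; [lra|].
  assert (0 <= gamma * (eps - ebar)) by (apply Rmult_le_pos; lra).
  unfold al; lra. }
assert (Hal : 0 < al) by (unfold al; lra).
set (X := (1 + gamma) * a + N + 2 * (- eps * p + a' * q) + Th * (P + 2 * q)).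
assert (HX : del * a + nu * N <= X).
(* Subtracting the square [|A u + Th u + z v|^2] from [z X] removes all products with [v] and leaves
   [z del a] plus terms in [N], [P], [e]. *)
{ set (z := 1 + g1).
  assert (Hz := Hgram (- eps) (a' + Th) z).
  assert (Hz' : 0 <= z ^ 2 * a + 2 * z * (- eps * p + a' * q + Th * q) + (N + 2 * Th * P + Th ^ 2 * e))
    by (unfold N, P; lra).
  assert (Hmain : g1 / (2 * Th + 1) * N <= g1 * N + (g1 - 1) * Th * P - Th ^ 2 * e).
  { assert (F1 : Th * P <= g1 * (2 * Th) / (2 * Th + 1) * N).
    { apply Rmult_le_reg_l with al; [assumption|].
      apply Rle_trans with (Th * N); [assert (0 <= Th * (N - al * P)) by (apply Rmult_le_pos; lra); lra|].
      assert (Th <= al * (g1 * (2 * Th) / (2 * Th + 1))).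
      { replace (al * (g1 * (2 * Th) / (2 * Th + 1))) with (g1 * al * (2 * Th / (2 * Th + 1)))
          by (field; lra).
        apply Rle_trans with ((Th + / 2) * (2 * Th / (2 * Th + 1))).
        - apply Req_le; field; lra.
        - apply Rmult_le_compat_r; [apply Rdiv_le_0_compat; lra|assumption]. }
      rewrite <- Rmult_assoc; now apply Rmult_le_compat_r. }
    assert (F2 : Th ^ 2 * e <= g1 * Th * P).
    { assert (0 <= g1 * Th * (P - al * e)) by (apply Rmult_le_pos; [apply Rmult_le_pos|]; lra).
      assert (0 <= Th * (g1 * al - Th) * e) by (apply Rmult_le_pos; [apply Rmult_le_pos|]; lra).
      lra. }
    assert (F3 : g1 / (2 * Th + 1) * N + g1 * (2 * Th) / (2 * Th + 1) * N = g1 * N) by (field; lra).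
    lra. }
  assert (Hnuz : z * nu = g1 / (2 * Th + 1)) by (unfold nu, z; field; lra).
  apply Rmult_le_reg_l with z; [unfold z; lra|].
  replace (z * (del * a + nu * N)) with (z * del * a + z * nu * N) by ring.
  rewrite Hnuz; unfold X.
  replace gamma with (g1 + del) by lra.
  unfold z in *; lra. }
assert (HNb : eps ^ 2 * b / 2 - a' ^ 2 * e <= N).
{ assert (H1 := Hgram (- eps) (2 * a') 0); unfold N; lra. }
assert (Hnn : nu' * (eps ^ 2 * b / 2) - kap / 4 * c <= nu * N).
{ assert (0 <= (nu - nu') * N) by (apply Rmult_le_pos; lra).
  assert (0 <= nu' * (N - (eps ^ 2 * b / 2 - a' ^ 2 * e))) by (apply Rmult_le_pos; lra).
  assert (0 <= (kap / 4 - nu' * a' ^ 2) * e) by (apply Rmult_le_pos; lra).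
  assert (0 <= kap / 4 * (c - e)) by (apply Rmult_le_pos; lra).
  lra. }
assert (HWc : kap / 2 * c <= (gamma * Ct + Ct - deps) * c - 2 * (1 + gamma) * W).
{ assert (0 <= 2 * (1 + gamma) * ((k + H) / 2 * e - W)) by (repeat apply Rmult_le_pos; lra).
  assert (0 <= (1 + gamma) * (k + H) * (c - e)) by (repeat apply Rmult_le_pos; lra).
  assert (0 <= mu * eps) by (apply Rmult_le_pos; lra).
  assert (0 <= gamma * (Ct - C0)) by (apply Rmult_le_pos; lra).
  assert (0 <= (gamma * Ct + Ct - deps - (1 + gamma) * (k + H) - kap / 2) * c)
    by (apply Rmult_le_pos; [unfold kap in *|]; lra).
  lra. }
assert (Hb' : 0 <= eps ^ 2 * b) by (apply Rmult_le_pos; [apply pow2_ge_0|lra]).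
assert (E1 : 0 <= (del / 2 - c0) * a) by (apply Rmult_le_pos; lra).
assert (E2 : 0 <= (nu' / 4 - c0) * (eps ^ 2 * b)) by (apply Rmult_le_pos; lra).
assert (E3 : 0 <= (kap / 16 - c0) * (c + e)) by (apply Rmult_le_pos; lra).
assert (E4 : 0 <= kap * (c - e)) by (apply Rmult_le_pos; lra).
assert (Heq : (gamma + 1) * a + eps ^ 2 * b - 2 * eps * p
     + (Ct * (1 + gamma) - deps + eps * (a' + theta)) * c
     + a' * theta * e + 2 * theta * q = X + (gamma * Ct + Ct - deps) * c).
{ unfold X, N, P; replace theta with (Th + a') by (unfold Th; ring); ring. }
rewrite Heq; lra.
Qed.

(** * The Liapunov functional along solutions *)

(** [F(y) / y] is a value of [F'], and [N s - F s] has the sign of [s]. The growth hypothesis bounds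
    [F'] from above only, hence one-sided estimates. *)
Lemma one_sided_derivative_bound (F : R -> R) N z :
  F 0 = 0 -> (forall y, ex_derive F y) -> (forall y, Rabs y <= Rabs z -> Derive F y <= N) ->
  z * F z <= N * z ^ 2 /\ RInt F 0 z <= N / 2 * z ^ 2.
Proof.
intros F0 DF HN.
assert (CF : forall y, continuous F y) by (intros y; now apply (ex_derive_continuous F)).
assert (H1 : forall y, Rabs y <= Rabs z -> y * F y <= N * y ^ 2).
{ intros y Hy.
  destruct (MVT_gen F 0 y (Derive F)) as [c [Hc Heq]].
  - intros x _; now apply Derive_correct.
  - intros x _; apply continuity_pt_filterlim, CF.
  - rewrite F0 in Heq.
    assert (Derive F c <= N).
    { apply HN; eapply Rle_trans; [|exact Hy].
      revert Hc; unfold Rmin, Rmax; destruct (Rle_dec 0 y); intros Hc;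
        unfold Rabs; destruct (Rcase_abs c), (Rcase_abs y); lra. }
    assert (0 <= y ^ 2) by apply pow2_ge_0.
    replace (F y) with (Derive F c * y) by lra.
    nra. }
split; [now apply H1|].
destruct (MVT_gen (fun s => N / 2 * s ^ 2 - RInt F 0 s) 0 z (fun s => N * s - F s))
  as [c [Hc Heq]].
- intros x _; apply (is_derive_minus (fun s => N / 2 * s ^ 2) (fun s => RInt F 0 s)).
  + auto_derive; [trivial|field].
  + now apply is_derive_RInt_upper.
- intros x _; apply continuity_pt_filterlim.
  apply (continuous_minus (fun s => N / 2 * s ^ 2) (fun s => RInt F 0 s)).
  + apply (ex_derive_continuous (fun s => N / 2 * s ^ 2)); auto_derive; trivial.
  + eapply is_derive_continuous, (is_derive_RInt_upper F 0 CF).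
- rewrite RInt_point in Heq; unfold zero in Heq; simpl in Heq.
  assert (Hcz : Rabs c <= Rabs z /\ 0 <= c * z).
  { revert Hc; unfold Rmin, Rmax; destruct (Rle_dec 0 z); intros Hc; split; try nra;
      unfold Rabs; destruct (Rcase_abs c), (Rcase_abs z); lra. }
  assert (Hc1 := H1 c (proj1 Hcz)).
  assert (0 <= (N * c - F c) * z); [|simpl in *; lra].
  destruct (Req_dec c 0) as [->|Hc0]; [rewrite F0; lra|].
  assert (0 < c ^ 2) by (rewrite <- Rsqr_pow2; now apply Rlt_0_sqr).
  (* [H1] controls only [c F(c)], so the sign is read off after multiplication by [c^2], using
     [c z >= 0]. *)
  apply Rmult_le_reg_l with (c ^ 2); [assumption|].
  assert (0 <= (N * c ^ 2 - c * F c) * (c * z)) by (apply Rmult_le_pos; lra).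
  lra.
Qed.

(** The one-sided bound for [- F]: bounding [V] from above requires [F'] bounded from below, which
    is how [m] enters. *)
Lemma primitive_abs_bound (F : R -> R) M z :
  F 0 = 0 -> (forall y, ex_derive F y) ->
  (forall y, Rabs y <= Rabs z -> Rabs (Derive F y) <= M) ->
  - (M / 2 * z ^ 2) <= RInt F 0 z.
Proof.
intros F0 DF HM.
assert (CF : forall y, continuous F y) by (intros y; now apply (ex_derive_continuous F)).
destruct (one_sided_derivative_bound (fun y => - F y) M z) as [_ H].
- lra.
- intros y; now apply (ex_derive_opp F).
- intros y Hy; rewrite Derive_opp.
  assert (H := HM y Hy); apply Rabs_le_between in H; lra.
- rewrite RInt_Ropp in H by assumption; lra.
Qed.

(** [F(u)] vanishes at both ends because [F 0 = 0], so [- <u_xx, F(u)> = <u_x, F'(u) u_x>]; the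
    other two inequalities integrate pointwise bounds. *)
Lemma ip_nonlinear (F u ux uxx : R -> R) N :
  F 0 = 0 -> (forall z, ex_derive F z /\ continuous (Derive F) z) ->
  (forall x, continuous u x) -> (forall x, continuous ux x) -> (forall x, continuous uxx x) ->
  (forall x, 0 < x < PI -> is_derive u x (ux x)) ->
  (forall x, 0 < x < PI -> is_derive ux x (uxx x)) ->
  u 0 = 0 -> u PI = 0 ->
  (forall x y, 0 <= x <= PI -> Rabs y <= Rabs (u x) -> Derive F y <= N) ->
  - ip uxx (fun x => F (u x)) <= N * ip ux ux /\
  ip u (fun x => F (u x)) <= N * ip u u /\
  RInt (fun x => RInt F 0 (u x)) 0 PI <= N / 2 * ip u u.
Proof.
intros F0 HF Cu Cux Cuxx Du Dux U0 UP HN.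
assert (HP := PI_RGT_0).
assert (CF : forall y, continuous F y) by (intros y; apply (ex_derive_continuous F), HF).
assert (CFu : forall x, continuous (fun x => F (u x)) x)
  by (intros x; now apply (continuous_comp u F)).
assert (CdF : forall x, continuous (fun x => Derive F (u x) * ux x) x).
{ intros x; apply continuous_Rmult; auto; apply (continuous_comp u (Derive F)); auto; apply HF. }
assert (CPhi : forall x, continuous (fun x => RInt F 0 (u x)) x).
{ intros x; apply (continuous_comp u (fun z => RInt F 0 z)); auto.
  eapply is_derive_continuous, (is_derive_RInt_upper F 0 CF). }
unfold ip.
assert (Hle : forall f c, (forall x, continuous f x) ->
  (forall x, 0 <= x <= PI -> f x <= c * (u x * u x)) ->
  RInt f 0 PI <= c * RInt (fun x => u x * u x) 0 PI).
{ intros f c Cf Hf.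
  rewrite <- RInt_Rscal by (intros; now apply continuous_Rmult).
  apply RInt_le; [lra|now apply ex_RInt_continuous_all| |intros; apply Hf; lra].
  apply ex_RInt_continuous_all; intros; apply continuous_Rscal; now apply continuous_Rmult. }
split; [|split].
- fold (ip uxx (fun x => F (u x))); rewrite ip_sym.
  rewrite (ip_by_parts (fun x : R => F (u x)) (fun x : R => Derive F (u x) * ux x) ux uxx); auto.
  + unfold ip; rewrite Ropp_involutive.
    rewrite <- RInt_Rscal by (intros; now apply continuous_Rmult).
    apply RInt_le; [lra| | |].
    * apply ex_RInt_continuous_all; intros; now apply (continuous_Rmult (fun x => Derive F (u x) * ux x)).
    * apply ex_RInt_continuous_all; intros; apply continuous_Rscal; now apply continuous_Rmult.
    * intros x Hx.
      assert (H := HN x (u x) ltac:(lra) (Rle_refl _)).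
      assert (0 <= ux x * ux x) by apply Rle_0_sqr.
      rewrite Rmult_assoc; now apply Rmult_le_compat_r.
  + intros x Hx; rewrite Rmult_comm; apply (is_derive_comp F u); auto.
    apply Derive_correct, HF.
  + now rewrite U0.
  + now rewrite UP.
- apply (Hle (fun x => u x * F (u x))).
  + intros; now apply continuous_Rmult.
  + intros x Hx.
    destruct (one_sided_derivative_bound F N (u x)) as [H _]; auto; [apply HF|intros; now apply (HN x)|].
    lra.
- apply (Hle (fun x => RInt F 0 (u x))); auto.
  intros x Hx.
  destruct (one_sided_derivative_bound F N (u x)) as [_ H]; auto; [apply HF|intros; now apply (HN x)|].
  lra.
Qed.

Lemma primitive_integral_lower (F u : R -> R) M :
  F 0 = 0 -> (forall z, ex_derive F z) -> (forall x, continuous u x) ->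
  (forall x y, 0 <= x <= PI -> Rabs y <= Rabs (u x) -> Rabs (Derive F y) <= M) ->
  - RInt (fun x => RInt F 0 (u x)) 0 PI <= M / 2 * ip u u.
Proof.
intros F0 DF Cu HM; assert (HP := PI_RGT_0).
assert (CF : forall y, continuous F y) by (intros y; now apply (ex_derive_continuous F)).
assert (CPhi : forall x, continuous (fun x => RInt F 0 (u x)) x).
{ intros x; apply (continuous_comp u (fun z => RInt F 0 z)); auto.
  eapply is_derive_continuous, (is_derive_RInt_upper F 0 CF). }
unfold ip; rewrite <- RInt_Ropp, <- RInt_Rscal; auto.
2:{ intros; now apply continuous_Rmult. }
apply RInt_le; [lra| | |].
- apply ex_RInt_continuous_all; intros x; now apply (continuous_opp (fun x => RInt F 0 (u x))).
- apply ex_RInt_continuous_all; intros; apply continuous_Rscal; now apply continuous_Rmult.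
- intros x Hx.
  assert (H := primitive_abs_bound F M (u x) F0 DF (fun y => HM x y ltac:(lra))).
  simpl in H; lra.
Qed.

(** * The functional, the residual of the equation and the derivative formula *)

Definition slice (f : R -> R -> R) (t : R) : R -> R := fun x => f x t.

Definition lyapunov (eps deps Cf F : R -> R) (a' theta gamma : R) (u ux uxx v : R -> R -> R)
    (t : R) : R :=
  ((gamma + 1) * ip (slice v t) (slice v t) + eps t ^ 2 * ip (slice uxx t) (slice uxx t)
   - 2 * eps t * ip (slice uxx t) (slice v t)
   + (Cf t * (1 + gamma) - deps t + eps t * (a' + theta)) * ip (slice ux t) (slice ux t)
   + a' * theta * ip (slice u t) (slice u t) + 2 * theta * ip (slice u t) (slice v t)) / 2
  - (1 + gamma) * RInt (fun x => RInt F 0 (u x t)) 0 PI.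

Lemma lyapunov_continuous eps deps Cf F a' theta gamma u ux uxx v t :
  (forall z, continuous F z) -> continuous2 u -> continuous2 ux -> continuous2 uxx -> continuous2 v ->
  continuous eps t -> continuous deps t -> continuous Cf t ->
  continuous (lyapunov eps deps Cf F a' theta gamma u ux uxx v) t.
Proof.
intros CF Cu Cux Cuxx Cv Ce Cd CC.
assert (Cip : forall f g, continuous2 f -> continuous2 g ->
  continuous (fun s => ip (slice f s) (slice g s)) t)
  by (intros; now apply ip_slice_continuous).
assert (CPhi : continuous (fun s => RInt (fun x => RInt F 0 (u x s)) 0 PI) t).
{ apply (RInt_slice_continuous (fun x s => RInt F 0 (u x s))); [|apply Rlt_le, PI_RGT_0].
  apply (continuous2_comp (fun z => RInt F 0 z)); auto.
  intros z; eapply is_derive_continuous, (is_derive_RInt_upper F 0 CF). }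
assert (Cc : forall k : R, continuous (fun _ : R => k) t) by (intros; apply continuous_const).
assert (Cm : forall f g : R -> R, continuous f t -> continuous g t -> continuous (fun s => f s - g s) t)
  by (intros f g; apply (continuous_minus f g)).
unfold lyapunov, Rdiv.
repeat match goal with
| |- continuous (fun s => @?f s - @?h s) t => apply (Cm f h)
| |- continuous (fun s => @?f s + @?h s) t => apply (continuous_Rplus f h)
| |- continuous (fun s => @?f s * @?h s) t => apply (continuous_Rmult f h)
| |- continuous (fun s => ip (slice ?f s) (slice ?h s)) t => apply (Cip f h)
| |- continuous (fun s => ?k) t => apply (Cc k)
end; auto.
apply (continuous_comp eps (fun x => x ^ 2)); auto.
apply (ex_derive_continuous (fun x => x ^ 2)); auto_derive; trivial.
Qed.

(** The product rule on abstract functions, with the integrals kept opaque; the equation is used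
    only afterwards. *)
Lemma is_derive_quadratic (e de Cf a b p c q w f : R -> R)
    (e1 de1 C1 a1 b1 p1 c1 q1 w1 f1 k1 k2 k3 g t : R) :
  is_derive e t e1 -> is_derive de t de1 -> is_derive Cf t C1 ->
  is_derive a t a1 -> is_derive b t b1 -> is_derive p t p1 -> is_derive c t c1 ->
  is_derive w t w1 -> is_derive q t q1 -> is_derive f t f1 ->
  is_derive (fun s => ((g + 1) * a s + e s ^ 2 * b s - 2 * e s * p s
     + (Cf s * (1 + g) - de s + e s * k1) * c s + k2 * w s + k3 * q s) / 2
     - (1 + g) * f s) t
   (((g + 1) * a1 + (2 * e t * e1 * b t + e t ^ 2 * b1) - 2 * (e1 * p t + e t * p1)
     + ((C1 * (1 + g) - de1 + e1 * k1) * c t + (Cf t * (1 + g) - de t + e t * k1) * c1)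
     + k2 * w1 + k3 * q1) / 2 - (1 + g) * f1).
Proof.
intros He Hde HC Ha Hb Hp Hc Hw Hq Hf.
assert (Hex : forall (h : R -> R) l, is_derive h t l -> ex_derive h t) by (intros; now exists l).
auto_derive; [repeat split; eapply Hex; eassumption|].
rewrite <- (is_derive_unique _ _ _ He), <- (is_derive_unique _ _ _ Hde),
  <- (is_derive_unique _ _ _ HC), <- (is_derive_unique _ _ _ Ha), <- (is_derive_unique _ _ _ Hb),
  <- (is_derive_unique _ _ _ Hp), <- (is_derive_unique _ _ _ Hc), <- (is_derive_unique _ _ _ Hw),
  <- (is_derive_unique _ _ _ Hq), <- (is_derive_unique _ _ _ Hf).
unfold Derive; field.
Qed.

Lemma slice_continuous f t : continuous2 f -> forall x, continuous (slice f t) x.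
Proof. apply continuous2_slice. Qed.

(** Along a solution this equals [a u_t] inside the strip. The coefficient [a] is not assumed
    continuous, whereas this expression is, so it can be integrated. *)
Definition source (eps Cf F : R -> R) (a' : R) (u uxx uxxt v vt : R -> R -> R) (t x : R) : R :=
  F (u x t) + (eps t * uxxt x t + (Cf t * uxx x t + (- a' * v x t + -1 * vt x t))).

Lemma source_continuous eps Cf F a' u uxx uxxt v vt t :
  (forall z, continuous F z) -> continuous2 u -> continuous2 uxx -> continuous2 uxxt ->
  continuous2 v -> continuous2 vt ->
  forall x, continuous (source eps Cf F a' u uxx uxxt v vt t) x.
Proof.
intros CF Cu Cuxx Cuxxt Cv Cvt x; unfold source.
repeat apply continuous_Rplus; try (apply continuous_Rscal; now apply (slice_continuous _ t)).
apply (continuous_comp (slice u t) F); auto; now apply slice_continuous.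
Qed.

Lemma ip_vt eps Cf F a' u uxx uxxt v vt t w :
  (forall z, continuous F z) -> continuous2 u -> continuous2 uxx -> continuous2 uxxt ->
  continuous2 v -> continuous2 vt -> (forall x, continuous w x) ->
  ip w (slice vt t) =
  ip w (fun x => F (u x t)) + eps t * ip w (slice uxxt t) + Cf t * ip w (slice uxx t)
  - a' * ip w (slice v t) - ip w (source eps Cf F a' u uxx uxxt v vt t).
Proof.
intros CF Cu Cuxx Cuxxt Cv Cvt Cw.
assert (C1 : forall x, continuous (fun x => F (u x t)) x)
  by (intros; apply (continuous_comp (slice u t) F); auto; now apply slice_continuous).
assert (C2 : forall f c, continuous2 f -> forall x, continuous (fun x => c * slice f t x) x)
  by (intros; apply continuous_Rscal; now apply slice_continuous).
unfold source.
rewrite (ip_plus w (fun x : R => F (u x t))), (ip_plus w (fun x : R => eps t * slice uxxt t x)),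
  (ip_plus w (fun x : R => Cf t * slice uxx t x)), (ip_plus w (fun x : R => - a' * slice v t x)); auto;
  try (intros; repeat apply continuous_Rplus; now apply C2).
rewrite !ip_scal by (auto; now apply slice_continuous). 
change (fun x : R => vt x t) with (slice vt t); ring.
Qed.

(** After [v_t] is replaced through the equation, [<u, u_xxt> = <u_xx, v>] brings about the
    cancellations; [<u_xx, u_xxt>] disappears as well, and [<v, F(u)>] cancels against the
    derivative of the potential. [<v, u_xxt>] survives with factor [gamma eps]. *)
Lemma is_derive_lyapunov eps deps ddeps Cf dC F a' theta gamma t0 u ux uxx uxxt v vt :
  (forall z, continuous F z) -> regular t0 u ux uxx uxxt v vt ->
  forall t, t0 < t ->
  is_derive eps t (deps t) -> is_derive deps t (ddeps t) -> is_derive Cf t (dC t) ->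
  let S := source eps Cf F a' u uxx uxxt v vt t in
  is_derive (lyapunov eps deps Cf F a' theta gamma u ux uxx v) t
    (gamma * eps t * ip (slice v t) (slice uxxt t)
     - (gamma * a' + a' - theta) * ip (slice v t) (slice v t) - (1 + gamma) * ip (slice v t) S
     - eps t * (Cf t - deps t) * ip (slice uxx t) (slice uxx t)
     + eps t * ip (slice uxx t) S - eps t * ip (slice uxx t) (fun x => F (u x t))
     + (dC t * (1 + gamma) - ddeps t + deps t * (a' + theta)) / 2 * ip (slice ux t) (slice ux t)
     - theta * Cf t * ip (slice ux t) (slice ux t)
     - theta * ip (slice u t) S + theta * ip (slice u t) (fun x => F (u x t))).
Proof.
intros CF Hreg t Ht De Dde DC S.
assert (Cu := reg_u Hreg); assert (Cux := reg_ux Hreg).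
assert (Cuxx := reg_uxx Hreg); assert (Cuxxt := reg_uxxt Hreg).
assert (Cv := reg_v Hreg); assert (Cvt := reg_vt Hreg).
assert (Du := reg_d_u Hreg); assert (Dv := reg_d_v Hreg).
assert (Duxx := reg_d_uxx Hreg).
destruct (regular_green _ _ _ _ _ _ _ Hreg t Ht) as [Hgreen _].
assert (Hux := regular_ip_ux _ _ _ _ _ _ _ Hreg t).
assert (DPhi : is_derive (fun s => RInt (fun x => RInt F 0 (u x s)) 0 PI) t
                 (ip (slice v t) (fun x => F (u x t)))).
{ apply (is_derive_RInt_slice (fun x s => RInt F 0 (u x s)) (fun x s => v x s * F (u x s)) t0);
    auto; [| |apply Rlt_le, PI_RGT_0|].
  - apply (continuous2_comp (fun z => RInt F 0 z)); auto.
    intros z; eapply is_derive_continuous, (is_derive_RInt_upper F 0 CF).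
  - apply continuous2_mult; auto; now apply continuous2_comp.
  - intros x s Hs; apply (is_derive_comp (fun z => RInt F 0 z) (fun r => u x r)); auto.
    now apply is_derive_RInt_upper. }
assert (H := is_derive_quadratic eps deps Cf
  (fun s => ip (slice v s) (slice v s)) (fun s => ip (slice uxx s) (slice uxx s))
  (fun s => ip (slice uxx s) (slice v s)) (fun s => ip (slice ux s) (slice ux s))
  (fun s => ip (slice u s) (slice v s)) (fun s => ip (slice u s) (slice u s))
  (fun s => RInt (fun x => RInt F 0 (u x s)) 0 PI)
  _ _ _ _ _ _ _ _ _ _ (a' + theta) (a' * theta) (2 * theta) gamma t
  De Dde DC
  (is_derive_ip t0 v vt v vt Cv Cvt Cv Cvt Dv Dv t Ht)
  (is_derive_ip t0 uxx uxxt uxx uxxt Cuxx Cuxxt Cuxx Cuxxt Duxx Duxx t Ht)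
  (is_derive_ip t0 uxx uxxt v vt Cuxx Cuxxt Cv Cvt Duxx Dv t Ht)
  (is_derive_ip_ux t0 u ux uxx uxxt v vt Hreg t Ht)
  (is_derive_ip t0 u v u v Cu Cv Cu Cv Du Du t Ht)
  (is_derive_ip t0 u v v vt Cu Cv Cv Cvt Du Dv t Ht) DPhi).
match type of H with is_derive _ _ ?L => match goal with |- is_derive _ _ ?M =>
  replace M with L; [exact H|] end end.
clear H.
change (fun x : R => v x t) with (slice v t) in *.
change (fun x : R => vt x t) with (slice vt t) in *.
change (fun x : R => u x t) with (slice u t) in *.
change (fun x : R => uxx x t) with (slice uxx t) in *.
change (fun x : R => uxxt x t) with (slice uxxt t) in *.
change (fun x : R => ux x t) with (slice ux t) in *.
rewrite (ip_sym (slice vt t) (slice v t)), (ip_sym (slice v t) (slice u t)),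
  (ip_sym (slice uxxt t) (slice uxx t)), (ip_sym (slice uxxt t) (slice v t)).
rewrite !(ip_vt eps Cf F a' u uxx uxxt v vt t) by (auto; now apply slice_continuous).
fold S.
rewrite Hgreen.
replace (ip (slice u t) (slice uxx t)) with (- ip (slice ux t) (slice ux t)) by lra.
rewrite (ip_sym (slice v t) (slice uxx t)).
field.
Qed.

(** The square of [d], written for the extended solution. *)
Definition energy (eps : R -> R) (u ux uxx v : R -> R -> R) (t : R) : R :=
  eps t ^ 2 * ip (slice uxx t) (slice uxx t) + ip (slice ux t) (slice ux t)
  + ip (slice u t) (slice u t) + ip (slice v t) (slice v t).

Lemma energy_continuous eps u ux uxx v t :
  continuous2 u -> continuous2 ux -> continuous2 uxx -> continuous2 v -> continuous eps t ->
  continuous (energy eps u ux uxx v) t.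
Proof.
intros Cu Cux Cuxx Cv Ce; unfold energy.
assert (Cip : forall f, continuous2 f -> continuous (fun s => ip (slice f s) (slice f s)) t)
  by (intros; now apply ip_slice_continuous).
repeat apply (continuous_Rplus (fun _ => _)); auto.
apply (continuous_Rmult (fun s => eps s ^ 2)); auto.
apply (continuous_comp eps (fun x => x ^ 2)); auto.
apply (ex_derive_continuous (fun x => x ^ 2)); auto_derive; trivial.
Qed.

Lemma regular_sup t0 u ux uxx uxxt v vt eps :
  regular t0 u ux uxx uxxt v vt -> forall t x, 0 <= x <= PI ->
  u x t ^ 2 <= energy eps u ux uxx v t.
Proof.
intros Hreg t x Hx.
assert (H := sup_bound (slice u t) (slice ux t) (slice_continuous u t (reg_u Hreg))
  (slice_continuous ux t (reg_ux Hreg))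
  (fun x => reg_dx_u Hreg x t) (reg_0 Hreg t) x Hx).
assert (H1 := ip_ge_0 (slice uxx t) (slice_continuous uxx t (reg_uxx Hreg))).
assert (H2 := ip_ge_0 (slice v t) (slice_continuous v t (reg_v Hreg))).
assert (H3 : 0 <= eps t ^ 2 * ip (slice uxx t) (slice uxx t))
  by (apply Rmult_le_pos; [apply pow2_ge_0|assumption]).
unfold energy; unfold ip in *; unfold slice in *; lra.
Qed.

Lemma regular_Poincare t0 u ux uxx uxxt v vt :
  regular t0 u ux uxx uxxt v vt -> forall t,
  ip (slice u t) (slice u t) <= ip (slice ux t) (slice ux t).
Proof.
intros Hreg t.
apply Poincare; try (apply slice_continuous; apply Hreg).
- intros x Hx; now apply (reg_dx_u Hreg).
- apply Hreg.
- apply Hreg.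
Qed.

(** Meant for [S = alpha v] with [0 <= alpha <= M]: then [|S|^2 <= M^2 |v|^2], and the last bound is
    Young's inequality with weight [c]. *)
Lemma ip_source_bounds S v w M c :
  (forall x, continuous S x) -> (forall x, continuous v x) -> (forall x, continuous w x) ->
  (forall x, 0 < x < PI -> S x * v x >= 0) ->
  (forall x, 0 < x < PI -> Rabs (S x) <= M * Rabs (v x)) -> 0 < c ->
  0 <= ip v S /\ ip w S <= c * ip w w + M ^ 2 / (4 * c) * ip v v.
Proof.
intros CS Cv Cw Hpos HM Hc; assert (HP := PI_RGT_0).
split.
- apply RInt_ge_0_continuous; [lra|intros; now apply continuous_Rmult|].
  intros x Hx; specialize (Hpos x Hx); lra.
- assert (HS : ip S S <= M ^ 2 * ip v v).
  { unfold ip; rewrite <- RInt_Rscal by (intros; now apply continuous_Rmult).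
    apply RInt_le; [lra| | |].
    - apply ex_RInt_continuous_all; intros; now apply continuous_Rmult.
    - apply ex_RInt_continuous_all; intros; apply continuous_Rscal; now apply continuous_Rmult.
    - intros x Hx; specialize (HM x Hx).
      replace (S x * S x) with (Rabs (S x) * Rabs (S x)) by (rewrite <- Rabs_mult; apply Rabs_pos_eq, Rle_0_sqr).
      replace (M ^ 2 * (v x * v x)) with ((M * Rabs (v x)) * (M * Rabs (v x))).
      + apply Rmult_le_compat; auto; apply Rabs_pos.
      + replace (v x * v x) with (Rabs (v x) * Rabs (v x)) by (rewrite <- Rabs_mult; apply Rabs_pos_eq, Rle_0_sqr).
        ring. }
  assert (H := ip_gram w S S (2 * c) (-1) 0 Cw CS CS).
  apply Rmult_le_reg_l with (4 * c); [lra|].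
  replace (4 * c * (c * ip w w + M ^ 2 / (4 * c) * ip v v)) with (4 * c ^ 2 * ip w w + M ^ 2 * ip v v)
    by (field; lra).
  lra.
Qed.

(** * Constants and extended reals *)

Lemma rpow_nonneg x y : 0 <= rpow x y.
Proof. unfold rpow; destruct (Rlt_dec 0 x); [apply Rlt_le, exp_pos|lra]. Qed.

Lemma rpow_le x y w : 0 < w -> x <= y -> rpow x w <= rpow y w.
Proof.
intros Hw Hxy; unfold rpow; destruct (Rlt_dec 0 x), (Rlt_dec 0 y); try lra.
- apply Rle_Rpower_l; lra.
- apply Rlt_le, exp_pos.
Qed.

Lemma rpow_small w e : 0 < w -> 0 < e -> exists x, 0 < x /\ rpow x w <= e.
Proof.
intros Hw He; exists (Rpower e (/ w)); split; [apply exp_pos|].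
unfold rpow; destruct (Rlt_dec 0 (Rpower e (/ w))) as [_|]; [|lra].
rewrite Rpower_mult, Rinv_l, Rpower_1 by lra; lra.
Qed.

Lemma rpow_sqr x y : rpow x (2 * y) = rpow x y ^ 2.
Proof.
unfold rpow; destruct (Rlt_dec 0 x); [|ring].
replace (2 * y) with (y + y) by ring; rewrite Rpower_plus; ring.
Qed.

Lemma rpow_mult_exp b y w : 0 < b -> rpow (b * exp y) w = rpow b w * exp (w * y).
Proof.
intros Hb; unfold rpow.
destruct (Rlt_dec 0 b) as [_|]; [|lra].
destruct (Rlt_dec 0 (b * exp y)) as [_|Hn].
- unfold Rpower; rewrite ln_mult, ln_exp, <- exp_plus by (auto; apply exp_pos).
  f_equal; ring.
- exfalso; apply Hn, Rmult_lt_0_compat; [assumption|apply exp_pos].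
Qed.

Lemma inf_pos_le f : Rbar_lt m_infty (inf_pos f) -> forall t, 0 < t -> real (inf_pos f) <= f t.
Proof.
intros Hf t Ht; unfold inf_pos in *.
set (E := fun y : R => exists t, 0 < t /\ y = f t) in *.
destruct (Glb_Rbar_correct E) as [Hlb _].
assert (H : Rbar_le (Glb_Rbar E) (f t)) by (apply Hlb; now exists t).
destruct (Glb_Rbar E); simpl in *; tauto.
Qed.

(** [real] sends infinite values to 0, so finiteness has to be settled; the value at 1 excludes
    [p_infty]. *)
Lemma inf_pos_ge f l : (forall t, 0 < t -> l <= f t) ->
  Rbar_lt m_infty (inf_pos f) /\ l <= real (inf_pos f).
Proof.
intros Hf; unfold inf_pos.
set (E := fun y : R => exists t, 0 < t /\ y = f t).
destruct (Glb_Rbar_correct E) as [Hlb Hglb].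
assert (H : Rbar_le l (Glb_Rbar E)) by (apply Hglb; intros y [t [Ht ->]]; now apply Hf).
assert (H1 : Rbar_le (Glb_Rbar E) (f 1)) by (apply Hlb; exists 1; split; [lra|reflexivity]).
destruct (Glb_Rbar E); simpl in *; tauto.
Qed.

(** The supremum is finite by the extreme value theorem; an infinite one would be turned into 0 by
    [real]. *)
Lemma m_bound F r : 0 <= r -> (forall z, continuous (Derive F) z) ->
  0 <= m F r /\ forall z, Rabs z <= r -> Rabs (Derive F z) <= m F r.
Proof.
intros Hr CF; unfold m.
set (E := fun y : R => exists z, Rabs z <= r /\ y = Rabs (Derive F z)).
destruct (Lub_Rbar_correct E) as [Hub Hlub].
assert (CA : forall z, - r <= z <= r -> continuity_pt (fun z => Rabs (Derive F z)) z).
{ intros z _; apply continuity_pt_filterlim.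
  apply (continuous_comp (Derive F) Rabs); [apply CF|apply continuous_Rabs]. }
destruct (continuity_ab_maj (fun z => Rabs (Derive F z)) (- r) r ltac:(lra) CA) as [M [HM _]].
assert (H1 : Rbar_le (Lub_Rbar E) (Rabs (Derive F M))).
{ apply Hlub; intros y [z [Hz ->]]; apply HM; now apply Rabs_le_between. }
assert (H2 : forall z, Rabs z <= r -> Rbar_le (Rabs (Derive F z)) (Lub_Rbar E))
  by (intros z Hz; apply Hub; now exists z).
assert (H0 : Rbar_le (Rabs (Derive F 0)) (Lub_Rbar E)) by (apply H2; now rewrite Rabs_R0).
destruct (Lub_Rbar E); simpl in *; try tauto.
split; [eapply Rle_trans; [apply Rabs_pos|exact H0]|exact H2].
Qed.

(** The summands over [a' + ebar] provide the dissipation of [|v|^2] and the positivity of [V];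
    [(a' + theta) / mu] serves the coefficient of [|u_x|^2], and [theta^2] with [(a' + 1) theta] the
    form [a' theta |u|^2 + 2 theta <u, v>]. *)
Lemma gamma3_facts a' A mu tau theta ebar Cbar k sigma :
  0 <= ebar -> 0 < Cbar -> 0 < mu -> 0 <= k -> 0 < a' + ebar / 2 -> 0 < theta ->
  2 * k <= mu * (theta + a') ->
  let g3 := gamma3 a' A mu tau theta ebar Cbar sigma in
  2 <= g3 /\ 1 + (a' + theta) / mu <= g3 /\
  1 <= g3 * (a' + ebar) + a' - theta - (A * rpow sigma tau) ^ 2 * (/ mu + theta / Cbar) /\
  theta - a' + 1 <= g3 * (a' + ebar) /\
  forall a e q, 0 <= a -> 0 <= e -> (forall y z, 0 <= y ^ 2 * e + z ^ 2 * a + 2 * y * z * q) ->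
  a' * theta * e + 2 * theta * q <= g3 * (a + e).
Proof.
intros He HC Hmu Hk Hae Ht Hk2.
assert (Hta : 0 <= theta + a') by (apply Rmult_le_reg_l with mu; lra).
assert (Hta' : 0 <= (a' + theta) / mu) by (apply Rdiv_le_0_compat; lra).
set (T := / mu + theta / Cbar).
assert (HT : 0 < T).
{ assert (0 < / mu) by (now apply Rinv_0_lt_compat).
  assert (0 < theta / Cbar) by (now apply Rdiv_lt_0_compat). unfold T; lra. }
set (s := (A * rpow sigma tau) ^ 2 * T).
assert (Hs : 0 <= s) by (apply Rmult_le_pos; [apply pow2_ge_0|lra]).
set (R0 := theta ^ 2 + 2 + (a' + theta) / mu + (a' + 1) * theta).
set (P := (1 + theta + ebar / 2 + s) / (a' + ebar)).
assert (HP : 0 < P) by (apply Rdiv_lt_0_compat; lra).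
assert (Hg3 : gamma3 a' A mu tau theta ebar Cbar sigma = R0 + P).
{ unfold gamma3; rewrite rpow_sqr; unfold P, R0, s, T; field; lra. }
intros g3; unfold g3; rewrite Hg3; clear g3.
assert (HPe : P * (a' + ebar) = 1 + theta + ebar / 2 + s) by (unfold P; field; lra).
assert (Htt : 0 <= theta * (theta + a')) by (apply Rmult_le_pos; lra).
assert (HR0 : 2 + theta + (a' + theta) / mu <= R0) by (unfold R0; lra).
assert (HR1 : 0 <= R0 * (a' + ebar)) by (apply Rmult_le_pos; lra).
split; [lra|]; split; [lra|]; split; [lra|]; split; [lra|].
intros a e q Ha Hee Hq.
(* For [a' < -1] the summand [(a' + 1) theta] is negative; Young's inequality is then weighted so
   that its [e] part is exactly cancelled by [a' theta e]. *)
destruct (Rle_lt_dec (-1) a') as [Ha1|Ha1].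
- assert (0 <= (a' + 1) * theta) by (apply Rmult_le_pos; lra).
  assert (theta ^ 2 <= R0) by (unfold R0; lra).
  assert (a' * theta + 1 <= R0).
  { assert (0 <= theta ^ 2) by apply pow2_ge_0. unfold R0; lra. }
  assert (H2 := Hq 1 (- theta)).
  assert (0 <= (R0 - theta ^ 2) * a) by (apply Rmult_le_pos; lra).
  assert (0 <= (R0 - (a' * theta + 1)) * e) by (apply Rmult_le_pos; lra).
  assert (0 <= P * (a + e)) by (apply Rmult_le_pos; lra).
  lra.
- assert (H2 := Hq (- a') (-1)).
  assert (Hb : 0 < theta / (- a')) by (apply Rdiv_lt_0_compat; lra).
  assert (Hb1 : theta / (- a') <= theta).
  { apply Rmult_le_reg_r with (- a'); [lra|]; unfold Rdiv; rewrite Rmult_assoc, Rinv_l by lra.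
    assert (0 <= theta * (- a' - 1)) by (apply Rmult_le_pos; lra). lra. }
  assert (H3 : 0 <= theta / (- a') * (a' ^ 2 * e + a + 2 * a' * q)) by (apply Rmult_le_pos; lra).
  replace (theta / (- a') * (a' ^ 2 * e + a + 2 * a' * q)) with
    (- (a' * theta * e) + theta / (- a') * a - 2 * theta * q) in H3 by (field; lra).
  assert (0 <= (R0 - theta / (- a')) * a) by (apply Rmult_le_pos; lra).
  assert (0 <= P * (a + e)) by (apply Rmult_le_pos; lra).
  assert (0 <= R0 * e) by (apply Rmult_le_pos; lra).
  lra.
Qed.

Lemma theta2_facts a' k mu ebar eddbar Cbar theta :
  0 < mu -> 0 < Cbar -> 0 < a' + ebar / 2 -> 0 < mu + Cbar / 2 - 2 * k ->
  theta2 a' k mu ebar eddbar Cbar < theta ->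
  0 < theta /\ 2 * a' <= theta /\ 2 * k <= mu * (theta + a') /\
  5 - eddbar - a' * (mu - Cbar) <= theta * (mu + Cbar / 2 - 2 * k).
Proof.
intros Hmu HC Hae Hden Hth; unfold theta2, theta1 in Hth.
assert (H1 := Rle_lt_trans _ _ _ (Rmax_r _ _) Hth).
assert (H2 := Rle_lt_trans _ _ _ (Rmax_l _ _) Hth).
assert (H3 := Rle_lt_trans _ _ _ (Rmax_l _ _) H2).
assert (H4 := Rle_lt_trans _ _ _ (Rmax_r _ _) H2).
assert (H5 := Rle_lt_trans _ _ _ (Rmax_l _ _) H4).
assert (H6 := Rle_lt_trans _ _ _ (Rmax_r _ _) H4).
split; [|split; [|split]].
- apply Rle_lt_trans with (2 := H1); apply Rdiv_le_0_compat; lra.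
- lra.
- apply (Rmult_lt_compat_r mu) in H5; [|lra].
  replace ((2 * k / mu - a') * mu) with (2 * k - a' * mu) in H5 by (field; lra). lra.
- apply (Rmult_lt_compat_r (mu + Cbar / 2 - 2 * k)) in H6; [|lra].
  unfold Rdiv in H6 at 1; rewrite Rmult_assoc, Rinv_l in H6 by lra. lra.
Qed.

(** * From solutions to differential inequalities *)

Lemma dot_correct f : C1_on (from 0) f -> forall t, 0 < t -> is_derive f t (dot f t).
Proof.
intros [Hf _] t Ht; apply derive_in_interior; [now apply locally_from|].
apply Hf; unfold from; lra.
Qed.

(** The origin of [kappa]. Taking [kappa >= 1] keeps the initial time off 0, where derivatives are
    one-sided and the infima over [t > 0] say nothing directly. *)
Lemma slow_variation dC gamma :
  0 <= gamma ->
  ((forall t, 0 <= t -> dC t <= 0) \/ is_lim dC p_infty 0) ->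
  exists kappa, 1 <= kappa /\ forall t, kappa <= t -> dC t * (1 + gamma) <= 1.
Proof.
intros Hg [H|H].
- exists 1; split; [lra|]; intros t Ht.
  assert (0 <= - dC t * (1 + gamma)) by (apply Rmult_le_pos; [specialize (H t)|]; lra). lra.
- apply is_lim_spec in H.
  assert (He : 0 < / (1 + gamma)) by (apply Rinv_0_lt_compat; lra).
  destruct (H (mkposreal _ He)) as [M HM].
  exists (Rmax 1 (M + 1)); split; [apply Rmax_l|]; intros t Ht.
  assert (M + 1 <= t) by (eapply Rle_trans; [apply Rmax_r|exact Ht]).
  assert (H1 := HM t ltac:(lra)); simpl in H1.
  apply Rabs_def2 in H1.
  apply Rmult_le_reg_r with (/ (1 + gamma)); [assumption|].
  rewrite Rmult_assoc, Rinv_r by lra; lra.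
Qed.

Lemma dsol_energy eps t0 u :
  classical t0 u -> forall t, t0 <= t ->
  dsol eps t0 u t = sqrt (energy eps (extend t0 u) (extend t0 (d_x u))
                            (extend t0 (d_x (d_x u))) (extend t0 (d_t t0 u)) t).
Proof.
intros (Cu & [_ Cux] & [_ Cuxx] & _ & [_ Cv] & _) t Ht.
unfold dsol, dist; f_equal; unfold dist2, energy, ip.
assert (HP := PI_RGT_0).
assert (Cm : forall f, continuous2 f -> forall x, continuous (fun x => slice f t x * slice f t x) x)
  by (intros; apply continuous_Rmult; now apply slice_continuous).
apply extend_continuous2 in Cu, Cux, Cuxx, Cv.
rewrite <- RInt_Rscal by now apply Cm.
rewrite <- RInt_Rplus, <- RInt_Rplus, <- RInt_Rplus;
  try (now apply Cm);
  try (intros; repeat apply (continuous_Rplus (fun _ => _)); try apply continuous_Rscal; now apply Cm).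
apply RInt_ext; rewrite Rmin_left, Rmax_right by lra; intros x Hx.
unfold slice; rewrite !extend_id by lra.
change (derive_in I0pi (derive_in I0pi (fun x => u x t)) x) with (d_x (d_x u) x t).
change (derive_in I0pi (fun x => u x t) x) with (d_x u x t); simpl; ring.
Qed.

(** [kappa], [c0] and [xi] are chosen before [t0] and the solution, which makes uniformity possible
    when [g] is bounded. *)
Lemma solution_estimates (eps C F : R -> R) a' a k h A omega rho mu tau theta sigma ebar eddbar Cbar :
  (forall t, 0 < t -> is_derive eps t (dot eps t)) ->
  (forall t, 0 < t -> is_derive (dot eps) t (dot (dot eps) t)) ->
  (forall t, 0 < t -> is_derive C t (dot C t)) ->
  (forall z, ex_derive F z /\ continuous (Derive F) z) -> F 0 = 0 ->
  (forall z, Rabs z < rho -> Derive F z <= k + h * rpow (Rabs z) omega) ->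
  0 <= ebar -> (forall t, 0 < t -> ebar <= eps t) ->
  0 < Cbar -> (forall t, 0 < t -> Cbar <= C t) ->
  (forall t, 0 < t -> eddbar <= dot (dot eps) t) ->
  0 <= k -> 0 <= h -> 0 <= A -> 0 < omega -> 0 < rho -> 0 < mu -> 0 < tau -> k < Cbar ->
  (forall t, 0 <= t -> mu * (1 + eps t) <= C t - dot eps t) ->
  0 < mu + Cbar / 2 - 2 * k ->
  (forall t0 u0 u1 u, 0 <= t0 -> is_solution eps C F a' a t0 u0 u1 u ->
     forall x t, 0 < x < PI -> t0 < t ->
     0 <= along a t0 u x t <= A * rpow (dsol eps t0 u t) tau) ->
  0 < a' + ebar / 2 ->
  ((forall t, 0 <= t -> dot C t <= 0) \/ is_lim (dot C) p_infty 0) ->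
  theta2 a' k mu ebar eddbar Cbar < theta -> 0 < sigma ->
  exists kappa c0 xi, 1 <= kappa /\ 0 < c0 /\ 0 < xi /\
  forall t0 u0 u1 u, kappa <= t0 -> is_solution eps C F a' a t0 u0 u1 u ->
  exists D2 V V' : R -> R,
    (forall t, t0 <= t -> dsol eps t0 u t = sqrt (D2 t)) /\
    (forall t, 0 <= D2 t) /\
    (forall t, t0 <= t -> continuous D2 t) /\ (forall t, t0 <= t -> continuous V t) /\
    (forall t, t0 < t -> is_derive V t (V' t)) /\
    (forall t, t0 <= t -> D2 t <= xi ^ 2 ->
       c0 * D2 t <= V t /\
       V t <= (1 + m F sigma) * (1 + gamma3 a' A mu tau theta ebar Cbar sigma) * g eps C t * D2 t) /\
    (forall t, t0 < t -> D2 t <= xi ^ 2 ->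
       V' t <= - eta mu * D2 t
               + h * rpow (sqrt (D2 t)) omega * ((2 / mu + theta) * g eps C t) * D2 t).
Proof.
intros De Dde DC HF F0 HFk Heb He HCb HC Hdd Hk Hh HA Hom Hrho Hmu Htau HkC HQ Hden Ha Hae HdC Hth Hsig.
destruct (theta2_facts _ _ _ _ _ _ _ Hmu HCb Hae Hden Hth) as (Ht & Ht1 & Ht2 & Ht3).
destruct (gamma3_facts a' A mu tau theta ebar Cbar k sigma Heb HCb Hmu Hk Hae Ht Ht2)
  as (Hg2 & HgK & Hgdis & HgTh & Hgq).
set (gam := gamma3 a' A mu tau theta ebar Cbar sigma) in *.
set (M := A * rpow sigma tau) in *.
assert (Hta : 0 <= theta + a') by (apply Rmult_le_reg_l with mu; lra).
assert (HTh : 0 <= theta - a') by (destruct (Rle_lt_dec 0 a'); lra).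
destruct (slow_variation (dot C) gam ltac:(lra) HdC) as (kappa & Hkap & HdCk).
(* When [k > mu], positivity comes from [gam >= 2] and [mu + Cbar / 2 > 2 k]. *)
assert (Hkp : 0 < gam * Cbar + mu - (1 + gam) * k).
{ assert (0 < gam * (Cbar - k)) by (apply Rmult_lt_0_compat; lra).
  destruct (Rle_lt_dec k mu); [lra|].
  assert (0 <= (gam - 2) * (Cbar - k)) by (apply Rmult_le_pos; lra). lra. }
destruct (lyapunov_lower ebar Cbar k a' mu theta gam) as (c0 & Hc0 & Hlow); try lra.
set (kp := gam * Cbar + mu - (1 + gam) * k) in *.
destruct (rpow_small omega (kp / 2 / ((1 + gam) * (h + 1))) Hom) as (x1 & Hx1 & Hx1').
{ repeat apply Rdiv_lt_0_compat; try lra; apply Rmult_lt_0_compat; lra. }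
(* [x1] keeps [(1 + gam) h d^omega] below [kp / 2]; [sigma] gives [|u| <= sigma], as [m] requires,
   and the bound [M] on [a]; [rho / 2] keeps [u] where the bound on [F'] holds. *)
set (xi := Rmin x1 (Rmin sigma (rho / 2))).
assert (Hxi : 0 < xi) by (repeat apply Rmin_glb_lt; lra).
assert (Hxi1 : xi <= x1) by apply Rmin_l.
assert (Hxi2 : xi <= sigma) by (eapply Rle_trans; [apply Rmin_r|apply Rmin_l]).
assert (Hxi3 : xi <= rho / 2) by (eapply Rle_trans; [apply Rmin_r|apply Rmin_r]).
exists kappa, c0, xi; do 3 (split; [assumption|]).
intros t0 u0 u1 u Ht0 Hsol.
assert (Hcl := proj1 Hsol).
assert (Hbd : forall t, t0 <= t -> u 0 t = 0 /\ u PI t = 0) by apply Hsol.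
assert (Hreg := classical_regular t0 u Hcl Hbd).
assert (Hd := dsol_energy eps t0 u Hcl).
set (U := extend t0 u) in *; set (Ux := extend t0 (d_x u)) in *.
set (Uxx := extend t0 (d_x (d_x u))) in *; set (Uxxt := extend t0 (d_t t0 (d_x (d_x u)))) in *.
set (Ut := extend t0 (d_t t0 u)) in *; set (Utt := extend t0 (d_t t0 (d_t t0 u))) in *.
assert (CF : forall z, continuous F z) by (intros z; apply (ex_derive_continuous F), HF).
assert (Cu := reg_u Hreg); assert (Cux := reg_ux Hreg).
assert (Cuxx := reg_uxx Hreg); assert (Cuxxt := reg_uxxt Hreg).
assert (Cv := reg_v Hreg); assert (Cvt := reg_vt Hreg).
set (D2 := energy eps U Ux Uxx Ut).
set (V := lyapunov eps (dot eps) C F a' theta gam U Ux Uxx Ut).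
assert (HDV := fun t (H : t0 < t) => is_derive_lyapunov eps (dot eps) (dot (dot eps)) C (dot C) F a'
  theta gam t0 U Ux Uxx Uxxt Ut Utt CF Hreg t H (De t ltac:(lra)) (Dde t ltac:(lra)) (DC t ltac:(lra))).
cbv zeta in HDV.
assert (Hpos : forall t, 0 <= ip (slice Uxx t) (slice Uxx t) /\ 0 <= ip (slice Ux t) (slice Ux t) /\
  0 <= ip (slice U t) (slice U t) /\ 0 <= ip (slice Ut t) (slice Ut t)).
{ intros t; repeat split; apply ip_ge_0; now apply slice_continuous. }
assert (HD2 : forall t, 0 <= D2 t).
{ intros t; destruct (Hpos t) as (P1 & P2 & P3 & P4); unfold D2, energy.
  assert (0 <= eps t ^ 2 * ip (slice Uxx t) (slice Uxx t)) by (apply Rmult_le_pos; [apply pow2_ge_0|lra]).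
  lra. }
assert (Hgram : forall t x y z,
  0 <= x ^ 2 * ip (slice Uxx t) (slice Uxx t) + y ^ 2 * ip (slice U t) (slice U t)
       + z ^ 2 * ip (slice Ut t) (slice Ut t) - 2 * x * y * ip (slice Ux t) (slice Ux t)
       + 2 * x * z * ip (slice Uxx t) (slice Ut t) + 2 * y * z * ip (slice U t) (slice Ut t)).
{ intros t x y z.
  assert (H := ip_gram (slice Uxx t) (slice U t) (slice Ut t) x y z
    (slice_continuous _ t Cuxx) (slice_continuous _ t Cu) (slice_continuous _ t Cv)).
  assert (H1 : ip (slice Ux t) (slice Ux t) = - ip (slice U t) (slice Uxx t)) by apply (regular_ip_ux _ _ _ _ _ _ _ Hreg).
  rewrite (ip_sym (slice Uxx t) (slice U t)) in H; rewrite H1; lra. }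
assert (Hsmall : forall t, D2 t <= xi ^ 2 -> 0 <= sqrt (D2 t) <= xi).
{ intros t H; split; [apply sqrt_pos|].
  rewrite <- (sqrt_pow2 xi) by lra; now apply sqrt_le_1_alt. }
assert (HU : forall t x, 0 <= x <= PI -> Rabs (U x t) <= sqrt (D2 t)).
{ intros t x Hx; rewrite <- sqrt_Rsqr_abs; apply sqrt_le_1_alt.
  rewrite Rsqr_pow2; now apply (regular_sup _ _ _ _ _ _ _ eps Hreg). }
assert (HFN : forall t, D2 t <= xi ^ 2 -> forall x y, 0 <= x <= PI -> Rabs y <= Rabs (slice U t x) ->
  Derive F y <= k + h * rpow (sqrt (D2 t)) omega).
{ intros t H x y Hx Hy; assert (H1 := Hsmall t H); assert (H2 := HU t x Hx); unfold slice in Hy.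
  assert (rpow (Rabs y) omega <= rpow (sqrt (D2 t)) omega) by (apply rpow_le; lra).
  assert (Derive F y <= k + h * rpow (Rabs y) omega) by (apply HFk; lra).
  assert (h * rpow (Rabs y) omega <= h * rpow (sqrt (D2 t)) omega) by (apply Rmult_le_compat_l; lra).
  lra. }
assert (HNL := fun t (H : D2 t <= xi ^ 2) => ip_nonlinear F (slice U t) (slice Ux t) (slice Uxx t)
  (k + h * rpow (sqrt (D2 t)) omega) F0 HF (slice_continuous _ t Cu) (slice_continuous _ t Cux)
  (slice_continuous _ t Cuxx) (fun x => reg_dx_u Hreg x t)
  (fun x => reg_dx_ux Hreg x t) (reg_0 Hreg t)
  (reg_PI Hreg t) (HFN t H)).
assert (Hec : forall t, ip (slice U t) (slice U t) <= ip (slice Ux t) (slice Ux t))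
  by (apply (regular_Poincare _ _ _ _ _ _ _ Hreg)).
destruct (m_bound F sigma ltac:(lra) (fun z => proj2 (HF z))) as [Hm0 Hm].
exists D2, V, (fun t => Derive V t).
split; [exact Hd|]; split; [exact HD2|]; split; [|split; [|split; [|split]]].
- intros t Htt; apply energy_continuous; auto.
  eapply is_derive_continuous, De; lra.
- intros t Htt; apply lyapunov_continuous; auto; eapply is_derive_continuous;
    [apply De|apply Dde|apply DC]; lra.
- intros t Htt; apply Derive_correct; eexists; now apply HDV.
- intros t Htt Hle.
  assert (Hs := Hsmall t Hle); destruct (HNL t Hle) as (_ & _ & HW).
  destruct (Hpos t) as (P1 & P2 & P3 & P4).
  assert (Hr := rpow_nonneg (sqrt (D2 t)) omega).
  assert (Hhr : 0 <= h * rpow (sqrt (D2 t)) omega) by (apply Rmult_le_pos; lra).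
  split.
  + apply (Hlow (eps t) (dot eps t) (C t) (h * rpow (sqrt (D2 t)) omega)); auto.
    * apply He; lra.
    * apply HC; lra.
    * apply HQ; lra.
    * lra.
    * assert (Hr1 : rpow (sqrt (D2 t)) omega <= kp / 2 / ((1 + gam) * (h + 1)))
        by (eapply Rle_trans; [apply (rpow_le _ x1); lra|exact Hx1']).
      apply (Rmult_le_compat_l ((1 + gam) * (h + 1))) in Hr1;
        [|apply Rmult_le_pos; lra].
      replace ((1 + gam) * (h + 1) * (kp / 2 / ((1 + gam) * (h + 1)))) with (kp / 2) in Hr1
        by (field; lra).
      assert (0 <= (1 + gam) * rpow (sqrt (D2 t)) omega) by (apply Rmult_le_pos; lra).
      lra.
  + apply (lyapunov_upper (eps t) (dot eps t) (C t) a' mu theta gam (m F sigma)); auto; try lra.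
    * specialize (He t); lra.
    * specialize (HC t); lra.
    * apply HQ; lra.
    * assert (H := Hgram t (eps t) 0 1); lra.
    * apply Hgq; auto; intros y z; assert (H := Hgram t 0 y z); lra.
    * apply primitive_integral_lower; auto; [apply HF|now apply slice_continuous|].
      intros x y Hx Hy; apply Hm; assert (H := HU t x Hx); unfold slice in Hy; lra.
- intros t Htt Hle.
  eapply Rle_trans; [apply Req_le, (is_derive_unique V t _ (HDV t Htt))|].
  assert (Hs := Hsmall t Hle); destruct (HNL t Hle) as (Hf1 & Hf2 & _).
  destruct (Hpos t) as (P1 & P2 & P3 & P4).
  assert (Hr := rpow_nonneg (sqrt (D2 t)) omega).
  assert (Hhr : 0 <= h * rpow (sqrt (D2 t)) omega) by (apply Rmult_le_pos; lra).
  assert (Het : ebar <= eps t) by (apply He; lra).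
  assert (HCt : Cbar <= C t) by (apply HC; lra).
  assert (HQt := HQ t ltac:(lra)).
  set (S := source eps C F a' U Uxx Uxxt Ut Utt t).
  assert (CS : forall x, continuous S x) by (now apply source_continuous).
  assert (HS : forall x, 0 < x < PI -> exists al, 0 <= al <= M /\ S x = al * slice Ut t x).
  { intros x Hx; exists (along a t0 u x t); split.
    - destruct (Ha t0 u0 u1 u ltac:(lra) Hsol x t Hx Htt) as [H1 H2]; split; [assumption|].
      eapply Rle_trans; [exact H2|]; apply Rmult_le_compat_l; [assumption|].
      apply rpow_le; [assumption|]; rewrite Hd by lra; fold D2; lra.
    - assert (H := proj1 (proj2 Hsol) x t Hx Htt).
      unfold S, source, slice, U, Uxx, Uxxt, Ut, Utt; rewrite !extend_id by lra; lra. }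
  assert (HSv : forall x, 0 < x < PI -> S x * slice Ut t x >= 0).
  { intros x Hx; destruct (HS x Hx) as (al & Hal & ->).
    rewrite Rmult_assoc; apply Rle_ge, Rmult_le_pos; [lra|apply Rle_0_sqr]. }
  assert (HSM : forall x, 0 < x < PI -> Rabs (S x) <= M * Rabs (slice Ut t x)).
  { intros x Hx; destruct (HS x Hx) as (al & Hal & ->).
    rewrite Rabs_mult, (Rabs_pos_eq al) by lra.
    apply Rmult_le_compat_r; [apply Rabs_pos|lra]. }
  assert (Cvt' := slice_continuous _ t Cv); assert (Cut' := slice_continuous _ t Cu).
  assert (Cuxx' := slice_continuous _ t Cuxx).
  (* Testing with [- u] gives the required lower bound on [<u, S>]. *)
  destruct (ip_source_bounds S (slice Ut t) (fun x : R => -1 * slice U t x) M (Cbar / 4) CS Cvt') as [Hs1 Hs3];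
    auto; [intros; now apply continuous_Rscal|lra|].
  assert (Hs2 : eps t * ip (slice Uxx t) S <= mu / 4 * eps t ^ 2 * ip (slice Uxx t) (slice Uxx t)
                + M ^ 2 / mu * ip (slice Ut t) (slice Ut t)).
  (* The Young weight [eps t * mu / 4] vanishes with [eps t]; in that case the left-hand side is
     0. *)
  { destruct (Rle_lt_or_eq_dec 0 (eps t) ltac:(lra)) as [Hp|Hz].
    - destruct (ip_source_bounds S (slice Ut t) (slice Uxx t) M (eps t * mu / 4) CS Cvt') as [_ H]; auto;
        [apply Rdiv_lt_0_compat; [now apply Rmult_lt_0_compat|lra]|].
      apply (Rmult_le_compat_l (eps t)) in H; [|lra].
      replace (mu / 4 * eps t ^ 2 * ip (slice Uxx t) (slice Uxx t) + M ^ 2 / mu * ip (slice Ut t) (slice Ut t))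
        with (eps t * (eps t * mu / 4 * ip (slice Uxx t) (slice Uxx t)
                       + M ^ 2 / (4 * (eps t * mu / 4)) * ip (slice Ut t) (slice Ut t))) by (field; lra).
      exact H.
    - rewrite <- Hz.
      assert (0 <= M ^ 2 / mu * ip (slice Ut t) (slice Ut t)); [|lra].
      apply Rmult_le_pos; [apply Rdiv_le_0_compat; [apply pow2_ge_0|lra]|lra]. }
  assert (Hw : forall f, (forall x, continuous f x) ->
    ip (fun x : R => -1 * slice U t x) f = -1 * ip (slice U t) f)
    by (intros; rewrite ip_sym, ip_scal, ip_sym; auto).
  rewrite (Hw S CS), Hw, (ip_sym (slice U t) (fun x : R => -1 * slice U t x)), (Hw _ Cut') in Hs3
    by (intros; now apply continuous_Rscal).
  destruct (regular_green _ _ _ _ _ _ _ Hreg t Htt) as [_ Hgreen].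
  assert (Hmain := dissipation_bound (eps t) (dot eps t) (dot (dot eps) t) (C t) (dot C t) Cbar ebar
    eddbar k (h * rpow (sqrt (D2 t)) omega) a' mu theta gam (M ^ 2)
    (ip (slice Ut t) (slice Ut t)) (ip (slice Uxx t) (slice Uxx t)) (ip (slice Ux t) (slice Ux t))
    (ip (slice U t) (slice U t)) (ip (slice Ut t) (slice Uxxt t)) (ip (slice Ut t) S) (ip (slice Uxx t) S)
    (ip (slice U t) S) (ip (slice Uxx t) (fun x => F (U x t))) (ip (slice U t) (fun x => F (U x t)))).
  eapply Rle_trans; [apply Hmain; clear Hmain|clear Hmain].
  all: try assumption.
  all: try (split; [lra|apply Hec]).
  all: try lra.
  + apply Hdd; lra.
  + apply HdCk; lra.
  + apply pow2_ge_0.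
  + replace (Cbar / 4 * ip (slice U t) (slice U t) + M ^ 2 / Cbar * ip (slice Ut t) (slice Ut t)) with
      (Cbar / 4 * (-1 * (-1 * ip (slice U t) (slice U t)))
       + M ^ 2 / (4 * (Cbar / 4)) * ip (slice Ut t) (slice Ut t)) by (field; lra).
    lra.
  (* Poincare turns [2 |u_x|^2] into at least [|u_x|^2 + |u|^2], so the dissipation dominates
     [eta d^2]. *)
  + assert (Heta : 0 <= eta mu /\ eta mu <= 1 /\ eta mu <= 3 / 4 * mu).
    { unfold eta; split; [apply Rmin_glb; lra|split; [apply Rmin_l|apply Rmin_r]]. }
    assert (Hb : 0 <= eps t ^ 2 * ip (slice Uxx t) (slice Uxx t))
      by (apply Rmult_le_pos; [apply pow2_ge_0|lra]).
    assert (Hec' := Hec t).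
    assert (E1 : 0 <= (3 / 4 * mu - eta mu) * (eps t ^ 2 * ip (slice Uxx t) (slice Uxx t)))
      by (apply Rmult_le_pos; lra).
    assert (E2 : 0 <= (1 - eta mu) * ip (slice Ut t) (slice Ut t)) by (apply Rmult_le_pos; lra).
    assert (E3 : 0 <= (1 - eta mu) * (ip (slice Ux t) (slice Ux t) + ip (slice U t) (slice U t)))
      by (apply Rmult_le_pos; lra).
    assert (Hmue : 0 <= mu * eps t) by (apply Rmult_le_pos; lra).
    assert (Hg1 : 1 <= g eps C t) by (unfold g; lra).
    (* From [mu eps <= C - dot eps <= 2 g] and [g >= 1]; this is the origin of the constant
       [2 / mu + theta]. *)
    assert (Hcoef : eps t + theta <= (2 / mu + theta) * g eps C t).
    { assert (eps t <= 2 / mu * g eps C t).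
      { apply Rmult_le_reg_l with mu; [assumption|].
        replace (mu * (2 / mu * g eps C t)) with (2 * g eps C t) by (field; lra).
        unfold g; lra. }
      assert (0 <= theta * (g eps C t - 1)) by (apply Rmult_le_pos; lra). lra. }
    assert (E4 : h * rpow (sqrt (D2 t)) omega * (eps t + theta) * ip (slice Ux t) (slice Ux t)
      <= h * rpow (sqrt (D2 t)) omega * ((2 / mu + theta) * g eps C t) * D2 t).
    { apply Rmult_le_compat; try lra.
      - apply Rmult_le_pos; lra.
      - now apply Rmult_le_compat_l.
      - unfold D2, energy; lra. }
    assert (HDe : eta mu * D2 t = eta mu * (eps t ^ 2 * ip (slice Uxx t) (slice Uxx t))
      + eta mu * (ip (slice Ux t) (slice Ux t) + ip (slice U t) (slice U t)) + eta mu * ip (slice Ut t) (slice Ut t))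
      by (unfold D2, energy; ring).
    lra.
Qed.

(** * The comparison equation *)

Lemma RInt_0_monotone (f : R -> R) S T :
  (forall t, continuous f t) -> (forall t, 0 <= t -> 0 <= f t) -> 0 <= S <= T ->
  RInt f 0 S <= RInt f 0 T.
Proof.
intros Cf Hf HST.
rewrite <- (RInt_Chasles f 0 S T) by now apply ex_RInt_continuous_all.
assert (0 <= RInt f S T) by (apply RInt_ge_0_continuous; auto; [lra|intros; apply Hf; lra]).
unfold plus; simpl; lra.
Qed.

(** The primitive is nondecreasing, so if it were unbounded its limit would be [p_infty]. [fc] is a
    version of [f] continuous on the whole line. *)
Lemma integral_0_infty_bounded (f fc : R -> R) :
  (forall t, continuous fc t) -> (forall t, 0 <= t -> 0 <= fc t) ->
  (forall t, 0 <= t -> f t = fc t) -> integral_0_infty f <> p_infty ->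
  exists M, forall T, 0 <= T -> RInt fc 0 T <= M.
Proof.
intros Cf Hf Heq Hfin.
apply NNPP; intros Hno; apply Hfin.
unfold integral_0_infty; apply is_lim_unique, is_lim_spec; intros M.
destruct (not_all_ex_not _ _ (fun H => Hno (ex_intro _ M H))) as [T HT].
apply imply_to_and in HT; destruct HT as [HT0 HT].
exists T; intros S HS.
replace (RInt f 0 S) with (RInt fc 0 S).
2:{ apply RInt_ext; rewrite Rmin_left, Rmax_right by lra; intros x Hx; symmetry; apply Heq; lra. }
assert (H := RInt_0_monotone fc T S Cf Hf ltac:(lra)); lra.
Qed.

(** [Lim] at [p_infty] is a limit along the integers, so a bound on the primitive there would bound
    the integral. *)
Lemma integral_0_infty_unbounded (f fc : R -> R) :
  (forall t, 0 <= t -> f t = fc t) -> integral_0_infty f = p_infty ->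
  forall M, exists T, 0 <= T /\ M <= RInt fc 0 T.
Proof.
intros Heq Hinf M.
apply NNPP; intros Hno.
assert (H : Rbar_le (integral_0_infty f) M).
{ unfold integral_0_infty, Lim; rewrite <- (Lim_seq_const M).
  apply Lim_seq_le_loc; exists 0%nat; intros n _; simpl.
  assert (Hn := pos_INR n).
  replace (RInt f 0 (INR n)) with (RInt fc 0 (INR n)).
  - apply Rnot_lt_le; intros Hlt; apply Hno; exists (INR n); lra.
  - apply RInt_ext; rewrite Rmin_left, Rmax_right by lra; intros x Hx; symmetry; apply Heq; lra. }
rewrite Hinf in H; exact H.
Qed.

Lemma exp_nondecreasing x y : x <= y -> exp x <= exp y.
Proof. intros [H| ->]; [now apply Rlt_le, exp_increasing|lra]. Qed.

Lemma sqrt_le_of_sqr x y : 0 <= y -> x <= y ^ 2 -> sqrt x <= y.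
Proof. intros Hy Hx; rewrite <- (sqrt_pow2 y Hy); now apply sqrt_le_1_alt. Qed.

Lemma sqr_lt_of_sqrt_lt x y : 0 <= x -> sqrt x < y -> x < y ^ 2.
Proof.
intros Hx Hy; rewrite <- (pow2_sqrt x Hx).
assert (H := sqrt_pos x); nra.
Qed.

(* The estimates of [solution_estimates], as hypotheses on the coefficient [gt] of the
   comparison equation. *)
Definition comparison (c0 Lam et hn omega xi t0 : R) (gt D2 V V' : R -> R) : Prop :=
  (forall t, 0 <= D2 t) /\
  (forall t, t0 <= t -> continuous D2 t) /\ (forall t, t0 <= t -> continuous V t) /\
  (forall t, t0 < t -> is_derive V t (V' t)) /\
  (forall t, t0 <= t -> D2 t <= xi ^ 2 -> c0 * D2 t <= V t /\ V t <= Lam * gt t * D2 t) /\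
  (forall t, t0 < t -> D2 t <= xi ^ 2 ->
     V' t <= - et * D2 t + hn * rpow (sqrt (D2 t)) omega * gt t * D2 t).

(** With [gt <= gs], a small [d] makes the superlinear term at most half of [et d^2], whence
    [V' <= - 2 E V] below a constant barrier. *)
Lemma comparison_exponential c0 Lam et hn omega xi gs :
  0 < c0 -> 0 < Lam -> 0 < et -> 0 <= hn -> 0 < omega -> 0 < xi -> 0 < gs ->
  exists delta D E, 0 < delta /\ 0 < D /\ 0 < E /\
  forall t0 gt D2 V V', comparison c0 Lam et hn omega xi t0 gt D2 V V' ->
  (forall t, t0 <= t -> 0 <= gt t <= gs) ->
  sqrt (D2 t0) < delta ->
  forall t, t0 <= t -> sqrt (D2 t) <= D * exp (- E * (t - t0)) * sqrt (D2 t0).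
Proof.
intros Hc Hlam Het Hhn Hom Hxi Hgs.
assert (HLg : 0 < Lam * gs) by (now apply Rmult_lt_0_compat).
destruct (rpow_small omega (et / 2 / ((hn + 1) * gs)) Hom) as (x1 & Hx1 & Hx1').
{ repeat apply Rdiv_lt_0_compat; try lra; apply Rmult_lt_0_compat; lra. }
set (b := Rmin xi x1).
assert (Hb : 0 < b) by (now apply Rmin_glb_lt).
assert (Hb1 : b <= xi) by apply Rmin_l.
assert (Hb2 : b <= x1) by apply Rmin_r.
(* The [+ 1] lets the single condition [d(t0) < b / D] give both [D2 t0 < b^2] and
   [Lam gs D2 t0 < c0 b^2]. *)
set (D := sqrt (Lam * gs / c0 + 1)).
assert (HD : 1 <= D).
{ rewrite <- sqrt_1; apply sqrt_le_1_alt.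
  assert (0 < Lam * gs / c0) by (now apply Rdiv_lt_0_compat); lra. }
assert (HD2 : D ^ 2 = Lam * gs / c0 + 1).
{ apply pow2_sqrt; assert (0 < Lam * gs / c0) by (now apply Rdiv_lt_0_compat); lra. }
(* One factor 2 is lost to the superlinear term, the other in passing from [d^2] to [d]. *)
set (E := et / (4 * (Lam * gs))).
assert (HE : 0 < E) by (apply Rdiv_lt_0_compat; lra).
exists (b / D), D, E; split; [apply Rdiv_lt_0_compat; lra|]; split; [lra|]; split; [assumption|].
intros t0 gt D2 V V' (HD0 & CD & CV & DV & Hlow & Hdec) Hg Hinit.
apply sqr_lt_of_sqrt_lt in Hinit; [|apply HD0].
assert (HbD : c0 * (b / D) ^ 2 * D ^ 2 = c0 * b ^ 2) by (field; lra).
rewrite HD2 in HbD.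
assert (HbD0 : 0 <= (b / D) ^ 2) by apply pow2_ge_0.
assert (HbD' : (Lam * gs + c0) * (b / D) ^ 2 = c0 * b ^ 2).
{ rewrite <- HbD; field; lra. }
assert (Hb2x : b ^ 2 <= xi ^ 2) by (apply pow_incr; lra).
assert (Hinit' : (Lam * gs + c0) * D2 t0 < c0 * b ^ 2)
  by (rewrite <- HbD'; apply Rmult_lt_compat_l; lra).
assert (Hi0 : D2 t0 < b ^ 2).
{ apply Rmult_lt_reg_l with c0; [assumption|].
  assert (0 <= Lam * gs * D2 t0) by (apply Rmult_le_pos; [lra|apply HD0]); lra. }
assert (HV0 : V t0 <= Lam * gs * D2 t0).
{ eapply Rle_trans; [apply (Hlow t0); lra|].
  apply Rmult_le_compat_r; [apply HD0|]; apply Rmult_le_compat_l; [lra|apply Hg; lra]. }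
assert (Hexp : forall t, t0 <= t -> 0 < exp (- (2 * E) * t - - (2 * E) * t0) <= 1).
{ intros t Htt; split; [apply exp_pos|]; rewrite <- exp_0; apply exp_nondecreasing.
  assert (0 <= 2 * E * (t - t0)) by (apply Rmult_le_pos; lra); lra. }
assert (Hbar : forall t, t0 <= t ->
  c0 * D2 t <= V t0 * exp (- (2 * E) * t - - (2 * E) * t0)).
{ apply (barrier D2 V V' (fun t => - (2 * E) * t) (fun _ => - (2 * E)) (fun _ => b ^ 2)); auto.
  - intros t _; apply continuous_Rscal, continuous_id.
  - intros t _; apply continuous_const.
  - intros t _; auto_derive; [trivial|ring].
  - intros t Htt H; apply (Hlow t Htt); lra.
  - intros t Htt H; eapply Rle_trans; [apply (Hdec t Htt); lra|].
    destruct (Hlow t ltac:(lra) ltac:(lra)) as [_ Hup].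
    destruct (Hg t ltac:(lra)) as [Hg0 Hgt].
    assert (Hr : rpow (sqrt (D2 t)) omega <= et / 2 / ((hn + 1) * gs)).
    { eapply Rle_trans; [apply (rpow_le _ x1); auto|exact Hx1'].
      eapply Rle_trans; [|exact Hb2]; apply sqrt_le_of_sqr; lra. }
    assert (Hr0 := rpow_nonneg (sqrt (D2 t)) omega).
    assert (HX : hn * rpow (sqrt (D2 t)) omega * gt t <= et / 2).
    { apply Rle_trans with ((hn + 1) * (et / 2 / ((hn + 1) * gs)) * gs).
      - apply Rmult_le_compat; auto; [apply Rmult_le_pos; lra|].
        apply Rmult_le_compat; lra.
      - apply Req_le; field; lra. }
    assert (HX' : hn * rpow (sqrt (D2 t)) omega * gt t * D2 t <= et / 2 * D2 t)
      by (apply Rmult_le_compat_r; auto).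
    assert (Hup' : V t <= Lam * gs * D2 t).
    { eapply Rle_trans; [exact Hup|]; apply Rmult_le_compat_r; auto.
      apply Rmult_le_compat_l; lra. }
    assert (2 * E * V t <= et / 2 * D2 t).
    { apply Rle_trans with (2 * E * (Lam * gs * D2 t)).
      - apply Rmult_le_compat_l; lra.
      - apply Req_le; unfold E; field; lra. }
    lra.
  - intros t Htt; specialize (Hexp t Htt).
    apply Rle_lt_trans with (Lam * gs * D2 t0).
    + apply Rle_trans with (Lam * gs * D2 t0 * exp (- (2 * E) * t - - (2 * E) * t0)).
      * apply Rmult_le_compat_r; lra.
      * assert (0 <= Lam * gs * D2 t0) by (apply Rmult_le_pos; [lra|apply HD0]).
        rewrite <- (Rmult_1_r (Lam * gs * D2 t0)) at 2; apply Rmult_le_compat_l; lra.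
    + assert (0 <= c0 * D2 t0) by (apply Rmult_le_pos; [lra|apply HD0]); lra. }
intros t Htt.
assert (H1 := Hbar t Htt).
set (ex := exp (- E * (t - t0))).
assert (Hex : exp (- (2 * E) * t - - (2 * E) * t0) = ex ^ 2).
{ unfold ex; simpl; rewrite Rmult_1_r, <- exp_plus; f_equal; ring. }
assert (Hex0 : 0 < ex) by apply exp_pos.
rewrite Hex in H1.
apply sqrt_le_of_sqr.
- repeat apply Rmult_le_pos; try lra; apply sqrt_pos.
- rewrite !Rpow_mult_distr, HD2, (pow2_sqrt (D2 t0)) by apply HD0.
  apply Rmult_le_reg_l with c0; [assumption|].
  replace (c0 * ((Lam * gs / c0 + 1) * ex ^ 2 * D2 t0)) with
    ((Lam * gs * D2 t0) * ex ^ 2 + c0 * D2 t0 * ex ^ 2) by (field; lra).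
  assert (0 <= ex ^ 2) by apply pow2_ge_0.
  assert (V t0 * ex ^ 2 <= Lam * gs * D2 t0 * ex ^ 2) by (apply Rmult_le_compat_r; lra).
  assert (0 <= c0 * D2 t0 * ex ^ 2) by (repeat apply Rmult_le_pos; auto; lra).
  lra.
Qed.

(* With [p' = et / (Lam gt)], the barrier [b^2 exp (- (p - p t0))] turns the superlinear term
   into a linear one with a coefficient that is integrable by [Hq]; this replaces the
   explicit solution of the Bernoulli equation. *)
Lemma comparison_decay c0 Lam et hn omega xi t0 (gt p q : R -> R) Gam :
  0 < c0 -> 0 < Lam -> 0 < et -> 0 <= hn -> 0 < omega -> 0 < xi -> 0 <= Gam ->
  (forall t, t0 <= t -> 0 < gt t) ->
  (forall t, t0 <= t -> is_derive p t (et / (Lam * gt t))) ->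
  (forall t, t0 <= t -> is_derive q t (exp (- (omega / 2) * p t) * gt t)) ->
  (forall t, t0 <= t -> p t0 <= p t) ->
  (forall t, t0 <= t -> hn * (q t - q t0) <= Gam) ->
  exists delta K, 0 < delta /\ 0 < K /\
  forall D2 V V', comparison c0 Lam et hn omega xi t0 gt D2 V V' ->
  sqrt (D2 t0) < delta ->
  forall t, t0 <= t -> D2 t <= K * D2 t0 * exp (- (p t - p t0)).
Proof.
intros Hc Hlam Het Hhn Hom Hxi HGam Hg Dp Dq Hpm Hq.
set (w := exp (omega / 2 * p t0)).
assert (Hw : 0 < w) by apply exp_pos.
(* [w] restores the normalization at [t0]: [w exp (- (omega / 2) p)] is
   [exp (- (omega / 2) (p - p t0))]. The bound on [x1] makes [Z (q t - q t0) <= 1]. *)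
destruct (rpow_small omega (c0 / (w * (Gam + 1))) Hom) as (x1 & Hx1 & Hx1').
{ apply Rdiv_lt_0_compat; auto; apply Rmult_lt_0_compat; lra. }
set (b := Rmin xi x1).
assert (Hb : 0 < b) by (now apply Rmin_glb_lt).
assert (Hb1 : b <= xi) by apply Rmin_l.
assert (Hb2 : b <= x1) by apply Rmin_r.
assert (Hb2x : b ^ 2 <= xi ^ 2) by (apply pow_incr; lra).
assert (Hrb : rpow b omega <= c0 / (w * (Gam + 1)))
  by (eapply Rle_trans; [now apply (rpow_le b x1)|exact Hx1']).
assert (Hrb0 := rpow_nonneg b omega).
set (Z := hn / c0 * rpow b omega * w).
assert (HZ0 : 0 <= hn / c0) by (apply Rdiv_le_0_compat; lra).
assert (HZ : forall t, t0 <= t -> Z * (q t - q t0) <= 1).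
{ intros t Htt; unfold Z.
  replace (hn / c0 * rpow b omega * w * (q t - q t0)) with
    (rpow b omega * w / c0 * (hn * (q t - q t0))) by (field; lra).
  apply Rle_trans with (rpow b omega * w / c0 * Gam).
  - apply Rmult_le_compat_l; [|now apply Hq].
    apply Rdiv_le_0_compat; [apply Rmult_le_pos|]; lra.
  - apply Rle_trans with (c0 / (w * (Gam + 1)) * w / c0 * Gam).
    + apply Rmult_le_compat_r; [lra|]; apply Rmult_le_compat_r; [apply Rlt_le, Rinv_0_lt_compat; lra|].
      apply Rmult_le_compat_r; lra.
    + apply Rmult_le_reg_r with (Gam + 1); [lra|].
      replace (c0 / (w * (Gam + 1)) * w / c0 * Gam * (Gam + 1)) with Gam by (field; lra). lra. }
assert (Hg0 := Hg t0 (Rle_refl _)).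
(* [exp 1] covers the whole effect of the superlinear term; through [gt t0] the constant depends on
   [t0]. *)
set (K := Lam * gt t0 * exp 1 / c0).
assert (HLg : 0 < Lam * gt t0) by (now apply Rmult_lt_0_compat).
assert (He1 : 1 < exp 1) by (assert (H := exp_ineq1 1); lra).
assert (HK : 0 < K) by (apply Rdiv_lt_0_compat; auto; apply Rmult_lt_0_compat; lra).
set (s := sqrt (K + 1)).
assert (Hs2 : s ^ 2 = K + 1) by (apply pow2_sqrt; lra).
assert (Hs : 1 <= s) by (rewrite <- sqrt_1; apply sqrt_le_1_alt; lra).
exists (b / s), K; split; [apply Rdiv_lt_0_compat; lra|]; split; [assumption|].
intros D2 V V' (HD0 & CD & CV & DV & Hlow & Hdec) Hinit.
apply sqr_lt_of_sqrt_lt in Hinit; [|apply HD0].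
assert (Hinit' : (K + 1) * D2 t0 < b ^ 2).
{ rewrite <- Hs2; replace (b ^ 2) with (s ^ 2 * (b / s) ^ 2) by (field; lra).
  apply Rmult_lt_compat_l; [rewrite Hs2; lra|assumption]. }
assert (HKD : 0 <= K * D2 t0) by (apply Rmult_le_pos; [lra|apply HD0]).
set (ep := fun t => exp (- (p t - p t0))).
assert (Hep : forall t, t0 <= t -> 0 < ep t <= 1).
{ intros t Htt; split; [apply exp_pos|]; unfold ep; rewrite <- exp_0; apply exp_nondecreasing.
  specialize (Hpm t Htt); lra. }
assert (Hep0 : ep t0 = 1) by (unfold ep; rewrite <- exp_0; f_equal; ring).
assert (Cp : forall t, t0 <= t -> continuous p t)
  by (intros; eapply is_derive_continuous; now apply Dp).
assert (Cq : forall t, t0 <= t -> continuous q t)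
  by (intros; eapply is_derive_continuous; now apply Dq).
set (Q := fun t => - 1 * p t + Z * q t).
assert (HQ : forall t, t0 <= t -> exp (Q t - Q t0) <= exp 1 * ep t).
{ intros t Htt; unfold ep; rewrite <- exp_plus; apply exp_nondecreasing; unfold Q.
  specialize (HZ t Htt); lra. }
assert (HV0 : V t0 <= Lam * gt t0 * D2 t0) by (apply (Hlow t0); lra).
assert (HVexp : forall t, t0 <= t -> V t0 * exp (Q t - Q t0) <= c0 * (K * D2 t0 * ep t)).
{ intros t Htt.
  replace (c0 * (K * D2 t0 * ep t)) with (Lam * gt t0 * D2 t0 * (exp 1 * ep t))
    by (unfold K; field; lra).
  assert (H := HQ t Htt); assert (H0 := exp_pos (Q t - Q t0)).
  assert (0 <= Lam * gt t0 * D2 t0) by (apply Rmult_le_pos; [lra|apply HD0]).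
  apply Rle_trans with (Lam * gt t0 * D2 t0 * exp (Q t - Q t0)).
  - apply Rmult_le_compat_r; lra.
  - now apply Rmult_le_compat_l. }
intros t Htt.
apply Rmult_le_reg_l with c0; [assumption|].
eapply Rle_trans; [|now apply HVexp].
revert t Htt.
apply (barrier D2 V V' Q
  (fun t => - 1 * (et / (Lam * gt t)) + Z * (exp (- (omega / 2) * p t) * gt t))
  (fun t => b ^ 2 * ep t)); auto.
- intros t Htt; apply continuous_Rplus; apply continuous_Rscal; auto.
- intros t Htt; apply continuous_Rscal.
  apply (continuous_comp (fun t => - (p t - p t0)) exp).
  + apply (continuous_opp (fun t => p t - p t0)), (continuous_minus p (fun _ => p t0)); auto.
    apply continuous_const.
  + apply (ex_derive_continuous exp), ex_derive_Reals_1, derivable_pt_exp.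
- intros t Htt; apply (is_derive_plus (fun t => - 1 * p t) (fun t => Z * q t)).
  + apply (is_derive_scal p); apply Dp; lra.
  + apply (is_derive_scal q); apply Dq; lra.
- intros t Htt H; apply (Hlow t Htt).
  destruct (Hep t Htt) as [H0 H1].
  assert (b ^ 2 * ep t <= b ^ 2 * 1) by (apply Rmult_le_compat_l; [apply pow2_ge_0|assumption]). lra.
- intros t Htt H.
  destruct (Hep t ltac:(lra)) as [H0 H1].
  assert (Hbt : b ^ 2 * ep t <= b ^ 2 * 1) by (apply Rmult_le_compat_l; [apply pow2_ge_0|assumption]).
  eapply Rle_trans; [apply (Hdec t Htt); lra|].
  destruct (Hlow t ltac:(lra) ltac:(lra)) as [Hl Hup].
  assert (Hgt := Hg t ltac:(lra)).
  assert (E1 : et / (Lam * gt t) * V t <= et * D2 t).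
  { assert (HLt : 0 < Lam * gt t) by (now apply Rmult_lt_0_compat).
    apply Rle_trans with (et / (Lam * gt t) * (Lam * gt t * D2 t)).
    - apply Rmult_le_compat_l; [apply Rdiv_le_0_compat; lra|assumption].
    - apply Req_le; field; split; apply Rgt_not_eq; assumption. }
  set (em := exp (- (omega / 2) * p t)).
  assert (Hem : 0 < em) by apply exp_pos.
  (* Below the barrier [d <= b exp (- (p - p t0) / 2)]; hence the exponent [omega / 2] in [G]. *)
  assert (Hr : rpow (sqrt (D2 t)) omega <= rpow b omega * w * em).
  { replace (rpow b omega * w * em) with (rpow (b * exp (- (p t - p t0) / 2)) omega).
    - apply rpow_le; [assumption|]; apply sqrt_le_of_sqr.
      + apply Rmult_le_pos; [lra|apply Rlt_le, exp_pos].
      + rewrite Rpow_mult_distr; simpl (exp _ ^ 2); rewrite Rmult_1_r, <- exp_plus.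
        replace (- (p t - p t0) / 2 + - (p t - p t0) / 2) with (- (p t - p t0)) by field.
        exact H.
    - rewrite rpow_mult_exp by assumption; unfold w, em.
      rewrite Rmult_assoc, <- exp_plus; do 2 f_equal; field. }
  assert (Hr0 := rpow_nonneg (sqrt (D2 t)) omega).
  assert (E2 : hn * rpow (sqrt (D2 t)) omega * gt t * D2 t <= Z * (em * gt t) * V t).
  { replace (Z * (em * gt t) * V t) with (hn * (rpow b omega * w * em) * gt t * (V t / c0))
      by (unfold Z; field; lra).
    apply Rmult_le_compat; auto.
    - apply Rmult_le_pos; [apply Rmult_le_pos|]; lra.
    - apply Rmult_le_compat_r; [lra|]; apply Rmult_le_compat_l; lra.
    - apply Rmult_le_reg_l with c0; [assumption|].
      replace (c0 * (V t / c0)) with (V t) by (field; lra). lra. }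
  lra.
- rewrite Hep0; lra.
- intros t Htt; eapply Rle_lt_trans; [now apply HVexp|].
  apply Rmult_lt_compat_l; [assumption|].
  apply Rmult_lt_compat_r; [apply (Hep t Htt)|].
  assert (H := HD0 t0); lra.
Qed.

(** * Proof of the stability theorem *)

Lemma ex_derive_in_continuous_on (D : R -> Prop) (f : R -> R) :
  (forall x, D x -> ex_derive_in D f x) -> continuous_on D f.
Proof.
intros Hf x Hx; destruct (Hf x Hx) as [l Hl].
apply (filterdiff_continuous_aux f (F := within D (locally x))).
- exists (fun y => scal y l); exact Hl.
- intros P HP; unfold within; revert HP; apply filter_imp; auto.
Qed.

Lemma sup_pos_ge f : Rbar_lt (sup_pos f) p_infty -> forall t, 0 < t -> f t <= real (sup_pos f).
Proof.
intros Hf t Ht; unfold sup_pos in *.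
set (E := fun y : R => exists t, 0 < t /\ y = f t) in *.
destruct (Lub_Rbar_correct E) as [Hub _].
assert (H : Rbar_le (f t) (Lub_Rbar E)) by (apply Hub; now exists t).
destruct (Lub_Rbar E); simpl in *; tauto.
Qed.

Lemma sigma'_M_witness eps C F a' h A omega mu tau theta :
  Rbar_lt 0 (sigma'_M eps C F a' h A omega mu tau theta) ->
  exists sigma, 0 < sigma /\ Rbar_lt (G eps C F a' h A omega mu tau theta sigma) p_infty.
Proof.
intros H; apply NNPP; intros Hno.
unfold sigma'_M in H.
set (E := fun sigma : R => sigma = 0 \/ 0 < sigma /\
  Rbar_lt (G eps C F a' h A omega mu tau theta sigma) p_infty) in *.
destruct (Lub_Rbar_correct E) as [_ Hlub].
assert (H0 : Rbar_le (Lub_Rbar E) 0).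
{ apply Hlub; intros s [-> |Hs]; [apply Rbar_le_refl|].
  exfalso; apply Hno; now exists s. }
exact (Rbar_le_not_lt _ _ H0 H).
Qed.

Theorem theorem3p1 :
  forall (eps C F : R -> R) (a' : R) (a : R -> R -> R -> R -> R -> R -> R)
    (k h A omega rho mu tau theta : R),
  C2_on (from 0) eps -> (forall t, 0 <= t -> 0 <= eps t) ->
  C1_on (from 0) C -> (forall t, 0 <= t -> 0 < C t) ->
  (forall z, ex_derive F z /\ continuous (Derive F) z) ->
  let ebar := real (inf_pos eps) in
  let eddbar := inf_pos (dot (dot eps)) in
  let Cbar := real (inf_pos C) in
  let sol := is_solution eps C F a' a in
  0 < Cbar ->
  0 <= k -> 0 <= h -> 0 <= A ->
  0 < omega -> 0 < rho -> 0 < mu -> 0 < tau ->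
  F 0 = 0 ->
  (forall z, Rabs z < rho -> Derive F z <= k + h * rpow (Rabs z) omega) ->
  k < Cbar ->
  (forall t, 0 <= t -> mu * (1 + eps t) <= C t - dot eps t) ->
  0 < mu + Cbar / 2 - 2 * k ->
  Rbar_lt m_infty eddbar ->
  (forall t0 u0 u1 u, 0 <= t0 -> sol t0 u0 u1 u ->
     forall x t, 0 < x < PI -> t0 < t ->
     0 <= along a t0 u x t <= A * rpow (dsol eps t0 u t) tau) ->
  0 < a' + ebar / 2 ->
  ((forall t, 0 <= t -> dot C t <= 0) \/ is_lim (dot C) p_infty 0) ->
  theta2 a' k mu ebar (real eddbar) Cbar < theta ->
  (Rbar_lt 0 (sigma'_M eps C F a' h A omega mu tau theta) ->
     stable eps sol) /\
  (Rbar_lt 0 (sigma'_M eps C F a' h A omega mu tau theta) ->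
     integral_0_infty (fun t => / g eps C t) = p_infty ->
     asymptotically_stable eps sol) /\
  (Rbar_lt (sup_pos (g eps C)) p_infty ->
     uniformly_stable eps sol /\ uniformly_exp_asymptotically_stable eps sol).
Proof.
intros eps C F a' a k h A omega rho mu tau theta Heps2 Heps HC1 HC HF ebar eddbar Cbar sol
  HCb Hk Hh HA Hom Hrho Hmu Htau F0 HFk HkC HQ Hden Hedd Ha Hae HdC Hth.
destruct (inf_pos_ge eps 0 (fun t H => Heps t (Rlt_le _ _ H))) as [He1 He2].
destruct (inf_pos_ge C 0 (fun t H => Rlt_le _ _ (HC t (Rlt_le _ _ H)))) as [HCb1 _].
destruct (theta2_facts _ _ _ _ _ _ _ Hmu HCb Hae Hden Hth) as (Ht & _ & Ht2 & _).
assert (Hn0 : 0 < 2 / mu + theta) by (assert (0 < 2 / mu) by (apply Rdiv_lt_0_compat; lra); lra).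
assert (Hg1 : forall t, 0 <= t -> 1 <= g eps C t).
{ intros t Htt; assert (H1 := HQ t Htt); assert (H2 := HC t Htt).
  assert (0 <= mu * eps t) by (apply Rmult_le_pos; [lra|auto]). unfold g; lra. }
assert (Heta : 0 < eta mu) by (unfold eta; apply Rmin_glb_lt; lra).
set (Lam := fun sigma => (1 + m F sigma) * (1 + gamma3 a' A mu tau theta ebar Cbar sigma)).
assert (HLam : forall sigma, 0 < sigma -> 0 < Lam sigma).
{ intros sigma Hs.
  destruct (gamma3_facts a' A mu tau theta ebar Cbar k sigma He2 HCb Hmu Hk Hae Ht Ht2) as (H2 & _).
  destruct (m_bound F sigma ltac:(lra) (fun z => proj2 (HF z))) as [Hm0 _].
  apply Rmult_lt_0_compat; lra. }
assert (Hest : forall sigma, 0 < sigma ->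
  exists kappa c0 xi, 1 <= kappa /\ 0 < c0 /\ 0 < xi /\
  forall t0 u0 u1 u, kappa <= t0 -> sol t0 u0 u1 u ->
  exists D2 V V' : R -> R, (forall t, t0 <= t -> dsol eps t0 u t = sqrt (D2 t)) /\
    comparison c0 (Lam sigma) (eta mu) (h * (2 / mu + theta)) omega xi t0 (g eps C) D2 V V').
{ intros sigma Hs.
  destruct (solution_estimates eps C F a' a k h A omega rho mu tau theta sigma ebar (real eddbar) Cbar)
    as (kappa & c0 & xi & Hkap & Hc0 & Hxi & Hall); auto.
  - apply dot_correct, Heps2.
  - apply dot_correct, Heps2.
  - now apply dot_correct.
  - now apply inf_pos_le.
  - now apply inf_pos_le.
  - now apply inf_pos_le.
  - exists kappa, c0, xi; do 3 (split; [assumption|]).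
    intros t0 u0 u1 u Ht0 Hsol.
    destruct (Hall t0 u0 u1 u Ht0 Hsol) as (D2 & V & V' & Hd & HD0 & CD & CV & DV & Hlow & Hdec).
    exists D2, V, V'; split; [exact Hd|]; repeat (split; [assumption|]).
    intros t Htt H; eapply Rle_trans; [now apply Hdec|]; apply Req_le; ring. }
(* [g] frozen at its value at 0 for negative times, hence continuous everywhere. *)
set (gc := fun t => g eps C (Rmax 0 t)).
assert (Cgc : forall t, continuous gc t).
{ intros t; unfold gc.
  assert (Hr : forall f : R -> R, continuous_on (from 0) f -> continuous (fun s => f (Rmax 0 s)) t).
  { intros f Hf; apply (continuous_on_comp (from 0) f (Rmax 0) t Hf).
    - intros s; apply Rmax_l.
    - apply continuous_Rmax_l. }
  unfold g; apply continuous_Rplus; [|apply continuous_const].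
  apply (continuous_minus (fun s => C (Rmax 0 s)) (fun s => dot eps (Rmax 0 s) / 2)).
  - apply Hr, ex_derive_in_continuous_on, HC1.
  - apply (continuous_Rmult (fun s => dot eps (Rmax 0 s))); [|apply continuous_const].
    apply (Hr (dot eps)), Heps2. }
assert (Hgc1 : forall t, 1 <= gc t) by (intros t; apply Hg1, Rmax_l).
assert (Hgc : forall t, 0 <= t -> g eps C t = gc t) by (intros t H; unfold gc; now rewrite Rmax_right).
assert (Cig : forall t, continuous (fun s => / gc s) t).
{ intros t; apply (continuous_comp gc Rinv); [apply Cgc|].
  apply continuous_Rinv; specialize (Hgc1 t); lra. }
assert (Hig : forall t, 0 < / gc t) by (intros t; apply Rinv_0_lt_compat; specialize (Hgc1 t); lra).
(* As [eta mu / Lam sigma] is [lambda], the integrand of [G] is [exp (- (omega / 2) p) g]. *)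
set (p := fun sigma t => eta mu / Lam sigma * RInt (fun s => / gc s) 0 t).
assert (Hlam : forall sigma, 0 < sigma -> 0 < eta mu / Lam sigma)
  by (intros; apply Rdiv_lt_0_compat; auto).
assert (Hpm : forall sigma, 0 < sigma -> forall s t, 0 <= s <= t -> p sigma s <= p sigma t).
{ intros sigma Hs s t Hst; apply Rmult_le_compat_l; [now apply Rlt_le, Hlam|].
  apply RInt_0_monotone; auto; intros; now apply Rlt_le. }
assert (Hdecay : Rbar_lt 0 (sigma'_M eps C F a' h A omega mu tau theta) ->
  exists kappa sigma, 1 <= kappa /\ 0 < sigma /\ forall t0, kappa <= t0 ->
  exists delta K, 0 < delta /\ 0 < K /\ forall u0 u1 u, sol t0 u0 u1 u -> dsol eps t0 u t0 < delta ->
  forall t, t0 <= t ->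
  dsol eps t0 u t ^ 2 <= K * dsol eps t0 u t0 ^ 2 * exp (- (p sigma t - p sigma t0))).
{ intros HM; destruct (sigma'_M_witness _ _ _ _ _ _ _ _ _ _ HM) as (sigma & Hs & HG).
  assert (Hl := Hlam sigma Hs); assert (HL := HLam sigma Hs).
  destruct (Hest sigma Hs) as (kappa & c0 & xi & Hkap & Hc0 & Hxi & Hall).
  set (iq := fun s => exp (- (omega / 2) * p sigma s) * gc s).
  assert (Dp : forall t, is_derive (p sigma) t (eta mu / Lam sigma * / gc t)).
  { intros t; apply (is_derive_scal (fun t => RInt (fun s => / gc s) 0 t)).
    now apply (is_derive_RInt_upper (fun s => / gc s)). }
  assert (Ciq : forall t, continuous iq t).
  { intros t; apply continuous_Rmult; auto.
    apply (continuous_comp (fun s => - (omega / 2) * p sigma s) exp).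
    - apply continuous_Rscal; eapply is_derive_continuous, Dp.
    - apply (ex_derive_continuous exp), ex_derive_Reals_1, derivable_pt_exp. }
  assert (Hiq : forall t, 0 <= iq t).
  { intros t; apply Rmult_le_pos; [apply Rlt_le, exp_pos|specialize (Hgc1 t); lra]. }
  (* The factor [h] stays in the bound because for [h = 0] finiteness of [G] says nothing about the
     integral. *)
  assert (HGam : exists Gam, forall T, 0 <= T -> h * RInt iq 0 T <= Gam).
  { unfold G in HG; destruct (Req_EM_T h 0) as [-> |Hh0].
    - exists 0; intros T _; lra.
    - set (f := fun s => exp (- (omega * lambda F a' A mu tau theta (real (inf_pos eps))
        (real (inf_pos C)) sigma / 2) * RInt (fun s' => / g eps C s') 0 s) * g eps C s) in HG.
      destruct (integral_0_infty_bounded f iq Ciq (fun t _ => Hiq t)) as [M HMb].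
      + intros t Htt; unfold f, iq; rewrite (Hgc t Htt); f_equal; f_equal.
        unfold p; replace (RInt (fun s' => / g eps C s') 0 t) with (RInt (fun s => / gc s) 0 t).
        * change (lambda F a' A mu tau theta (real (inf_pos eps)) (real (inf_pos C)) sigma)
            with (eta mu / Lam sigma); field; lra.
        * apply RInt_ext; rewrite Rmin_left, Rmax_right by lra; intros x Hx; rewrite Hgc; auto; lra.
      + intros Hinf; rewrite Hinf in HG; revert HG; simpl.
        destruct (Rle_dec 0 h) as [Hle|]; [|lra].
        destruct (Rle_lt_or_eq_dec 0 h Hle) as [|]; simpl; [tauto|intros _; lra].
      + exists (h * M); intros T HT; apply Rmult_le_compat_l; auto. }
  destruct HGam as [Gam HGam].
  assert (HGam0 : 0 <= Gam).
  { specialize (HGam 0 (Rle_refl _)); rewrite RInt_point in HGam; unfold zero in HGam; simpl in HGam; lra. }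
  exists kappa, sigma; split; [assumption|]; split; [assumption|].
  intros t0 Ht0.
  destruct (comparison_decay c0 (Lam sigma) (eta mu) (h * (2 / mu + theta)) omega xi t0 (g eps C)
    (p sigma) (fun t => RInt iq 0 t) ((2 / mu + theta) * Gam)) as (delta & K & Hdel & HK & Hcmp);
    auto.
  - apply Rmult_le_pos; lra.
  - apply Rmult_le_pos; lra.
  - intros t Htt; specialize (Hg1 t); lra.
  - intros t Htt; rewrite Hgc by lra.
    replace (eta mu / (Lam sigma * gc t)) with (eta mu / Lam sigma * / gc t); [apply Dp|].
    specialize (Hgc1 t); field; lra.
  - intros t Htt; rewrite Hgc by lra; apply (is_derive_RInt_upper iq 0 Ciq).
  - intros t Htt; apply Hpm; auto; lra.
  - intros t Htt.
    assert (0 <= RInt iq 0 t0) by (apply RInt_ge_0_continuous; auto; lra).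
    assert (0 <= h * RInt iq 0 t0) by (now apply Rmult_le_pos).
    assert (h * RInt iq 0 t <= Gam) by (apply HGam; lra).
    replace (h * (2 / mu + theta) * (RInt iq 0 t - RInt iq 0 t0)) with
      ((2 / mu + theta) * (h * RInt iq 0 t - h * RInt iq 0 t0)) by ring.
    apply Rmult_le_compat_l; lra.
  - exists delta, K; split; [assumption|]; split; [assumption|].
    intros u0 u1 u Hsol Hinit t Htt.
    destruct (Hall t0 u0 u1 u Ht0 Hsol) as (D2 & V & V' & Hd & Hc).
    rewrite Hd in Hinit by lra; rewrite !Hd by lra.
    rewrite !pow2_sqrt by apply Hc.
    now apply (Hcmp D2 V V'). }
assert (Hdnn : forall t0 u t, 0 <= dsol eps t0 u t) by (intros; apply sqrt_pos).
assert (Hstab : forall kappa sigma, 1 <= kappa -> 0 < sigma -> (forall t0, kappa <= t0 ->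
  exists delta K, 0 < delta /\ 0 < K /\ forall u0 u1 u, sol t0 u0 u1 u -> dsol eps t0 u t0 < delta ->
  forall t, t0 <= t ->
  dsol eps t0 u t ^ 2 <= K * dsol eps t0 u t0 ^ 2 * exp (- (p sigma t - p sigma t0))) ->
  stable_with kappa 1 eps sol).
{ intros kappa sigma Hkap Hs Hall s t0 Hs1 Ht0 _.
  destruct (Hall t0 Ht0) as (delta & K & Hdel & HK & Hd).
  (* [d(t0) < s / r] gives [(K + 1) d(t0)^2 < s^2]. This works for every positive [s], so the
     threshold 1 is arbitrary. *)
  set (r := sqrt (K + 1)).
  assert (Hr2 : r ^ 2 = K + 1) by (apply pow2_sqrt; lra).
  assert (Hr : 1 <= r) by (rewrite <- sqrt_1; apply sqrt_le_1_alt; lra).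
  exists (Rmin delta (s / r)); split; [apply Rmin_glb_lt; auto; apply Rdiv_lt_0_compat; lra|].
  intros u0 u1 u Hsol Hinit t Htt.
  assert (Hi1 := Rlt_le_trans _ _ _ Hinit (Rmin_l _ _)).
  assert (Hi2 := Rlt_le_trans _ _ _ Hinit (Rmin_r _ _)).
  assert (H := Hd u0 u1 u Hsol Hi1 t Htt).
  assert (Hexp : 0 < exp (- (p sigma t - p sigma t0)) <= 1).
  { split; [apply exp_pos|]; rewrite <- exp_0; apply exp_nondecreasing.
    assert (p sigma t0 <= p sigma t) by (apply Hpm; auto; lra); lra. }
  set (d0 := dsol eps t0 u t0) in *; set (d := dsol eps t0 u t) in *.
  assert (Hd0 : 0 <= d0) by apply Hdnn; assert (Hd' : 0 <= d) by apply Hdnn.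
  assert (Hrd : r * d0 < s).
  { apply (Rmult_lt_compat_l r) in Hi2; [|lra].
    replace (r * (s / r)) with s in Hi2 by (field; lra); assumption. }
  assert (Hrd2 : (K + 1) * d0 ^ 2 < s ^ 2).
  { rewrite <- Hr2, <- Rpow_mult_distr; assert (0 <= r * d0) by (apply Rmult_le_pos; lra); nra. }
  assert (0 <= d0 ^ 2) by apply pow2_ge_0.
  assert (K * d0 ^ 2 * exp (- (p sigma t - p sigma t0)) <= K * d0 ^ 2 * 1).
  { apply Rmult_le_compat_l; [apply Rmult_le_pos|]; lra. }
  nra. }
split; [|split].
- intros HM; destruct (Hdecay HM) as (kappa & sigma & Hkap & Hs & Hall).
  exists kappa, 1; split; [lra|]; now apply (Hstab kappa sigma).
- intros HM Hinf; destruct (Hdecay HM) as (kappa & sigma & Hkap & Hs & Hall).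
  exists kappa, 1; split; [lra|]; split; [now apply (Hstab kappa sigma)|].
  intros t0 Ht0 _.
  destruct (Hall t0 Ht0) as (delta & K & Hdel & HK & Hd).
  exists delta; split; [assumption|]; intros nu u0 u1 Hnu.
  assert (Hl := Hlam sigma Hs); assert (HL := HLam sigma Hs).
  assert (HKd : 0 < K * delta ^ 2) by (apply Rmult_lt_0_compat; [assumption|now apply pow_lt]).
  assert (Hnu2 : 0 < nu ^ 2 / (K * delta ^ 2 + 1)) by (apply Rdiv_lt_0_compat; [now apply pow_lt|lra]).
  (* A growth of [p] by [Del] brings [K delta^2 exp (- Del)] below [nu^2]; it is reached because the
     integral of [1 / g] diverges, at a time depending on [nu] and [t0] only. *)
  set (Del := - ln (nu ^ 2 / (K * delta ^ 2 + 1))).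
  destruct (integral_0_infty_unbounded (fun t => / g eps C t) (fun s => / gc s)
    (fun t H => f_equal Rinv (Hgc t H)) Hinf ((p sigma t0 + Del) / (eta mu / Lam sigma)))
    as (T & HT0 & HT).
  (* [T] is measured from 0 and may be 0; adding 1 makes the delay positive. *)
  exists (T + 1); split; [lra|]; intros u Hsol Hinit t Htt.
  assert (HpT : p sigma t0 + Del <= p sigma T).
  { unfold p at 2; apply (Rmult_le_compat_l (eta mu / Lam sigma)) in HT; [|lra].
    replace (eta mu / Lam sigma * ((p sigma t0 + Del) / (eta mu / Lam sigma)))
      with (p sigma t0 + Del) in HT by (field; split; apply Rgt_not_eq; assumption); assumption. }
  assert (Hpt : p sigma T <= p sigma t) by (apply Hpm; auto; lra).
  assert (H := Hd u0 u1 u Hsol Hinit t ltac:(lra)).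
  assert (Hexp : exp (- (p sigma t - p sigma t0)) <= nu ^ 2 / (K * delta ^ 2 + 1)).
  { rewrite <- (exp_ln _ Hnu2); apply exp_nondecreasing; fold Del; unfold Del in *; lra. }
  set (d0 := dsol eps t0 u t0) in *; set (d := dsol eps t0 u t) in *.
  assert (Hd0 : 0 <= d0) by apply Hdnn; assert (Hd' : 0 <= d) by apply Hdnn.
  assert (Hd02 : d0 ^ 2 <= delta ^ 2) by (apply pow_incr; lra).
  assert (d ^ 2 < nu ^ 2).
  { eapply Rle_lt_trans; [exact H|].
    apply Rle_lt_trans with (K * delta ^ 2 * (nu ^ 2 / (K * delta ^ 2 + 1))).
    - apply Rmult_le_compat; auto; [apply Rmult_le_pos; [lra|apply pow2_ge_0]|apply Rlt_le, exp_pos|].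
      apply Rmult_le_compat_l; lra.
    - apply Rmult_lt_reg_r with (K * delta ^ 2 + 1); [lra|].
      replace (K * delta ^ 2 * (nu ^ 2 / (K * delta ^ 2 + 1)) * (K * delta ^ 2 + 1))
        with (K * delta ^ 2 * nu ^ 2) by (field; lra).
      assert (0 < nu ^ 2) by now apply pow_lt.
      lra. }
  nra.
- intros Hsup.
  assert (Hgs := sup_pos_ge _ Hsup).
  set (gs := real (sup_pos (g eps C))) in *.
  assert (Hgs1 : 1 <= gs) by (eapply Rle_trans; [apply (Hg1 1)|apply Hgs]; lra).
  (* Any positive [sigma] would do here, since the bound on [g] replaces the integral condition. *)
  destruct (Hest 1 Rlt_0_1) as (kappa & c0 & xi & Hkap & Hc0 & Hxi & Hall).
  destruct (comparison_exponential c0 (Lam 1) (eta mu) (h * (2 / mu + theta)) omega xi gs)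
    as (delta & D & E & Hdel & HD & HE & Hcmp); auto; try lra; [apply HLam; lra|apply Rmult_le_pos; lra|].
  assert (Hexp : forall t0, kappa <= t0 -> forall u0 u1 u, sol t0 u0 u1 u ->
    dsol eps t0 u t0 < delta -> forall t, t0 <= t ->
    dsol eps t0 u t <= D * exp (- E * (t - t0)) * dsol eps t0 u t0).
  { intros t0 Ht0 u0 u1 u Hsol Hinit t Htt.
    destruct (Hall t0 u0 u1 u Ht0 Hsol) as (D2 & V & V' & Hd & Hc).
    rewrite Hd in Hinit by lra; rewrite !Hd by lra.
    apply (Hcmp t0 (g eps C) D2 V V'); auto.
    intros s Hs; split; [specialize (Hg1 s); lra|apply Hgs; lra]. }
  split.
  + exists kappa, 1; split; [lra|]; intros s Hs.
    exists (Rmin delta (s / D)); split; [apply Rmin_glb_lt; auto; apply Rdiv_lt_0_compat; lra|].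
    intros t0 Ht0 _ u0 u1 u Hsol Hinit t Htt.
    assert (Hi1 := Rlt_le_trans _ _ _ Hinit (Rmin_l _ _)).
    assert (Hi2 := Rlt_le_trans _ _ _ Hinit (Rmin_r _ _)).
    eapply Rle_lt_trans; [now apply (Hexp t0 Ht0 u0 u1)|].
    apply Rle_lt_trans with (D * dsol eps t0 u t0).
    * apply Rmult_le_compat_r; [apply Hdnn|].
      rewrite <- (Rmult_1_r D) at 2; apply Rmult_le_compat_l; [lra|].
      rewrite <- exp_0; apply exp_nondecreasing.
      assert (0 <= E * (t - t0)) by (apply Rmult_le_pos; lra); lra.
    * apply (Rmult_lt_compat_l D) in Hi2; [|assumption].
      replace (D * (s / D)) with s in Hi2 by (field; lra); assumption.
  + exists kappa, delta, D, E; do 3 (split; [assumption|]).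
    intros t0 Ht0 _; now apply Hexp.
Qed.
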